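(* Let $I,J\subseteq S$. The set $\{\,C'_{\lambda,z}\mid z\in W^{IJ},\ \lambda\in X(T)^+_z\,\}$, where $C'_{\lambda,z}=C_{w_I}C'_{m_{\lambda,z}}C_{w_J}$, is an $A$-basis of $\mathcal H^{IJ}$ consisting of self-dual elements (that is, $\overline{C'_{\lambda,z}}=C'_{\lambda,z}$), and the map $\chi^{IJ}\colon\mathcal H\to\mathcal H^{IJ}$ may be identified with projection of $\mathcal H$ onto the span of $\{\,C'_{m_{\lambda,z}}\mid z\in W^{IJ},\ \lambda\in X(T)^+_z\,\}$; that is, for $x\in W_{\mathrm{ex}}$, $$\chi^{IJ}(C'_x)=\begin{cases}C'_{\lambda,z}&\text{if }x=m_{\lambda,z}\text{ for some }z\in W^{IJ},\ \lambda\in X(T)^+_z,\\0&\text{otherwise.}\end{cases}$$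
   Context: $G$ is a connected reductive complex algebraic group whose derived group is simply connected, $B\supseteq T$ are a Borel subgroup and a maximal torus, $W=N_G(T)/T$, $S$ is the set of simple reflections determined by $B$, $X(T)$ is the (additive) character group of $T$, $\Phi$ is the root system, $\Phi^+$ is the set of roots of $B$, and $\Pi$ is the corresponding base. $A=\mathbb Z[v,v^{-1}]$. Extended affine Weyl group. $t_\lambda$ is translation by $\lambda\in X(T)$ on $X(T)$. $W_{\mathrm{ex}}=\langle W,t_\lambda\mid\lambda\in X(T)\rangle\cong X(T)\rtimes W$, and $W_{\mathrm{af}}=\langle W,t_\alpha\mid\alpha\in\Phi\rangle$. $W_{\mathrm{af}}$ is a Coxeter group with generating set $S_{\mathrm{af}}\supseteq S$ consisting of $S$ together with the reflections $t_\beta s_\beta$ for those $\beta\in\Phi^+$ such that $\check\beta$ is the highest coroot of an irreducible component of the dual root system. $W_{\mathrm{ex}}=W_{\mathrm{af}}\Gamma$ with $W_{\mathrm{af}}\cap\Gamma=1$, where $\Gamma$ is the subgroup of elements normalizing $S_{\mathrm{af}}$, acting on $W_{\mathrm{af}}$ by Coxeter group automorphisms. Length and Bruhat order of $W_{\mathrm{af}}$ are extended by $\ell(y\gamma)=\ell(y)$, and $y\gamma\leq y'\gamma'$ iff $\gamma=\gamma'$ and $y\leq y'$ ($y,y'\in W_{\mathrm{af}}$, $\gamma,\gamma'\in\Gamma$). Hecke algebra. $\mathcal H$ is the $A$-algebra with generators $T_w$ ($w\in W$), $\theta_\lambda$ ($\lambda\in X(T)$) and relations $T_wT_{w'}=T_{ww'}$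 if $\ell(ww')=\ell(w)+\ell(w')$; $T_s^2=v^2T_1+(v^2-1)T_s$ for $s\in S$; $\theta_\lambda\theta_\mu=\theta_{\lambda+\mu}$; $\theta_\lambda T_s-T_s\theta_{s(\lambda)}=(v^2-1)\frac{\theta_\lambda-\theta_{s(\lambda)}}{1-\theta_{-\alpha}}$ for $s=s_\alpha\in S$; $\theta_0=T_1=1$. It has a standard $A$-basis $\{T_x\mid x\in W_{\mathrm{ex}}\}$ extending the $T_w$, $w\in W$, with $T_xT_{x'}=T_{xx'}$ whenever $\ell(xx')=\ell(x)+\ell(x')$, $T_s^2=v^2T_1+(v^2-1)T_s$ for $s\in S_{\mathrm{af}}$, and $T_{t_\lambda}=v^{\ell(t_\lambda)}\theta_\lambda$ for $\lambda$ dominant. The bar involution of $\mathcal H$ is the ring automorphism with $\overline v=v^{-1}$, $\overline{T_x}=T_{x^{-1}}^{-1}$. For $x\in W_{\mathrm{ex}}$, $C'_x$ is the unique element with $\overline{C'_x}=C'_x$ and $C'_x=v^{-\ell(x)}T_x+\sum_{y<x}v^{-\ell(x)}P_{y,x}T_y$, with $P_{y,x}$ a polynomial in $v$ of degree at most $\ell(x)-\ell(y)-1$. For $I\subseteq S$, $W_I=\langle I\rangle$ has longest element $w_I$, $C_{w_I}=(-v)^{\ell(w_I)}\sum_{y\in W_I}(-1)^{\ell(y)}v^{-2\ell(y)}T_y$ (which is fixed by the bar involution), $\mathcal H^{IJ}=C_{w_I}\mathcal HC_{w_J}$, and $\chi^{IJ}(h)=C_{w_I}hC_{w_J}$. The bar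 involution of $\mathcal H^{IJ}$ is the one induced from $\mathcal H$. $W^{IJ}$ is the set of minimal length $(W_I,W_J)$-double coset representatives in $W$. For $z\in W^{IJ}$, $X(T)^+_z=\{\lambda\in X(T)\mid\langle\lambda,\check\alpha\rangle\geq0\text{ for all }\alpha\in\Pi\text{ with }s_\alpha\in I\cap zJz^{-1}\}$, and for $\lambda\in X(T)^+_z$, $m_{\lambda,z}$ is the element of minimal length in the double coset $W_It_\lambda zW_J\subseteq W_{\mathrm{ex}}$. *)

(* Defs.v *)
From HB Require Import structures.
From mathcomp Require Import all_boot all_order all_algebra.
From mathcomp Require Import boolp classical_sets fsbigop.

Set Implicit Arguments.
Unset Strict Implicit.
Unset Printing Implicit Defensive.

Import GRing.Theory.

Local Open Scope classical_set_scope.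
Local Open Scope ring_scope.

(* Z[v, v^-1], as the subring of Frac(Z[X]) of those f with 'X^k f in Z[X]
   for some k. *)

Local Notation "x %:F" := (tofrac x).

Definition is_laurent : pred {fraction {poly int}} := fun f =>
  `[< exists (k : nat) (p : {poly int}),
        ('X^k : {poly int})%:F * f = p%:F >].

Lemma is_laurent_subring : subring_closed is_laurent.
Proof.
split=> [|f g|f g].
- by apply/asboolP; exists 0%N, 1; rewrite !tofrac1 mulr1.
- move=> /asboolP[k [p fp]] /asboolP[l [q gq]]; apply/asboolP.
  exists (k + l)%N, ('X^l * p - 'X^k * q).
  rewrite exprD !(tofracB, tofracM) -fp -gq mulrBr !mulrA.
  by congr (_ - _); rewrite [_%:F * _%:F]mulrC.
- move=> /asboolP[k [p fp]] /asboolP[l [q gq]]; apply/asboolP.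
  exists (k + l)%N, (p * q).
  by rewrite exprD !tofracM -fp -gq mulrACA.
Qed.

HB.instance Definition _ := GRing.isSubringClosed.Build
  {fraction {poly int}} is_laurent is_laurent_subring.

Record laurent := Laurent {
  laurent_val : {fraction {poly int}};
  _ : laurent_val \in is_laurent
}.

HB.instance Definition _ := [isSub for laurent_val].
HB.instance Definition _ := [Choice of laurent by <:].
HB.instance Definition _ := [SubChoice_isSubComNzRing of laurent by <:].

Lemma is_laurentX : ('X : {poly int})%:F \in is_laurent.
Proof. by apply/asboolP; exists 0%N, 'X; rewrite tofrac1 mul1r. Qed.

Lemma is_laurentXV : (('X : {poly int})%:F)^-1 \in is_laurent.
Proof.
apply/asboolP; exists 1%N, 1.
by rewrite expr1 divff ?tofrac1 // tofrac_eq0 polyX_eq0.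
Qed.

Definition v : laurent := Laurent is_laurentX.
Definition vinv : laurent := Laurent is_laurentXV.

Lemma v_vinv : v * vinv = 1.
Proof. by apply: val_inj; rewrite /= divff // tofrac_eq0 polyX_eq0. Qed.

Definition polyv (p : {poly int}) : laurent :=
  (map_poly (fun k : int => k%:~R) p).[v].

Definition basis_on (M : lmodType laurent) (K : choiceType) (D : set K)
    (f : K -> M) (N : set M) : Prop :=
  [/\ forall k, D k -> N (f k),
      forall (s : seq K) (c : K -> laurent), uniq s ->
        (forall k, k \in s -> D k) ->
        \sum_(k <- s) c k *: f k = 0 -> forall k, k \in s -> c k = 0
    & forall h, N h -> exists (s : seq K) (c : K -> laurent),
        (forall k, k \in s -> D k) /\ h = \sum_(k <- s) c k *: f k].

Section CoxeterGroups.
Variable G : groupType.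
Implicit Type S : set G.

Inductive generated S : set G :=
  | generated1 : generated S 1%g
  | generated_in x of S x : generated S x
  | generatedM x y of generated S x & generated S y : generated S (x * y)%g
  | generatedV x of generated S x : generated S (x^-1)%g.

Definition is_word S (x : G) (k : nat) : Prop :=
  exists s : seq G, [/\ size s = k, forall a, a \in s -> S a
                      & x = foldr (fun a b => a * b)%g 1%g s].

Definition coxeter_length S (x : G) : nat :=
  xget 0%N [set k | is_word S x k /\ forall j, is_word S x j -> (k <= j)%N].

Definition reflection S (t : G) : Prop :=
  exists s g, [/\ S s, generated S g & t = (g * s * g^-1)%g].

(* The Bruhat order of the Coxeter system (<S>, S). *)
Inductive bruhat S : G -> G -> Prop :=
  | bruhat_refl x : bruhat S x x
  | bruhat_step x y t of bruhat S x y & reflection S t &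
      (coxeter_length S y < coxeter_length S (y * t)%g)%N :
      bruhat S x (y * t)%g.

End CoxeterGroups.

(* The root datum (X(T), Phi, Y(T), Phi^vee) of (G, T) together with the base
   determined by B.  Bases of X(T) and Y(T) dual to each other are chosen, so
   that X(T) = 'cV[int]_n, Y(T) = 'rV[int]_n. *)

Definition pairing n (lam : 'cV[int]_n) (y : 'rV[int]_n) : int :=
  (y *m lam) 0 0.

Record rootDatum (n : nat) := RootDatum {
  roots : seq 'cV[int]_n;
  coroot : 'cV[int]_n -> 'rV[int]_n; (* relevant on roots only *)
  base : seq 'cV[int]_n;
  pairing_coroot : forall a, a \in roots -> pairing a (coroot a) = 2%:Z;
  coroot_inj : {in roots &, injective coroot};
  roots_stable : forall a b, a \in roots -> b \in roots ->
    b - pairing b (coroot a) *: a \in roots;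
  coroots_stable : forall a b, a \in roots -> b \in roots ->
    exists2 c, c \in roots &
      coroot b - pairing a (coroot b) *: coroot a = coroot c;
  roots_reduced : forall a, a \in roots -> a *+ 2 \notin roots;
  base_uniq : uniq base;
  base_roots : {subset base <= roots};
  base_free : forall c : 'cV[int]_n -> int,
    \sum_(a <- base) c a *: a = 0 -> forall a, a \in base -> c a = 0;
  base_span : forall b, b \in roots -> exists c : 'cV[int]_n -> nat,
    b = \sum_(a <- base) a *+ c a \/ b = - \sum_(a <- base) a *+ c a
}.

Section RootDatum.
Variables (n : nat) (R : rootDatum n).
Notation X := 'cV[int]_n.

(* The derived group is simply connected iff the coroots span a saturated
   sublattice of Y(T). *)
Definition simply_connected_derived : Prop :=
  forall (k : int) (y : 'rV[int]_n), k != 0 ->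
    (exists c : X -> int, k *: y = \sum_(a <- roots R) c a *: coroot R a) ->
    exists c : X -> int, y = \sum_(a <- roots R) c a *: coroot R a.

Definition positive_root (b : X) : Prop :=
  b \in roots R /\ exists c : X -> nat, b = \sum_(a <- base R) a *+ c a.

Definition dominant (lam : X) : Prop :=
  forall a, a \in base R -> 0 <= pairing lam (coroot R a).

Inductive same_component (b : X) : X -> Prop :=
  | same_component_refl : same_component b b
  | same_component_step c d of same_component b c & c \in roots R &
      d \in roots R & pairing d (coroot R c) != 0 : same_component b d.

(* b^vee is the highest root of its irreducible component of Phi^vee, with
   respect to the base of simple coroots *)
Definition highest_coroot (b : X) : Prop :=
  b \in roots R /\
  forall d, d \in roots R -> same_component b d -> exists c : X -> nat,
    coroot R b - coroot R d = \sum_(a <- base R) coroot R a *+ c a.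

(* s_a : lam |-> lam - <lam, a^vee> a *)
Definition reflection_mx (a : X) : 'M[int]_n := 1%:M - a *m coroot R a.

Lemma reflection_mxE a lam :
  reflection_mx a *m lam = lam - pairing lam (coroot R a) *: a.
Proof.
rewrite /reflection_mx mulmxBl mul1mx -mulmxA; congr (_ - _).
by rewrite [coroot R a *m lam]mx11_scalar mul_mx_scalar.
Qed.

Lemma reflection_mxK a : a \in roots R ->
  reflection_mx a *m reflection_mx a = 1%:M.
Proof.
move=> aR; rewrite {2}/reflection_mx mulmxBr mulmx1 mulmxA reflection_mxE.
rewrite pairing_coroot //.
have -> : a - 2%:Z *: a = - a by rewrite (scaler_nat 2) mulr2n opprD addrA subrr add0r.
rewrite mulNmx opprK.
by rewrite /reflection_mx subrK.
Qed.

Inductive in_weyl : 'M[int]_n -> Prop :=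
  | in_weyl1 : in_weyl 1%:M
  | in_weylM a M of a \in roots R & in_weyl M : in_weyl (reflection_mx a *m M).

Lemma in_weyl_mul M N : in_weyl M -> in_weyl N -> in_weyl (M *m N).
Proof.
move=> HM HN; elim: HM => [|a {}M aR _ IH]; first by rewrite mul1mx.
by rewrite -mulmxA; apply: in_weylM.
Qed.

Lemma in_weyl_inv M : in_weyl M ->
  [/\ in_weyl (invmx M), invmx M *m M = 1%:M & M *m invmx M = 1%:M].
Proof.
move=> HM; suff [N [HN NM MN]] : exists N, [/\ in_weyl N, N *m M = 1%:M
                                            & M *m N = 1%:M].
  have uM : M \in unitmx by case/mulmx1_unit: MN.
  suff -> : invmx M = N by [].
  by rewrite -[LHS]mulmx1 -MN mulmxA mulVmx // mul1mx.
elim: HM => [|a {}M aR _ [N [HN NM MN]]].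
  by exists 1%:M; split; [exact: in_weyl1| rewrite mul1mx..].
exists (N *m reflection_mx a); split.
- apply: in_weyl_mul => //; rewrite -[reflection_mx a]mulmx1.
  by apply: in_weylM => //; exact: in_weyl1.
- by rewrite mulmxA -(mulmxA N) reflection_mxK // mulmx1.
- by rewrite mulmxA -(mulmxA _ M) MN mulmx1 reflection_mxK.
Qed.

(* W = N_G(T)/T, as a group of automorphisms of X(T) *)
Record weyl := Weyl { weyl_mx :> 'M[int]_n; _ : `[< in_weyl weyl_mx >] }.

HB.instance Definition _ := [isSub for weyl_mx].
HB.instance Definition _ := [Choice of weyl by <:].

Lemma in_weylP (w : weyl) : in_weyl w. Proof. by case: w => M /= /asboolP. Qed.

Definition weyl_one : weyl := Weyl (asboolT in_weyl1).
Definition weyl_mul (w z : weyl) : weyl :=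
  Weyl (asboolT (in_weyl_mul (in_weylP w) (in_weylP z))).
Definition weyl_inv (w : weyl) : weyl :=
  Weyl (asboolT (let: And3 h _ _ := in_weyl_inv (in_weylP w) in h)).

Lemma weyl_mulA : associative weyl_mul.
Proof. by move=> x y z; apply: val_inj; rewrite /= mulmxA. Qed.
Lemma weyl_mul1 : left_id weyl_one weyl_mul.
Proof. by move=> x; apply: val_inj; rewrite /= mul1mx. Qed.
Lemma weyl_mulr1 : right_id weyl_one weyl_mul.
Proof. by move=> x; apply: val_inj; rewrite /= mulmx1. Qed.
Lemma weyl_mulV : left_inverse weyl_one weyl_inv weyl_mul.
Proof. by move=> x; apply: val_inj; case: (in_weyl_inv (in_weylP x)). Qed.
Lemma weyl_mulrV : right_inverse weyl_one weyl_inv weyl_mul.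
Proof. by move=> x; apply: val_inj; case: (in_weyl_inv (in_weylP x)). Qed.

HB.instance Definition _ := isGroup.Build weyl
  weyl_mulA weyl_mul1 weyl_mulr1 weyl_mulV weyl_mulrV.

(* W_ex = X(T) x| W; the pair (lam, w) is the affine map t_lam w. *)
Definition extWeyl : Type := (X * weyl)%type.

HB.instance Definition _ := Choice.copy extWeyl (X * weyl)%type.

Definition ext_one : extWeyl := (0, 1%g).
Definition ext_mul (x y : extWeyl) : extWeyl :=
  (x.1 + weyl_mx x.2 *m y.1, (x.2 * y.2)%g).
Definition ext_inv (x : extWeyl) : extWeyl :=
  (- (weyl_mx (x.2^-1)%g *m x.1), (x.2^-1)%g).

Lemma ext_mulA : associative ext_mul.
Proof.
by move=> x y z; rewrite /ext_mul /= mulmxDr mulmxA addrA mulgA.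
Qed.
Lemma ext_mul1 : left_id ext_one ext_mul.
Proof. by case=> l w; rewrite /ext_mul /= mul1mx add0r mul1g. Qed.
Lemma ext_mulr1 : right_id ext_one ext_mul.
Proof. by case=> l w; rewrite /ext_mul /= mulmx0 addr0 mulg1. Qed.
Lemma ext_mulV : left_inverse ext_one ext_inv ext_mul.
Proof. by case=> l w; rewrite /ext_mul /= addNr mulVg. Qed.
Lemma ext_mulrV : right_inverse ext_one ext_inv ext_mul.
Proof.
case=> l w; rewrite /ext_mul /= mulmxN mulmxA.
have -> : weyl_mx w *m weyl_mx (w^-1)%g = 1%:M.
  by case: (in_weyl_inv (in_weylP w)).
by rewrite mul1mx subrr mulgV.
Qed.

HB.instance Definition _ := isGroup.Build extWeyl
  ext_mulA ext_mul1 ext_mulr1 ext_mulV ext_mulrV.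

Definition translation (lam : X) : extWeyl := (lam, 1%g).
Definition fin (w : weyl) : extWeyl := (0, w).

(* S *)
Definition simple_refl : set weyl :=
  [set s | exists2 a, a \in base R & weyl_mx s = reflection_mx a].

Definition affine_weyl : set extWeyl :=
  generated [set x | (exists w, x = fin w) \/
                     (exists2 a, a \in roots R & x = translation a)].

(* S_af *)
Definition affine_simple_refl : set extWeyl :=
  [set x | (exists2 s, simple_refl s & x = fin s) \/
           (exists b s, [/\ positive_root b, highest_coroot b,
              weyl_mx s = reflection_mx b & x = (translation b * fin s)%g])].

Definition Gamma : set extWeyl :=
  [set g | [set (g * s * g^-1)%g | s in affine_simple_refl]
           = affine_simple_refl].

(* ell (y g) = ell y for y in W_af and g in Gamma; on the standard parabolic
   subgroup W of W_af this is the length with respect to S. *)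
Definition ell (x : extWeyl) : nat :=
  xget 0%N [set k | exists y g, [/\ affine_weyl y, Gamma g, x = (y * g)%g
                              & k = coxeter_length affine_simple_refl y]].

Definition bruhat_le (x x' : extWeyl) : Prop :=
  exists y y' g, [/\ affine_weyl y, affine_weyl y', Gamma g,
    x = (y * g)%g /\ x' = (y' * g)%g & bruhat affine_simple_refl y y'].

Definition bruhat_lt (x x' : extWeyl) : Prop := bruhat_le x x' /\ x <> x'.

(* The element (theta_lam - theta_(s_a lam)) / (1 - theta_(-a)) of the Z-span
   of the theta's, with the geometric progression carried out. *)
Definition demazure (K : zmodType) (theta : X -> K) (a lam : X) : K :=
  match pairing lam (coroot R a) with
  | Posz k => \sum_(i < k) theta (lam - a *+ i)
  | Negz k => - \sum_(i < k.+1) theta (lam + a *+ i.+1)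
  end.

Lemma demazureE (K : pzRingType) (theta : X -> K) (a lam : X) :
    (forall l m, theta l * theta m = theta (l + m)) ->
  demazure theta a lam * (1 - theta (- a))
  = theta lam - theta (reflection_mx a *m lam).
Proof.
move=> thD; rewrite reflection_mxE /demazure.
case: (pairing lam (coroot R a)) => k.
  rewrite mulr_suml (eq_bigr (fun i : 'I_k =>
    - (theta (lam - a *+ i.+1) - theta (lam - a *+ i)))) => [|i _]; last first.
    by rewrite mulrBr mulr1 thD opprB mulrSr opprD addrA.
  rewrite sumrN -(big_mkord xpredT (fun i =>
    theta (lam - a *+ i.+1) - theta (lam - a *+ i))).
  by rewrite telescope_sumr // opprB mulr0n subr0 -scaler_nat natz.
rewrite mulNr mulr_suml (eq_bigr (fun i : 'I_k.+1 =>
  theta (lam + a *+ i.+1) - theta (lam + a *+ i))) => [|i _]; last first.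
  by rewrite mulrBr mulr1 thD mulrSr addrA addrK.
rewrite -(big_mkord xpredT (fun i =>
  theta (lam + a *+ i.+1) - theta (lam + a *+ i))).
by rewrite telescope_sumr // opprB mulr0n addr0 NegzE scaleNr opprK
  -scaler_nat natz.
Qed.

(* The defining relations of H (Bernstein presentation). *)
Record bernstein_relations (K : algType laurent) (Tw : weyl -> K)
    (theta : X -> K) : Prop := {
  bernstein_mul : forall w w',
    ell (fin (w * w')%g) = (ell (fin w) + ell (fin w'))%N ->
    Tw w * Tw w' = Tw (w * w')%g;
  bernstein_quad : forall s, simple_refl s ->
    Tw s * Tw s = (v ^+ 2) *: Tw 1%g + (v ^+ 2 - 1) *: Tw s;
  bernstein_theta : forall lam mu,
    theta lam * theta mu = theta (lam + mu);
  bernstein_comm : forall a s lam, a \in base R ->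
    weyl_mx s = reflection_mx a ->
    theta lam * Tw s - Tw s * theta (weyl_mx s *m lam)
    = (v ^+ 2 - 1) *: demazure theta a lam;
  bernstein_theta0 : theta 0 = 1;
  bernstein_T1 : Tw 1%g = 1
}.

(* H is the algebra presented by bernstein_relations: hecke_rel, hecke_lift and
   hecke_lift_uniq.  The T x, for x in W_ex, extend the generators indexed by W
   to the standard basis, which the last four fields determine. *)
Record affineHecke := AffineHecke {
  hecke :> algType laurent;
  T : extWeyl -> hecke;
  theta : X -> hecke;
  hecke_rel : bernstein_relations (fun w => T (fin w)) theta;
  hecke_lift : forall (K : algType laurent) (Tw : weyl -> K) (th : X -> K),
    bernstein_relations Tw th ->
    exists f : {lrmorphism hecke -> K},
      (forall w, f (T (fin w)) = Tw w) /\ (forall lam, f (theta lam) = th lam);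
  hecke_lift_uniq : forall (K : algType laurent)
      (f g : {lrmorphism hecke -> K}),
    (forall w, f (T (fin w)) = g (T (fin w))) ->
    (forall lam, f (theta lam) = g (theta lam)) -> f =1 g;
  T_basis : basis_on setT T setT;
  T_mul : forall x x', ell (x * x')%g = (ell x + ell x')%N ->
    T x * T x' = T (x * x')%g;
  T_quad : forall s, affine_simple_refl s ->
    T s * T s = (v ^+ 2) *: T 1%g + (v ^+ 2 - 1) *: T s;
  T_translation : forall lam, dominant lam ->
    T (translation lam) = v ^+ ell (translation lam) *: theta lam
}.

Section Hecke.
Variable H : affineHecke.

Definition bar_involution (bar : {rmorphism H -> H}) : Prop :=
  [/\ bijective bar,
      bar (v%:A) = vinv%:A
    & forall x, bar (T H x) * T H (x^-1)%g = 1 /\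
                T H (x^-1)%g * bar (T H x) = 1].

(* c is the Kazhdan-Lusztig element C'_x.  deg P <= d - 1 is size P <= d; the
   sum is over a finite set since lower Bruhat intervals are finite. *)
Definition is_kl (bar : {rmorphism H -> H}) (x : extWeyl) (c : H) : Prop :=
  bar c = c /\
  exists P : extWeyl -> {poly int},
    (forall y, bruhat_lt y x -> (size (P y) <= ell x - ell y)%N) /\
    c = vinv ^+ ell x *: T H x
        + \sum_(y \in [set y | bruhat_lt y x])
            (vinv ^+ ell x * polyv (P y)) *: T H y.

End Hecke.

Section Parabolic.
Variables I J : set weyl.

Definition longest : weyl :=
  xget 1%g [set w | generated I w /\
    forall y, generated I y -> (ell (fin y) <= ell (fin w))%N].

Definition Cw (H : affineHecke) : H :=
  (- v) ^+ ell (fin longest) *: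
    \sum_(y \in generated I)
      ((-1) ^+ ell (fin y) * vinv ^+ (2 * ell (fin y))) *: T H (fin y).

(* W^{IJ} *)
Definition min_coset_rep (z : weyl) : Prop :=
  forall a b, generated I a -> generated J b ->
    (ell (fin z) <= ell (fin (a * z * b)%g))%N.

(* X(T)^+_z *)
Definition partial_dominant (z : weyl) (lam : X) : Prop :=
  forall a s, a \in base R -> weyl_mx s = reflection_mx a ->
    I s -> J (z^-1 * s * z)%g -> 0 <= pairing lam (coroot R a).

(* W_I t_lam z W_J *)
Definition double_coset (lam : X) (z : weyl) : set extWeyl :=
  [set x | exists a b, [/\ generated I a, generated J b &
             x = (fin a * (translation lam * fin z) * fin b)%g]].

(* m_{lam,z} *)
Definition min_elt (lam : X) (z : weyl) : extWeyl :=
  xget 1%g [set m | double_coset lam z m /\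
    forall y, double_coset lam z y -> (ell m <= ell y)%N].

End Parabolic.

Section HeckeIJ.
Variables (H : affineHecke) (I J : set weyl).

Definition chi (h : H) : H := Cw I H * h * Cw J H.

(* H^{IJ} *)
Definition heckeIJ : set H := range chi.

Definition indexIJ : set (X * weyl) :=
  [set p | min_coset_rep I J p.2 /\ partial_dominant I J p.2 p.1].

(* C'_{lam,z}, given the elements C'_x *)
Definition klIJ (C' : extWeyl -> H) (p : X * weyl) : H :=
  Cw I H * C' (min_elt I J p.1 p.2) * Cw J H.

End HeckeIJ.

End RootDatum.

Arguments simple_refl {n} R.
Arguments heckeIJ {n R} H I J.

(* Main.v *)
(* W_ex acts on the affine roots <., a^vee> + k.  Their signs on the fundamental
   alcove give the exchange property for the length on W_ex; it follows that the
   elements x with sx > x for s in I and xs > x for s in J represent the double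
   cosets W_I x W_J, each exactly once, and that they are the m_{lam,z}.

   If sx < x for some s in I then T_s C'_x = v^2 C'_x, whereas C_{w_I} T_s =
   - C_{w_I}, so that chi kills C'_x, and likewise on the right.  For the
   remaining x, chi(C'_x) is v^-l(x) chi(T_x) plus a combination of chi(T_y) with
   l(y) < l(x), and chi(T_y) is supported on W_I y W_J.  By triangularity only the
   coefficient of T_x in chi(T_x) has to be shown nonzero: at v = 1 it is, up to
   sign, the number of pairs (a, b) in W_I x W_J with a x b = x, all of which
   contribute with the same sign since l is additive modulo 2. *)
From mathcomp Require Import all_boot all_order all_algebra.
From mathcomp Require Import boolp classical_sets fsbigop.
From mathcomp Require Import functions cardinality zify ring.
Require Import Defs.

Set Implicit Arguments.
Unset Strict Implicit.
Unset Printing Implicit Defensive.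

Import Order.TTheory GRing.Theory Num.Theory.

Local Open Scope classical_set_scope.
Local Open Scope ring_scope.

(** The length on W_ex is defined through the decomposition W_af Gamma, with Gamma the normalizer of
    S_af, whereas exchange arguments need signs of affine roots. The bridge is that Gamma consists
    exactly of the elements preserving positivity. The difficult half is that an element normalizing
    S_af might a priori send a simple affine root to the negative of one. A second obstacle is that
    S_af mentions highest coroots: each component must be shown to have one, since otherwise the
    walls from S_af would not bound an alcove. Geometry stays over the integers: points are scaled,
    and the invariant form is the sum over all coroots of products of pairings.

    On the Hecke side the Bruhat order enters only through the implication from y < x to l(y) <
    l(x). A bar-fixed element with all coefficients in v^-1 Z[v^-1] is zero; this yields C'_s C'_w =
    C'_x + sum of mu(y) C'_y for x = sw > w, and thence T_s C'_x = v^2 C'_x by induction on the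
    length. Setting v = 1 is done coefficientwise, as a congruence modulo v - 1. *)

(** * Coxeter combinatorics of a group acting on roots *)

(* Restatements at the Group instance of the product, which lia does not identify
   with the instances that occur in mulgA and invgM. *)
Lemma gmulA (G : groupType) (x y z : G) : (x * (y * z) = x * y * z)%g.
Proof. exact: mulgA. Qed.

Lemma ginvM (G : groupType) (x y : G) : ((x * y)^-1 = y^-1 * x^-1)%g.
Proof. exact: invgM. Qed.

Definition gprod (G : groupType) (s : seq G) : G :=
  foldr (fun a b => a * b)%g 1%g s.

Definition word_in (G : groupType) (I : set G) (s : seq G) : Prop :=
  forall a, a \in s -> I a.

Section Words.
Variable G : groupType.
Implicit Types (I : set G) (s : seq G) (x : G).

Lemma gprod_cat s s' : gprod (s ++ s') = (gprod s * gprod s')%g.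
Proof. by elim: s => [|a s IH] /=; rewrite ?mul1g // IH gmulA. Qed.

Lemma gprod_rcons s a : gprod (rcons s a) = (gprod s * a)%g.
Proof. by rewrite -cats1 gprod_cat /= mulg1. Qed.

Lemma word_in_cons I a s : I a -> word_in I s -> word_in I (a :: s).
Proof. by move=> Ia Is b; rewrite inE => /predU1P[->|/Is]. Qed.

Lemma word_in_consP I a s : word_in I (a :: s) -> I a /\ word_in I s.
Proof.
by move=> H; split=> [|b sb]; apply: H; rewrite inE ?eqxx // sb orbT.
Qed.

Lemma word_in_cat I s s' : word_in I s -> word_in I s' -> word_in I (s ++ s').
Proof. by move=> Is Is' b; rewrite mem_cat => /orP[/Is|/Is']. Qed.

Lemma word_in_rcons I a s : I a -> word_in I s -> word_in I (rcons s a).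
Proof.
by move=> Ia Is; rewrite -cats1; apply: word_in_cat => //; apply: word_in_cons.
Qed.

Lemma word_in_rconsP I a s : word_in I (rcons s a) -> I a /\ word_in I s.
Proof.
by move=> H; split=> [|b sb]; apply: H; rewrite mem_rcons inE ?eqxx // sb orbT.
Qed.

Lemma word_in_sub I I' s : I `<=` I' -> word_in I s -> word_in I' s.
Proof. by move=> II' Is a /Is /II'. Qed.

Lemma gen_word I s : word_in I s -> generated I (gprod s).
Proof.
elim: s => [|a s IH] /=; first by move=> _; exact: generated1.
by case/word_in_consP=> Ia Is; apply: generatedM (IH Is); exact: generated_in.
Qed.

Lemma gen_sub I I' x : I `<=` I' -> generated I x -> generated I' x.
Proof.
move=> II'; elim=> [|y /II' Iy|y z _ Iy _ Iz|y _ Iy].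
- exact: generated1.
- exact: generated_in.
- exact: generatedM.
- exact: generatedV.
Qed.

Lemma genP I x : (forall a, I a -> (a * a = 1)%g) -> generated I x ->
  exists2 s, word_in I s & x = gprod s.
Proof.
move=> invI; elim=> [|y Iy|y z _ [s Is ->] _ [s' Is' ->]|y _ [s Is ->]].
- by exists [::].
- by exists [:: y]; [exact: word_in_cons| rewrite /= mulg1].
- by exists (s ++ s'); [exact: word_in_cat| rewrite gprod_cat].
- exists (rev s); first by move=> a; rewrite mem_rev => /Is.
  elim: s Is => [|a s IH] /=; first by rewrite invg1.
  case/word_in_consP => Ia Is; rewrite ginvM IH // rev_cons gprod_rcons.
  congr (_ * _)%g; apply: (mulIg a); rewrite mulVg.
  by rewrite invI.
Qed.

End Words.

(* A group permuting roots and containing the reflections in them.  It need not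
   be generated by the simple reflections: the elements of W_ex preserving the
   positive affine roots are those of Gamma. *)
Record posRoots (G : groupType) := PosRoots {
  psi : Type;
  act : G -> psi -> psi;
  opp : psi -> psi;
  refl : psi -> G;
  pos : pred psi;
  isroot : psi -> Prop;
  simple : psi -> Prop;
  act1 : forall h, isroot h -> act 1%g h = h;
  actM : forall x y h, isroot h -> act (x * y)%g h = act x (act y h);
  act_root : forall x h, isroot h -> isroot (act x h);
  opp_root : forall h, isroot h -> isroot (opp h);
  simple_root : forall f, simple f -> isroot f;
  simple_pos : forall f, simple f -> pos f;
  oppK : forall h, isroot h -> opp (opp h) = h;
  pos_opp : forall h, isroot h -> pos (opp h) = ~~ pos h;
  act_opp : forall x h, isroot h -> act x (opp h) = opp (act x h);
  refl_opp : forall h, isroot h -> refl (opp h) = refl h;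
  refl_act : forall x h, isroot h -> refl (act x h) = (x * refl h * x^-1)%g;
  refl_self : forall h, isroot h -> act (refl h) h = opp h;
  reflK : forall h, isroot h -> (refl h * refl h)%g = 1%g;
  refl_pos : forall f h, simple f -> isroot h -> pos h -> h <> f ->
    pos (act (refl f) h);
  simple_stab : forall x, (forall f, simple f -> pos (act x f)) ->
    forall h, isroot h -> pos h -> pos (act x h);
  measure : G -> nat;
  measure_desc : forall x f, simple f -> ~~ pos (act x^-1%g f) ->
    (measure (refl f * x)%g < measure x)%N
}.

(** * Length, deletion and exchange from the signs of roots *)

Section Length.
Variables (G : groupType) (P : posRoots G).
Notation act := (@act G P).
Notation refl := (@refl G P).
Notation pos := (@pos G P).
Notation opp := (@opp G P).
Notation root := (@isroot G P).
Notation simple := (@simple G P).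
Implicit Types (x y z g : G) (h f e : psi P) (s : seq G).

Definition simples : set G := [set refl f | f in simple].

(** These elements will turn out to be the ones of length 0. *)
Definition domp g : Prop := forall h, root h -> pos h -> pos (act g h).

Local Notation S := simples.

Lemma S_invol (s : G) : S s -> (s * s = 1)%g.
Proof. by case=> f /simple_root rf <-; exact: reflK. Qed.

Lemma S_inv (s : G) : S s -> (s^-1 = s)%g.
Proof. by move=> Ss; apply: mulg1_eq; exact: S_invol. Qed.

Lemma actKV x h : root h -> act x (act x^-1%g h) = h.
Proof. by move=> rh; rewrite -actM // mulgV act1. Qed.

Lemma actVK x h : root h -> act x^-1%g (act x h) = h.
Proof. by move=> rh; rewrite -actM // mulVg act1. Qed.

Lemma domp1 : domp 1%g.
Proof. by move=> h rh ph; rewrite act1. Qed.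

Lemma dompV g : domp g -> domp g^-1%g.
Proof.
move=> dg h rh ph; apply: contraT => nh.
have rgh : root (act g^-1%g h) by exact: act_root.
have := dg (opp (act g^-1%g h)) (opp_root rgh).
rewrite pos_opp // nh => /(_ isT).
by rewrite act_opp // actKV // pos_opp // ph.
Qed.

Lemma dompM g g' : domp g -> domp g' -> domp (g * g')%g.
Proof.
by move=> dg dg' h rh ph; rewrite actM //; apply: dg;
  [exact: act_root|exact: dg'].
Qed.

(** The reflection in [act g f] makes some simple root e negative. Conjugating by g, the simple
    reflection [refl f] makes the positive root [act g^-1 e] negative, and f is the only such
    root. *)
Lemma domp_simple g f : domp g -> simple f -> simple (act g f).
Proof.
move=> dg sf; set h := act g f.
have rf := simple_root sf; have rh : root h by exact: act_root.
have ph : pos h by apply: dg => //; exact: simple_pos.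
have [e se ne] : exists2 e, simple e & ~~ pos (act (refl h) e).
  apply: contrapT => H.
  have /negP : ~~ pos (act (refl h) h) by rewrite refl_self // pos_opp // ph.
  apply; apply: simple_stab => // e se.
  by apply: contraT => ne; case: H; exists e.
have re := simple_root se.
have pe : pos (act g^-1%g e) by apply: dompV => //; exact: simple_pos.
have [E|NE] := pselect (act g^-1%g e = f).
  by rewrite /h -E actKV.
case/negP: ne; rewrite refl_act // -gmulA actM // actM //.
have rge : root (act g^-1%g e) by exact: act_root.
by apply: dg; [exact: act_root|exact: refl_pos].
Qed.

Lemma refl_conj x h : root h -> (x * refl h = refl (act x h) * x)%g.
Proof. by move=> rh; rewrite refl_act // mulgVK. Qed.

Definition dec x k : Prop :=
  exists s g, [/\ word_in S s, domp g, x = (gprod s * g)%g & size s = k].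

(** As long as x^-1 makes some simple root negative, its reflection lowers [measure]; when there is
    none left, [simple_stab] applies to x^-1. *)
Lemma dec_exists x : exists k, `[< dec x k >].
Proof.
have [m] := ubnP (measure P x); elim: m x => // m IH x lem.
have [dx|ndx] := pselect (domp x^-1%g).
  exists 0%N; apply/asboolP; exists [::], x; split=> //; last by rewrite mul1g.
  by rewrite -[x]invgK; exact: dompV.
have [f sf nf] : exists2 f, simple f & ~~ pos (act x^-1%g f).
  apply: contrapT => H; apply: ndx; apply: simple_stab => f sf.
  by apply: contraT => nf; case: H; exists f.
have /IH[k /asboolP[s [g [Ss dg E sz]]]] : (measure P (refl f * x)%g < m)%N.
  by apply: leq_trans (measure_desc sf nf) _.
exists k.+1; apply/asboolP; exists (refl f :: s), g; split=> //=;
  last by rewrite sz.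
  by apply: word_in_cons => //; exists f.
by rewrite -gmulA -E gmulA reflK ?mul1g //; exact: simple_root.
Qed.

Definition len x : nat := ex_minn (dec_exists x).

Lemma lenP x : dec x (len x).
Proof. by rewrite /len; case: ex_minnP => k /asboolP. Qed.

Lemma len_min x k : dec x k -> (len x <= k)%N.
Proof. by move=> dx; rewrite /len; case: ex_minnP => j _; apply;
  apply/asboolP. Qed.

Lemma len_le s g : word_in S s -> domp g -> (len (gprod s * g)%g <= size s)%N.
Proof. by move=> Ss dg; apply: len_min; exists s, g. Qed.

Lemma len_word s : word_in S s -> (len (gprod s) <= size s)%N.
Proof. by move=> Ss; rewrite -[gprod s]mulg1; apply: len_le => //;
  exact: domp1. Qed.

Lemma len1 : len 1%g = 0%N.
Proof. by apply/eqP; rewrite -leqn0; apply: (@len_word [::]). Qed.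

Lemma len_domp g : domp g -> len g = 0%N.
Proof.
by move=> dg; apply/eqP; rewrite -leqn0 -[g]mul1g; apply: (@len_le [::]).
Qed.

Lemma len0_domp g : len g = 0%N -> domp g.
Proof.
move=> g0; have := lenP g; rewrite g0 => -[[|a s] [g' [_ dg' -> //]]].
by rewrite mul1g.
Qed.

(** The image of h changes sign at some letter of s. There it is the simple root of that letter, so
    multiplying by [refl h] on the right deletes the letter. The shorter word keeps its letters in
    I, which later makes the length of W_I the restriction of [len]. *)
Lemma deletion (I : set G) s g h : I `<=` S -> word_in I s -> domp g ->
    root h -> pos h -> ~~ pos (act (gprod s * g)%g h) ->
  exists s', [/\ word_in I s', (size s').+1 = size s &
                 (gprod s * g * refl h = gprod s' * g)%g].
Proof.
move=> IS; elim: s => [|a s IH] /= Is dg rh ph nh.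
  by case/negP: nh; rewrite mul1g; exact: dg.
have [Ia {}Is] := word_in_consP Is.
set y := (gprod s * g)%g in IH *.
have [py|ny] := boolP (pos (act y h)); last first.
  have [s' [Is' sz E]] := IH Is dg rh ph ny.
  exists (a :: s'); split=> /=; first exact: word_in_cons.
    by rewrite sz.
  by rewrite -!gmulA in E *; rewrite E.
exists s; split=> //.
have [f sf Ea] := IS _ Ia; have rf := simple_root sf.
have Ef : act y h = f.
  apply: contrapT => NE; case/negP: nh.
  by rewrite -gmulA actM // -Ea; apply: refl_pos => //; exact: act_root.
rewrite -(gmulA a) -gmulA -/y refl_conj // Ef Ea gmulA S_invol ?mul1g //.
exact: IS.
Qed.

Lemma len_refl_lt x h : root h -> pos h -> ~~ pos (act x h) ->
  (len (x * refl h)%g < len x)%N.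
Proof.
have [s [g [Ss dg E sz]]] := lenP x => rh ph; rewrite {1}E => nh.
have [|s' [Ss' sz' E']] := deletion _ Ss dg rh ph nh; first by [].
by rewrite {1}E E' -sz -sz' ltnS; exact: len_le.
Qed.

Lemma len_refl_gt x h : root h -> pos h -> pos (act x h) ->
  (len x < len (x * refl h)%g)%N.
Proof.
move=> rh ph pxh.
have := @len_refl_lt (x * refl h)%g h rh ph; rewrite -gmulA reflK // mulg1;
  apply.
by rewrite actM // refl_self // act_opp // pos_opp ?negbK //; exact: act_root.
Qed.

Lemma len_mulr_le x a : S a -> (len (x * a)%g <= (len x).+1)%N.
Proof.
have [s [g [Ss dg E sz]]] := lenP x => -[f sf <-]; rewrite {1}E -gmulA.
have rf := simple_root sf.
rewrite refl_conj // gmulA -gprod_rcons -sz -(size_rcons s (refl (act g f))).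
apply: len_le => //; apply: word_in_rcons => //.
by exists (act g f) => //; exact: domp_simple.
Qed.

Lemma len_mulr x a : S a ->
  len (x * a)%g = (len x).+1 \/ len x = (len (x * a)%g).+1.
Proof.
move=> Sa; have := len_mulr_le x Sa; have := len_mulr_le (x * a)%g Sa.
rewrite -gmulA S_invol // mulg1.
have [f sf Ea] := Sa; rewrite -Ea; have rf := simple_root sf;
  have pf := simple_pos sf.
have [pxf|nxf] := boolP (pos (act x f)).
  by have := len_refl_gt rf pf pxf; lia.
by have := len_refl_lt rf pf nxf; lia.
Qed.

Lemma len_inv x : len x^-1%g = len x.
Proof.
suff H k : forall y, (len y <= k)%N -> (len y^-1%g <= k)%N.
  by apply/eqP; rewrite eqn_leq; apply/andP; split; [|rewrite -{1}[x]invgK];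
    apply: H.
elim: k => [|k IH] y;
  first by rewrite !leqn0 => /eqP /len0_domp /dompV /len_domp ->.
have [[|a s] [g [Ss dg E sz]]] := lenP y.
  by rewrite E mul1g => _; rewrite len_domp //; exact: dompV.
have [Sa {}Ss] := word_in_consP Ss.
move=> ly; rewrite E -gmulA ginvM (S_inv Sa);
  apply: leq_trans (len_mulr_le _ Sa) _.
rewrite ltnS; apply: IH; apply: leq_trans (len_le Ss dg) _.
by rewrite -ltnS; move: ly; rewrite -sz.
Qed.

Lemma len_mull x a : S a ->
  len (a * x)%g = (len x).+1 \/ len x = (len (a * x)%g).+1.
Proof.
move=> Sa; rewrite -(len_inv (a * x)%g) -(len_inv x) ginvM (S_inv Sa).
exact: len_mulr.
Qed.

Lemma len_mulr_pos x f : simple f ->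
  (len x < len (x * refl f)%g)%N = pos (act x f).
Proof.
move=> sf; have rf := simple_root sf; have pf := simple_pos sf.
have [pxf|nxf] := boolP (pos (act x f)).
  by rewrite (len_refl_gt rf pf pxf).
by have := len_refl_lt rf pf nxf; lia.
Qed.

(** A simple reflection makes only its own positive root negative, so x carries the simple root of t
    to that of s. *)
Lemma fold_eq x (s t : G) : S s -> S t -> (len x < len (x * t)%g)%N ->
  (len (s * x * t)%g < len (s * x)%g)%N -> (s * x = x * t)%g.
Proof.
move=> [f sf <-] [e se <-]; rewrite len_mulr_pos // => pxe.
rewrite ltnNge => /negP nle.
have nse : ~~ pos (act (refl f * x)%g e).
  by rewrite -len_mulr_pos //; apply/negP => /ltnW.
have re := simple_root se.
have Ef : act x e = f.
  apply: contrapT => NE; case/negP: nse.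
  by rewrite actM //; apply: refl_pos => //; exact: act_root.
by rewrite [RHS]refl_conj // Ef.
Qed.

(** The image under z of the simple root of t is positive, is made negative by y, and has z t z^-1
    as its reflection. *)
Lemma len_conj y z (t : G) : S t -> (len z < len (z * t)%g)%N ->
  (len (y * z * t)%g < len (y * z)%g)%N ->
    (len (y * (z * t * z^-1))%g < len y)%N.
Proof.
move=> [e se <-]; rewrite len_mulr_pos // => pze.
rewrite ltnNge => /negP nle.
have nyz : ~~ pos (act (y * z)%g e).
  by rewrite -len_mulr_pos //; apply/negP => /ltnW.
have re := simple_root se.
rewrite -refl_act //; apply: len_refl_lt => //; first exact: act_root.
by rewrite -actM.
Qed.

Lemma len_mul_domp x g : domp g -> len (x * g)%g = len x.
Proof.
move=> dg; have H y z : domp z -> (len (y * z)%g <= len y)%N.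
  have [s [g' [Ss dg' E sz]]] := lenP y => dz.
  by rewrite {1}E -gmulA -sz; apply: len_le => //; exact: dompM.
apply/eqP; rewrite eqn_leq H // -{1}[x](mulgK g).
by apply: H; exact: dompV.
Qed.

Lemma gen_conj_domp g x : domp g -> generated S x ->
  generated S (g * x * g^-1)%g.
Proof.
move=> dg; elim=> [|y [f sf <-]|y z _ Sy _ Sz|y _ Sy].
- by rewrite mulg1 mulgV; exact: generated1.
- rewrite -refl_act; last exact: simple_root.
  by apply: generated_in; exists (act g f) => //; exact: domp_simple.
- have -> : (g * (y * z) * g^-1 = (g * y * g^-1) * (g * z * g^-1))%g.
    by rewrite !gmulA mulgVK.
  exact: generatedM.
- have -> : (g * y^-1 * g^-1 = (g * y * g^-1)^-1)%g by rewrite !ginvM invgK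
  gmulA.
  exact: generatedV.
Qed.

(** If a word followed by a positivity-preserving g makes e negative, some tail of it carries e to a
    simple root; this exhibits [refl e] as a conjugate of a simple reflection. Conjugation by g does
    not leave the generated subgroup. *)
Lemma refl_gen h : root h -> generated S (refl h).
Proof.
suff H s g e : word_in S s -> domp g -> root e -> pos e ->
    ~~ pos (act (gprod s * g)%g e) -> generated S (refl e).
  have H' e : root e -> pos e -> generated S (refl e).
    (* The element [refl e] itself makes e negative and so supplies the word. *)
    move=> re pe; have [s [g [Ss dg E _]]] := lenP (refl e).
    by apply: (H s g) => //; rewrite -E refl_self // pos_opp // pe.
  move=> rh; have [ph|nh] := boolP (pos h); first exact: H'.
  by rewrite -refl_opp //; apply: H'; [exact: opp_root|rewrite pos_opp].
elim: s => [|a s IH] /= Ss dg re pe ne.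
  by case/negP: ne; rewrite mul1g; exact: dg.
have [Sa {}Ss] := word_in_consP Ss.
set y := (gprod s * g)%g in IH.
have [py|ny] := boolP (pos (act y e)); last exact: IH.
have [f sf Ea] := Sa; have rf := simple_root sf.
have Ef : act y e = f.
  apply: contrapT => NE; case/negP: ne.
  rewrite -gmulA actM // -Ea; apply: refl_pos => //; exact: act_root.
have -> : refl e = (g^-1 * ((gprod s)^-1 * a * gprod s) * (g^-1)^-1)%g.
  by rewrite -[e](actVK y) // Ef refl_act // Ea !invgK /y ginvM !gmulA.
apply: gen_conj_domp; first exact: dompV.
have Gs := gen_word Ss.
by apply: generatedM => //; apply: generatedM;
  [exact: generatedV|exact: generated_in].
Qed.

(** * Parabolic subgroups and minimal coset representatives *)

Section Parabolic.
Variable I : set G.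
Hypothesis IS : I `<=` S.

Lemma reduced_word s : word_in I s -> exists s',
  [/\ word_in I s', gprod s' = gprod s & size s' = len (gprod s)].
Proof.
elim/last_ind: s => [|s a IH] Is.
  by exists [::]; rewrite /= len1.
have [Ia {}Is] := word_in_rconsP Is.
have [s' [Is' E sz]] := IH Is.
rewrite gprod_rcons -E.
have [f sf Ea] := IS Ia; have rf := simple_root sf.
have [pf|nf] := boolP (pos (act (gprod s') f)).
  exists (rcons s' a); split; first exact: word_in_rcons.
    by rewrite gprod_rcons.
  rewrite size_rcons sz -E.
  have := len_mulr (gprod s') (IS Ia).
  by rewrite -len_mulr_pos // Ea in pf; lia.
have := @deletion I s' 1%g f IS Is' domp1 rf (simple_pos sf).
rewrite !mulg1 => /(_ nf)[s2 [Is2 sz2 E2]].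
exists s2; split=> //; first by rewrite -Ea E2 mulg1.
have := len_mulr (gprod s') (IS Ia).
have := len_refl_lt rf (simple_pos sf) nf.
by rewrite Ea E; lia.
Qed.

Lemma gen_reduced b : generated I b ->
  exists s, [/\ word_in I s, b = gprod s & size s = len b].
Proof.
case/genP=> [a /IS|s Is ->]; first exact: S_invol.
by have [s' [Is' E sz]] := reduced_word Is; exists s'.
Qed.

Lemma gen_len0 b : generated I b -> len b = 0%N -> b = 1%g.
Proof. by case/gen_reduced=> -[|a s] [_ -> sz] // b0; rewrite b0 in sz. Qed.

Lemma gen_len1 b : generated I b -> len b = 1%N -> I b.
Proof.
case/gen_reduced=> s [Is -> sz] b1; rewrite b1 in sz.
case: s Is sz {b1} => [|a [|//]] // Is _; rewrite /= mulg1.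
by apply: Is; rewrite inE.
Qed.

Lemma gen_descr b : generated I b -> b <> 1%g ->
  exists2 t, I t & len b = (len (b * t)%g).+1.
Proof.
case/gen_reduced=> s; case/lastP: s => [|s t] [Is E sz] b1; first by case: b1.
have [It {}Is] := word_in_rconsP Is; exists t => //.
have := len_mulr b (IS It).
have -> : (b * t)%g = gprod s.
  by rewrite E gprod_rcons -gmulA S_invol ?mulg1 //; exact: IS.
have := len_word (word_in_sub IS Is).
by rewrite size_rcons in sz; lia.
Qed.

Lemma gen_descl b : generated I b -> b <> 1%g ->
  exists2 t, I t & len b = (len (t * b)%g).+1.
Proof.
move=> Ib b1; have [||t It E] := @gen_descr b^-1%g; first exact: generatedV.
  by move=> E; apply: b1; rewrite -[b]invgK E invg1.
exists t => //; rewrite -(len_inv b) E -(len_inv (t * b)%g) ginvM.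
by rewrite (S_inv (IS It)).
Qed.

Lemma min_coset x : exists2 b, generated I b &
  forall b', generated I b' -> (len (x * b)%g <= len (x * b * b')%g)%N.
Proof.
pose Q k := `[< exists2 b, generated I b & len (x * b)%g = k >].
have exQ : exists k, Q k.
  by exists (len (x * 1)%g); apply/asboolP; exists 1%g => //; exact: generated1.
case: (ex_minnP exQ) => k /asboolP[b Ib <-] H; exists b => // b' Ib'.
apply: H; apply/asboolP; exists (b * b')%g; last by rewrite gmulA.
exact: generatedM.
Qed.

(** Induct on a word of b. If a letter t acted in opposite directions on the lengths of b and x b,
    then by [len_conj] a conjugate of t in W_I would shorten x. *)
Lemma len_min_coset x b :
  (forall b', generated I b' -> (len x <= len (x * b')%g)%N) ->
  generated I b -> len (x * b)%g = (len x + len b)%N.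
Proof.
move=> minx /genP[a /IS|s]; first exact: S_invol.
elim/last_ind: s b => [|s t IH] b Is ->{b};
  first by rewrite /= mulg1 len1 addn0.
have [It {}Is] := word_in_rconsP Is.
have {IH} := IH _ Is erefl; rewrite gprod_rcons.
move: (gen_word Is); move: (gprod s) => b Ib E.
have Iconj c : generated I c -> generated I (c * t * c^-1)%g.
  move=> Ic; apply: generatedM; last exact: generatedV.
  by apply: generatedM => //; exact: generated_in.
have St := IS It.
have [Ebt|Ebt] := len_mulr b St; have [Exbt|Exbt] := len_mulr (x * b)%g St;
  rewrite gmulA.
- by lia.
- have := @len_conj x b t St; rewrite Ebt Exbt !ltnS !leqnn => /(_ isT isT).
  by have := minx _ (Iconj _ Ib); lia.
- have := @len_conj x (b * t)%g t St.
  have K : (b * t * t)%g = b by rewrite -gmulA S_invol ?mulg1.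
  rewrite gmulA -(gmulA (x * b)%g) S_invol // mulg1.
  rewrite K Ebt Exbt !ltnS !leqnn => /(_ isT isT).
  have Ibt : generated I (b * t)%g by apply: generatedM => //;
    exact: generated_in.
  have := minx _ (Iconj _ Ibt); rewrite K; lia.
- by lia.
Qed.

(** Absence of right descents in I already gives minimality: write x = (x c) c^-1 with x c minimal
    in its coset; a last letter of c^-1, if there were one, would shorten x. *)
Lemma len_coset x b : (forall t, I t -> (len x < len (x * t)%g)%N) ->
  generated I b -> len (x * b)%g = (len x + len b)%N.
Proof.
move=> redx; apply: len_min_coset.
have [c Ic minc] := min_coset x.
have [c1|c1] := pselect (c = 1%g).
  by move=> b' Ib'; have := minc _ Ib'; rewrite c1 mulg1.
have IcV : generated I c^-1%g by exact: generatedV.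
have [|t It E] := gen_descr IcV.
  by move=> E; apply: c1; rewrite -[c]invgK E invg1.
have := redx _ It.
have := len_min_coset minc IcV; rewrite mulgK => ->.
have := len_min_coset minc (generatedM IcV (generated_in It)).
by rewrite gmulA mulgK => ->; lia.
Qed.

Lemma len_cosetl x a : (forall t, I t -> (len x < len (t * x)%g)%N) ->
  generated I a -> len (a * x)%g = (len a + len x)%N.
Proof.
move=> redx Ia; rewrite -(len_inv (a * x)%g) ginvM len_coset;
  last exact: generatedV.
  by rewrite !len_inv addnC.
by move=> t It; rewrite len_inv -(S_inv (IS It)) -ginvM len_inv; exact: redx.
Qed.

(* Along a reduced word t_1 ... t_k of b, left multiplication by s raises the
   length of m and lowers that of m t_1 ... t_k; at the step where this changes
   fold_eq applies. *)
Lemma coset_exchange m (s : G) b : (forall t,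
  I t -> (len m < len (m * t)%g)%N) ->
  S s -> (len m < len (s * m)%g)%N -> generated I b ->
  (len (s * m * b)%g < len (m * b)%g)%N -> exists2 t, I t & (s * m = m * t)%g.
Proof.
move=> redm Ss sm /gen_reduced[w [Iw -> sz]]; move: sz.
elim/last_ind: w Iw => [|w t IH] Iw sz.
  by rewrite /= !mulg1; lia.
have [It {}Iw] := word_in_rconsP Iw; have Ib := gen_word Iw.
have E := len_coset redm (gen_word Iw).
have := len_coset redm (gen_word (word_in_rcons It Iw)).
have := len_word (word_in_sub IS Iw).
rewrite size_rcons in sz; rewrite -sz gprod_rcons !gmulA.
have szb : size w = len (gprod w).
  have := len_word (word_in_sub IS Iw).
  have := len_mulr (gprod w) (IS It).
  by rewrite gprod_rcons in sz; lia.
move=> _ Et.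
have [lt|ge] := ltnP (len (s * m * gprod w)%g) (len (m * gprod w)%g).
  by move=> _; exact: IH.
move=> lt.
have F : (s * (m * gprod w) = m * gprod w * t)%g.
  apply: fold_eq => //; first exact: IS.
  - by rewrite Et E -szb; lia.
  - have := len_mull (m * gprod w)%g Ss.
    by move: lt ge; rewrite !gmulA Et E -szb; lia.
exists (gprod w * t * (gprod w)^-1)%g; last first.
  by rewrite -[LHS](mulgK (gprod w)) -(gmulA s) F !gmulA.
have Ir : generated I (gprod w * t * (gprod w)^-1)%g.
  apply: generatedM; last exact: generatedV.
  by apply: generatedM => //; exact: generated_in.
(* Additivity along m W_I compares l(s m) = l(m) + 1 with l(m) + l(r) for this element r of W_I, so
   r has length 1. *)
apply: gen_len1 => //.
have := len_coset redm Ir.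
have -> : (m * (gprod w * t * (gprod w)^-1) = s * m)%g.
  by rewrite -[RHS](mulgK (gprod w)) -(gmulA s) F !gmulA.
by have := len_mull m Ss; lia.
Qed.

End Parabolic.

Definition reduced (I J : set G) x : Prop :=
  (forall a, I a -> (len x < len (a * x)%g)%N) /\
  (forall b, J b -> (len x < len (x * b)%g)%N).

(** * Reduced representatives of double cosets *)

Section DoubleCosets.
Variables I J : set G.
Hypotheses (IS : I `<=` S) (JS : J `<=` S).

(** Induct on the length of a. A first letter s of a lowers the length of m b = a m', so
    [coset_exchange] gives s m = m t with t in J, and s is absorbed into b. *)
Lemma reduced_uniq m m' a b : reduced I J m -> reduced I J m' ->
  generated I a -> generated J b -> (a * m' = m * b)%g -> m' = m.
Proof.
move=> [rIm rJm] [rIm' rJm'] Ia; have [k] := ubnP (len a).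
elim: k => // k IH in a b Ia * => lek Jb E.
have E1 := len_cosetl IS rIm' Ia; have E2 := len_coset JS rJm Jb.
have E' : (m' * b^-1 = a^-1 * m)%g.
  by rewrite -[m'](mulKg a) E !gmulA mulgK.
have E3 := len_cosetl IS rIm (generatedV Ia).
have E4 := len_coset JS rJm' (generatedV Jb).
rewrite E' E3 !len_inv in E4; rewrite E E2 in E1.
have [a1|/eqP a1] := eqVneq a 1%g.
  have b1 : b = 1%g by apply: (gen_len0 JS Jb); move: E1 E4; rewrite a1 len1;
    lia.
  by move: E; rewrite a1 b1 mul1g mulg1.
have [s Is Ea] := gen_descl IS Ia a1.
have Isa : generated I (s * a)%g by apply: generatedM => //;
  exact: generated_in.
have lt : (len (s * m * b)%g < len (m * b)%g)%N.
  rewrite -gmulA -E gmulA (len_cosetl IS rIm' Isa) (len_cosetl IS rIm' Ia).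
  by lia.
have [t Jt Et] := coset_exchange JS rJm (IS Is) (rIm _ Is) Jb lt.
apply: (IH (s * a)%g (t * b)%g) => //; first by lia.
  by apply: generatedM => //; exact: generated_in.
by rewrite -gmulA E gmulA Et gmulA.
Qed.

(** In the same induction each letter s split off from a satisfies s z = z t with t in J. Thus W_I
    and z W_J z^-1 meet in a standard parabolic subgroup. *)
Lemma gen_meet_conj z a b : reduced I J z -> generated I a -> generated J b ->
  (a * z = z * b)%g -> generated (I `&` [set s | J (z^-1 * s * z)%g]) a.
Proof.
move=> [rIz rJz] Ia; have [k] := ubnP (len a).
elim: k => // k IH in a b Ia * => lek Jb E.
have [->|/eqP a1] := eqVneq a 1%g; first exact: generated1.
have [s Is Ea] := gen_descl IS Ia a1.
have Isa : generated I (s * a)%g by apply: generatedM => //;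
  exact: generated_in.
have lt : (len (s * z * b)%g < len (z * b)%g)%N.
  rewrite -gmulA -E gmulA (len_cosetl IS rIz Isa) (len_cosetl IS rIz Ia).
  by lia.
have [t Jt Et] := coset_exchange JS rJz (IS Is) (rIz _ Is) Jb lt.
have -> : a = (s * (s * a))%g by rewrite gmulA S_invol ?mul1g //; exact: IS.
apply: generatedM.
  apply: generated_in; split=> //=.
  by rewrite -gmulA Et mulKg.
apply: (IH _ (t * b)%g) => //; first by lia.
  by apply: generatedM => //; exact: generated_in.
by rewrite -gmulA E gmulA Et gmulA.
Qed.

End DoubleCosets.
End Length.

(** * Root data *)

Lemma seq_argmax (T : eqType) (s : seq T) (Q : T -> Prop) (f : T -> int) :
  (exists2 x, x \in s & Q x) ->
  exists x, [/\ x \in s, Q x & forall y, y \in s -> Q y -> f y <= f x].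
Proof.
elim: s => [|a s IH] [x]; first by rewrite in_nil.
have [[y ys Qy]|no] := pselect (exists2 y, y \in s & Q y).
  move=> _ _; have [z [zs Qz maxz]] := IH (ex_intro2 _ _ y ys Qy).
  have [[Qa fa]|na] := pselect (Q a /\ f z <= f a).
    exists a; split=> //; first exact: mem_head.
    by move=> w; rewrite inE => /predU1P[->//|ws Qw];
      apply: le_trans (maxz _ ws Qw) fa.
  exists z; split=> //; first by rewrite inE zs orbT.
  move=> w; rewrite inE => /predU1P[->{w} Qa|]; last exact: maxz.
  by rewrite leNgt; apply/negP => /ltW lt; apply: na.
rewrite inE => /predU1P[->{x} Qa|xs Qx]; last by case: no; exists x.
exists a; split=> //; first exact: mem_head.
by move=> y; rewrite inE => /predU1P[->//|ys Qy]; case: no; exists y.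
Qed.

Section Pairing.
Variable n : nat.
Implicit Types (l m : 'cV[int]_n) (y z : 'rV[int]_n).

Lemma pairingDl l m y : pairing (l + m) y = pairing l y + pairing m y.
Proof. by rewrite /pairing mulmxDr mxE. Qed.
Lemma pairingDr l y z : pairing l (y + z) = pairing l y + pairing l z.
Proof. by rewrite /pairing mulmxDl mxE. Qed.
Lemma pairingZl (k : int) l y : pairing (k *: l) y = k * pairing l y.
Proof. by rewrite /pairing -scalemxAr mxE. Qed.
Lemma pairingZr (k : int) l y : pairing l (k *: y) = k * pairing l y.
Proof. by rewrite /pairing -scalemxAl mxE. Qed.
Lemma pairingNl l y : pairing (- l) y = - pairing l y.
Proof. by rewrite /pairing mulmxN mxE. Qed.
Lemma pairingNr l y : pairing l (- y) = - pairing l y.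
Proof. by rewrite /pairing mulNmx mxE. Qed.
Lemma pairingBl l m y : pairing (l - m) y = pairing l y - pairing m y.
Proof. by rewrite pairingDl pairingNl. Qed.
Lemma pairingBr l y z : pairing l (y - z) = pairing l y - pairing l z.
Proof. by rewrite pairingDr pairingNr. Qed.
Lemma pairing0l y : pairing 0 y = 0.
Proof. by rewrite /pairing mulmx0 mxE. Qed.
Lemma pairing0r l : pairing l 0 = 0.
Proof. by rewrite /pairing mul0mx mxE. Qed.
Lemma pairingMnl l y (k : nat) : pairing (l *+ k) y = k%:Z * pairing l y.
Proof. by rewrite -scaler_nat pairingZl natz. Qed.
Lemma pairingMnr l y (k : nat) : pairing l (y *+ k) = k%:Z * pairing l y.
Proof. by rewrite -scaler_nat pairingZr natz. Qed.

Lemma pairing_suml (T : Type) (s : seq T) (P : pred T) (F : T -> 'cV[int]_n) y :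
  pairing (\sum_(i <- s | P i) F i) y = \sum_(i <- s | P i) pairing (F i) y.
Proof.
exact: (big_morph (fun l => pairing l y) (fun a b =>
  pairingDl a b y) (pairing0l y)).
Qed.

Lemma pairing_sumr (T : Type) (s : seq T) (P : pred T) l (F : T -> 'rV[int]_n) :
  pairing l (\sum_(i <- s | P i) F i) = \sum_(i <- s | P i) pairing l (F i).
Proof. exact: (big_morph (pairing l) (pairingDr l) (pairing0r l)). Qed.

Lemma pairing_inj y z : (forall l, pairing l y = pairing l z) -> y = z.
Proof.
move=> H; apply/matrixP => i j; rewrite (ord1 i).
have := H (delta_mx j 0); rewrite /pairing -!colE !mxE //.
Qed.

Lemma pairing_self_scale (k m : int) l y : pairing l y != 0 ->
  k *: l = m *: l -> k = m.
Proof.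
move=> ly /(congr1 (fun u => pairing u y)); rewrite !pairingZl.
by move/(mulIf ly).
Qed.

End Pairing.

(** * Invariant form and positive roots *)

Section RootSystem.
Variables (n : nat) (R : rootDatum n).
Notation X := 'cV[int]_n.
Notation Phi := (roots R).
Notation Delta := (base R).
Notation crt := (coroot R).
Notation refl := (reflection_mx R).
Implicit Types (a b c d : X) (mu nu : X).

Definition cpair mu a : int := pairing mu (crt a).
Notation pr := cpair.

Lemma pr_self a : a \in Phi -> pr a a = 2%:Z.
Proof. exact: pairing_coroot. Qed.

Lemma root_neq0 a : a \in Phi -> a != 0.
Proof.
by move=> /pr_self; apply: contra_eq_neq => ->; rewrite /cpair pairing0l.
Qed.

Lemma reflE a mu : refl a *m mu = mu - pr mu a *: a.
Proof. exact: reflection_mxE. Qed.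

Lemma refl_root a b : a \in Phi -> b \in Phi -> refl a *m b \in Phi.
Proof. by move=> aP bP; rewrite reflE; apply: roots_stable. Qed.

Lemma reflection_mx_self a : a \in Phi -> refl a *m a = - a.
Proof.
move=> aP; rewrite reflE pr_self // (scaler_nat 2) mulr2n opprD addrA subrr.
by rewrite add0r.
Qed.

Lemma reflKv a mu : a \in Phi -> refl a *m (refl a *m mu) = mu.
Proof. by move=> aP; rewrite mulmxA reflection_mxK // mul1mx. Qed.

Lemma root_opp a : a \in Phi -> - a \in Phi.
Proof. by move=> aP; rewrite -reflection_mx_self //; apply: refl_root. Qed.

(** The transpose of the reflection in a, acting on Y(T). *)
Definition corefl a (y : 'rV[int]_n) := y - pairing a y *: crt a.

Lemma pairing_refl a mu y : pairing (refl a *m mu) y = pairing mu (corefl a y).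
Proof.
rewrite reflE pairingBl pairingZl /corefl pairingBr pairingZr /cpair; ring.
Qed.

Lemma coreflK a : a \in Phi -> involutive (corefl a).
Proof.
by move=> aP y; apply: pairing_inj => l; rewrite -!pairing_refl reflKv.
Qed.

(** Repetitions are removed so that each [corefl a] permutes the list; this makes [form]
    invariant. *)
Definition coroots := undup [seq crt a | a <- Phi].

Lemma corootsP a : a \in Phi -> crt a \in coroots.
Proof. by move=> aP; rewrite mem_undup map_f. Qed.

Lemma corefl_coroots a : a \in Phi ->
  perm_eq [seq corefl a y | y <- coroots] coroots.
Proof.
move=> aP; have inj := inv_inj (coreflK aP).
have U : uniq [seq corefl a y | y <- coroots] by rewrite map_inj_uniq
  ?undup_uniq.
apply: uniq_perm => //; first exact: undup_uniq.
have sub : {subset [seq corefl a y | y <- coroots] <= coroots}.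
  move=> z /mapP[y]; rewrite mem_undup => /mapP[b bP ->] ->.
  rewrite mem_undup; have [c cP E] := coroots_stable aP bP.
  by rewrite /corefl E; exact: map_f.
by have [] := uniq_min_size U sub; rewrite // size_map.
Qed.

(** An invariant form, only semidefinite on X(T) but positive on every root, because the coroot of
    that root contributes the term 4. *)
Definition form mu nu : int := \sum_(y <- coroots) pairing mu y * pairing nu y.

Lemma formC mu nu : form mu nu = form nu mu.
Proof. by apply: eq_bigr => y _; rewrite mulrC. Qed.
Lemma formDl mu mu' nu : form (mu + mu') nu = form mu nu + form mu' nu.
Proof.
by rewrite /form -big_split; apply: eq_bigr => y _; rewrite pairingDl mulrDl.
Qed.
Lemma formZl k mu nu : form (k *: mu) nu = k * form mu nu.
Proof.
by rewrite /form mulr_sumr; apply: eq_bigr => y _; rewrite pairingZl mulrA.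
Qed.
Lemma formDr mu nu nu' : form mu (nu + nu') = form mu nu + form mu nu'.
Proof. by rewrite formC formDl !(formC mu). Qed.
Lemma formZr k mu nu : form mu (k *: nu) = k * form mu nu.
Proof. by rewrite formC formZl formC. Qed.
Lemma formNl mu nu : form (- mu) nu = - form mu nu.
Proof. by rewrite -scaleN1r formZl mulN1r. Qed.
Lemma formNr mu nu : form mu (- nu) = - form mu nu.
Proof. by rewrite formC formNl formC. Qed.
Lemma form_suml (T : Type) (s : seq T) (F : T -> X) nu :
  form (\sum_(i <- s) F i) nu = \sum_(i <- s) form (F i) nu.
Proof.
apply: (big_morph (fun l => form l nu) (fun a b => formDl a b nu)).
by rewrite -(scale0r 0) formZl mul0r.
Qed.

Lemma form_ge0 mu : 0 <= form mu mu.
Proof. by apply: sumr_ge0 => y _; rewrite -expr2 sqr_ge0. Qed.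

Lemma form_eq0 mu nu : form mu mu = 0 -> form mu nu = 0.
Proof.
move/eqP; rewrite psumr_eq0 => [/allP H|y _]; last by rewrite -expr2 sqr_ge0.
apply: big1_seq => y /andP[_ /H /=].
by rewrite mulf_eq0 orbb => /eqP ->; rewrite mul0r.
Qed.

Lemma form_gt0 a : a \in Phi -> 0 < form a a.
Proof.
move=> aP; rewrite lt_def form_ge0 andbT; apply/eqP => /eqP.
rewrite psumr_eq0 => [/allP H|y _]; last by rewrite -expr2 sqr_ge0.
by have := H _ (corootsP aP); rewrite /= -/(pr a a) pr_self.
Qed.

Lemma form_refl a mu nu : a \in Phi ->
  form (refl a *m mu) (refl a *m nu) = form mu nu.
Proof.
move=> aP; rewrite /form -[RHS](perm_big _ (corefl_coroots aP)) big_map.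
by apply: eq_bigr => y _; rewrite !pairing_refl.
Qed.

Lemma form_pr a mu : a \in Phi -> 2%:Z * form a mu = form a a * pr mu a.
Proof.
move=> aP; have := form_refl a mu aP; rewrite reflection_mx_self // reflE.
rewrite formNl formDr formNr formZr; lia.
Qed.

Lemma coroot_form_inj a b : a \in Phi -> b \in Phi -> form a a = form b b ->
  (forall mu, form a mu = form b mu) -> crt a = crt b.
Proof.
move=> aP bP E H; apply: pairing_inj => mu.
apply: (mulfI (x := form a a)); first by rewrite gt_eqF ?form_gt0.
by rewrite -/(pr mu a) -/(pr mu b) -form_pr // {}H form_pr // E.
Qed.

(** The axiom [coroots_stable] yields the coroot of some unnamed root. By [form_pr] the form
    determines each coroot, and its invariance identifies the one at the reflected root. *)
Lemma coroot_refl a b : a \in Phi -> b \in Phi ->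
  crt (refl a *m b) = crt b - pr a b *: crt a.
Proof.
move=> aP bP; apply: pairing_inj => mu;
  rewrite -/(corefl a (crt b)) -pairing_refl.
apply: (mulfI (x := form b b)); first by rewrite gt_eqF ?form_gt0.
rewrite -{1}(form_refl b b aP) -!/(pr _ _) -form_pr ?refl_root // -form_pr //.
by rewrite -{1}[mu](reflKv _ aP) form_refl.
Qed.

Lemma coroot_opp a : a \in Phi -> crt (- a) = - crt a.
Proof.
move=> aP; rewrite -reflection_mx_self // coroot_refl // pr_self // (scaler_nat
  2).
by rewrite mulr2n opprD addrA subrr add0r.
Qed.

Lemma pr_gt0 a b : a \in Phi -> b \in Phi -> (0 < pr a b) = (0 < pr b a).
Proof.
move=> aP bP; have := form_pr a bP; have := form_pr b aP; rewrite (formC b a).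
have := form_gt0 aP; have := form_gt0 bP.
move=> fb fa Ea Eb.
rewrite -(pmulr_rgt0 _ fb) -Eb Ea pmulr_rgt0 //.
Qed.

Lemma prNl a b : pr (- a) b = - pr a b.
Proof. exact: pairingNl. Qed.

Lemma prNr a b : b \in Phi -> pr a (- b) = - pr a b.
Proof. by move=> bP; rewrite /cpair coroot_opp // pairingNr. Qed.

Lemma pr_eq0 a b : a \in Phi -> b \in Phi -> (pr a b == 0) = (pr b a == 0).
Proof.
move=> aP bP; have := pr_gt0 aP bP; have := pr_gt0 (root_opp aP) bP.
rewrite !(prNl, prNr) //; lia.
Qed.

Lemma pr_lt0 a b : a \in Phi -> b \in Phi -> (pr a b < 0) = (pr b a < 0).
Proof. by move=> aP bP; have := pr_gt0 aP bP; have := pr_eq0 aP bP; lia. Qed.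

Lemma pr_refl a b c : a \in Phi -> c \in Phi ->
  pr (refl a *m b) (refl a *m c) = pr b c.
Proof.
move=> aP cP; rewrite /cpair coroot_refl // -/(corefl a (crt c)) -pairing_refl.
by rewrite reflKv.
Qed.

Lemma pr_refl_self a mu : a \in Phi -> pr (refl a *m mu) a = - pr mu a.
Proof.
by move=> aP; rewrite reflE /cpair pairingBl pairingZl -/(pr a a) pr_self //;
  lia.
Qed.

Lemma refl_refl a b : a \in Phi -> b \in Phi ->
  refl (refl a *m b) *m refl a = refl a *m refl b.
Proof.
move=> aP bP; apply/matrixP => i j.
have H mu : refl (refl a *m b) *m (refl a *m mu) = refl a *m (refl b *m mu).
  rewrite reflE pr_refl // (reflE b mu) mulmxBr -scalemxAr //.
have := H (delta_mx j 0); rewrite !mulmxA -!colE.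
by move=> /(congr1 (fun u : X => u i 0)); rewrite mxE [in RHS]mxE.
Qed.

Lemma base_root a : a \in Delta -> a \in Phi.
Proof. exact: base_roots. Qed.

Lemma base_coef_uniq (e e' : X -> int) :
  \sum_(a <- Delta) e a *: a = \sum_(a <- Delta) e' a *: a ->
  forall a, a \in Delta -> e a = e' a.
Proof.
move=> /eqP; rewrite -subr_eq0 -sumrB => /eqP E a aD.
apply/eqP; rewrite -subr_eq0; apply/eqP.
apply: (@base_free _ R (fun a => e a - e' a)) => //.
by rewrite -[RHS]E; apply: eq_bigr => b _; rewrite scalerBl.
Qed.

Lemma base_delta a (k : int) : a \in Delta ->
  \sum_(b <- Delta) (if b == a then k else 0) *: b = k *: a.
Proof.
move=> aD; rewrite (bigD1_seq a) //=; last exact: base_uniq.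
rewrite eqxx big1 ?addr0 // => b /negPf ->; exact: scale0r.
Qed.

Lemma mulrn_scale (V : lmodType int) (x : V) (k : nat) : x *+ k = k%:Z *: x.
Proof. by rewrite -scaler_nat natz. Qed.

Notation posr := (positive_root R).

Lemma pos_or a : a \in Phi -> posr a \/ posr (- a).
Proof.
move=> aP; have [e [E|E]] := base_span aP; first by left; split; last exists e.
right; split; first exact: root_opp.
by exists e; rewrite E opprK.
Qed.

Lemma pos_not a : posr a -> ~ posr (- a).
Proof.
move=> [aP [e E]] [_ [e' E']].
have /base_free H : \sum_(a <- Delta) ((e a)%:Z + (e' a)%:Z) *: a = 0.
  rewrite -[RHS](subrr a) {1}E E' -big_split; apply: eq_bigr => b _ /=.
  by rewrite !mulrn_scale scalerDl.
case/eqP: (root_neq0 aP); rewrite E big1_seq // => b /andP[_ /H].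
by case: (e b) => // k; lia.
Qed.

Lemma base_pos a : a \in Delta -> posr a.
Proof.
move=> aD; split; first exact: base_root.
exists (fun b => if b == a then 1%N else 0%N).
rewrite -{1}[a]scale1r -(base_delta 1 aD); apply: eq_bigr => b _.
by case: eqP => _; rewrite ?scale1r ?scale0r.
Qed.

(** The reflection changes only the coefficient of a, so if the image were negative, b would be a
    multiple of a. *)
Lemma simple_refl_pos a b : a \in Delta -> posr b -> b <> a ->
  posr (refl a *m b).
Proof.
move=> aD [bP [e E]] ba; have aP := base_root aD.
have [//|[_ [e' E']]] := pos_or (refl_root aP bP); exfalso.
have H c : c \in Delta -> (e c)%:Z + (e' c)%:Z = if c == a then pr b a else 0.
  apply: (@base_coef_uniq (fun c => (e c)%:Z + (e' c)%:Z)
                          (fun c => if c == a then pr b a else 0)).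
  rewrite base_delta //; transitivity (b - refl a *m b);
    [|by rewrite reflE opprB addrC subrK].
  rewrite {1}E E' -big_split; apply: eq_bigr => x _ /=.
  by rewrite !mulrn_scale scalerDl.
have {}E : b = (e a)%:Z *: a.
  rewrite -(base_delta _ aD) {1}E; apply: eq_big_seq => c cD.
  rewrite mulrn_scale; case: eqP => [->//|/eqP ca].
  by have := H c cD; rewrite (negPf ca); case: (e c) => //; lia.
(* From 2 = e(a) <a, b^vee> the multiple e(a) is 1 or 2, and 2 is excluded by reducedness. *)
have := pr_self bP; rewrite {1}E /cpair pairingZl -/(pr a b) => E2.
case: (e a) E E2 => [|[|[|k]]] E E2.
- by rewrite mul0r in E2.
- by apply: ba; rewrite E scale1r.
- have := roots_reduced aP; rewrite mulrn_scale -E bP //.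
- move: (pr a b) E2 => m E2; have [m0|m1] : m <= 0 \/ 1 <= m by lia.
    by nia.
  by nia.
Qed.

Lemma form_pr_gt0 a mu : a \in Phi -> (0 < form mu a) = (0 < pr mu a).
Proof.
move=> aP; have := form_pr mu aP; have := form_gt0 aP => fa;
  rewrite (formC a) => E.
by rewrite -(pmulr_rgt0 (pr mu a) fa) -E pmulr_rgt0.
Qed.

(** Induct on the height. Since the form is positive at b, some simple root has positive product
    with b; reflecting in it lowers the height, and the root stays positive unless b is simple. *)
Lemma pos_root_ind (Q : X -> Prop) : (forall a, a \in Delta -> Q a) ->
  (forall a b, a \in Delta -> posr b -> pr b a < 0 -> Q b -> Q (refl a *m b)) ->
  forall b, posr b -> Q b.
Proof.
move=> Qbase Qstep b [bP [e E]].
have [k] := ubnP (\sum_(a <- Delta) e a)%N.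
elim: k => // k IH in b bP e E *; move=> lek.
have [bD|nbD] := boolP (b \in Delta); first exact: Qbase.
have [a aD ab] : exists2 a, a \in Delta & 0 < pr b a.
  apply: contrapT => H; have := form_gt0 bP; rewrite {1}E form_suml.
  rewrite ltNge => /negP; apply; rewrite big_seq; apply: sumr_le0 => a aD.
  rewrite mulrn_scale formZl.
  suff : form a b <= 0 by case: (e a) => [|m]; nia.
  rewrite leNgt formC form_pr_gt0 ?base_root //; apply/negP => ab.
  by apply: H; exists a.
have aP := base_root aD.
have pb' : posr (refl a *m b).
  apply: simple_refl_pos => //; first by split=> //; exists e.
  by move=> ba; rewrite ba aD in nbD.
have [b'P [e' E']] := pb'.
have H c : c \in Delta -> (e' c)%:Z = (e c)%:Z - (if c == a then pr b a else 0).
  apply: (@base_coef_uniq (fun c => (e' c)%:Z)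
          (fun c => (e c)%:Z - (if c == a then pr b a else 0))).
  under [RHS]eq_bigr do rewrite scalerBl.
  rewrite sumrB base_delta //.
  under eq_bigr do rewrite -mulrn_scale.
  under [in RHS]eq_bigr do rewrite -mulrn_scale.
  by rewrite -E -E' reflE.
rewrite -[b](reflKv _ aP); apply: Qstep => //.
  by rewrite pr_refl_self // oppr_lt0.
apply: (IH _ b'P e') => //; rewrite -ltnS; apply: leq_trans lek; rewrite ltnS.
rewrite (bigD1_seq a) ?base_uniq //= [X in (_ < X)%N](bigD1_seq a) ?base_uniq
  //=.
rewrite -addSn leq_add //; first by have := H a aD; rewrite eqxx; lia.
rewrite big_seq_cond [X in (_ <= X)%N]big_seq_cond.
apply: leq_sum => c /andP[cD /negPf ca]; have := H c cD; rewrite ca; lia.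
Qed.

End RootSystem.

(** * Components and the existence of highest coroots *)

Section HighestCoroot.
Variables (n : nat) (R : rootDatum n).
Notation X := 'cV[int]_n.
Notation Phi := (roots R).
Notation Delta := (base R).
Notation crt := (coroot R).
Notation refl := (reflection_mx R).
Notation posr := (positive_root R).
Notation pr := (cpair R).
Notation form := (form R).
Implicit Types (a b c d : X) (mu nu : X) (K : X -> Prop).

Definition rho2 : X := \sum_(b <- [seq b <- undup Phi | `[< posr b >]]) b.

(** The reflection in a permutes the positive roots other than a and negates a. *)
Lemma rho2_simple a : a \in Delta -> pr rho2 a = 2%:Z.
Proof.
move=> aD; have aP := base_root aD; have pa := base_pos aD.
pose s := [seq b <- undup Phi | `[< posr b >] && (b != a)].
have us : uniq s by rewrite filter_uniq ?undup_uniq.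
have memP b : (b \in s) = `[< posr b >] && (b != a).
  rewrite mem_filter mem_undup; case: asboolP => //= -[bP _].
  by rewrite bP andbT.
have E : rho2 = a + \sum_(b <- s) b.
  rewrite /rho2 [LHS](bigD1_seq a) ?filter_uniq ?undup_uniq //=.
    by rewrite -big_filter -filter_predI; congr (_ + \sum_(i <- _) i);
      apply: eq_filter => b /=; rewrite andbC.
  by rewrite mem_filter mem_undup aP andbT; apply/asboolP.
have inj : injective (fun b => refl a *m b).
  by move=> b c /(congr1 (mulmx (refl a))); rewrite !reflKv.
have perm : perm_eq [seq refl a *m b | b <- s] s.
  have U : uniq [seq refl a *m b | b <- s] by rewrite map_inj_uniq.
  apply: uniq_perm => //.
  have sub : {subset [seq refl a *m b | b <- s] <= s}.
    move=> z /mapP[b]; rewrite memP => /andP[/asboolP pb /eqP ba] ->;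
      rewrite memP.
    apply/andP; split; first by apply/asboolP; exact: simple_refl_pos.
    apply/eqP => E'; have [bP _] := pb; apply: (pos_not pb).
    by rewrite -(reflKv b aP) E' reflection_mx_self // opprK.
  by have [_] := uniq_min_size U sub (eq_leq (esym (size_map _ _))).
have : refl a *m rho2 = rho2 - 2%:Z *: a.
  rewrite {1}E mulmxDr reflection_mx_self // mulmx_sumr -(big_map (mulmx (refl
    a)) xpredT id).
  rewrite (perm_big _ perm) /= E (scaler_nat 2) mulr2n opprD addrACA.
  by rewrite subrr add0r addrC.
rewrite reflE => /addrI /oppr_inj; apply: (pairing_self_scale (y := crt a)).
by rewrite -/(pr a a) pr_self.
Qed.

(** On coroots this is twice the height with respect to the simple coroots. *)
Definition cht (y : 'rV[int]_n) : int := pairing rho2 y.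
Notation ht := cht.

(** The same notion serves for roots, with f the identity, and for coroots, with f = [crt]. *)
Definition Ncomb (V : zmodType) (K : X -> Prop) (f : X -> V) (y : V) : Prop :=
  exists e : X -> nat, (forall a, e a != 0%N -> K a) /\
    y = \sum_(a <- Delta) f a *+ e a.

Lemma Ncomb_mono (V : zmodType) K K' (f : X -> V) y : (forall a, K a -> K' a) ->
  Ncomb K f y -> Ncomb K' f y.
Proof. by move=> KK' [e [H E]]; exists e; split=> // a /H /KK'. Qed.

Lemma Ncomb0 (V : zmodType) K (f : X -> V) : Ncomb K f 0.
Proof. by exists (fun=> 0%N); split=> //; rewrite big1. Qed.

Lemma NcombD (V : zmodType) K (f : X -> V) y z :
  Ncomb K f y -> Ncomb K f z -> Ncomb K f (y + z).
Proof.
move=> [e [He ->]] [e' [He' ->]]; exists (fun a => (e a + e' a)%N); split.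
  by move=> a; rewrite addn_eq0 negb_and => /orP[/He|/He'].
by rewrite -big_split; apply: eq_bigr => a _; rewrite mulrnDr.
Qed.

Lemma NcombMn (V : zmodType) K (f : X -> V) y k :
  Ncomb K f y -> Ncomb K f (y *+ k).
Proof.
move=> Ky; elim: k => [|k IH]; first by rewrite mulr0n; exact: Ncomb0.
by rewrite mulrS; exact: NcombD.
Qed.

Lemma Ncomb_base (V : zmodType) K (f : X -> V) a :
  a \in Delta -> K a -> Ncomb K f (f a).
Proof.
move=> aD Ka; exists (fun b => if b == a then 1%N else 0%N); split.
  by move=> b; case: (b =P a) => [->|].
rewrite (bigD1_seq a) ?base_uniq //= eqxx big1 ?addr0 // => b /negPf ->.
by rewrite mulr0n.
Qed.

Lemma Ncomb_pairing K y q : (forall a, a \in Delta -> 0 < pr q a) ->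
  Ncomb K crt y -> 0 <= pairing q y /\ (pairing q y = 0 -> y = 0).
Proof.
move=> qpos [e [_ ->]]; set y' := \sum_(a <- _) _.
have E : pairing q y' = \sum_(a <- Delta) (e a)%:Z * pr q a.
  by rewrite pairing_sumr; apply: eq_bigr => a _; rewrite pairingMnr.
have ge0 a : a \in Delta -> 0 <= (e a)%:Z * pr q a by move/qpos; nia.
rewrite E; split; first by rewrite big_seq; apply: sumr_ge0 => a /ge0.
rewrite big_seq_cond => /eqP; rewrite psumr_eq0 => [/allP H|a /andP[/ge0]] //.
apply: big1_seq => a /andP[_ aD]; have := H a aD; rewrite aD /= mulf_eq0.
by case/orP=> [/eqP[->] //|]; rewrite (gt_eqF (qpos a aD)).
Qed.

Lemma ht_Ncomb K y : Ncomb K crt y -> 0 <= ht y /\ (ht y = 0 -> y = 0).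
Proof. by apply: Ncomb_pairing => a aD; rewrite rho2_simple. Qed.

(** Such a K cuts out a union of connected components of the Dynkin diagram. *)
Definition orth_cut K : Prop :=
  forall a b, a \in Delta -> b \in Delta -> K a -> ~ K b -> pr a b = 0.

Definition spanned K b : Prop := Ncomb K id b /\ Ncomb K crt (crt b).

Lemma spanned_base K a : a \in Delta -> K a -> spanned K a.
Proof. by move=> aD Ka; split;
  [exact: (@Ncomb_base _ K id)|exact: Ncomb_base]. Qed.

Lemma spanned_refl K a b : a \in Delta -> b \in Phi -> K a -> pr b a < 0 ->
  spanned K b -> spanned K (refl a *m b).
Proof.
move=> aD bP Ka ba [Kb Kb']; have aP := base_root aD.
have ab : pr a b < 0 by rewrite pr_lt0.
rewrite /spanned coroot_refl // reflE.
have -> : - (pr b a *: a) = a *+ `|pr b a|%N.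
  by rewrite mulrn_scale -scaleNr; congr (_ *: _); lia.
have -> : - (pr a b *: crt a) = crt a *+ `|pr a b|%N.
  by rewrite mulrn_scale -scaleNr; congr (_ *: _); lia.
by split; apply: NcombD => //; apply: NcombMn;
  [exact: (@Ncomb_base _ K id)|exact: Ncomb_base].
Qed.

Lemma spanned_orth K a b : orth_cut K -> spanned K a -> spanned (fun x =>
  ~ K x) b ->
  pr a b = 0 /\ pr b a = 0.
Proof.
move=> orth [[e [Ke Ea]] [f [Kf Fa]]] [[e' [Ke' Eb]] [f' [Kf' Fb]]].
split.
  rewrite /cpair Fb pairing_sumr; apply: big1_seq => y /andP[_ yD].
  rewrite pairingMnr; have [->|/Kf' Ky] := eqVneq (f' y) 0%N;
    first by rewrite mul0r.
  rewrite {1}Ea pairing_suml big1_seq ?mulr0 // => x /andP[_ xD].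
  rewrite pairingMnl; have [->|/Ke Kx] := eqVneq (e x) 0%N;
    first by rewrite mul0r.
  by rewrite -/(pr x y) orth ?mulr0.
rewrite /cpair Fa pairing_sumr; apply: big1_seq => y /andP[_ yD].
rewrite pairingMnr; have [->|/Kf Ky] := eqVneq (f y) 0%N;
  first by rewrite mul0r.
rewrite {1}Eb pairing_suml big1_seq ?mulr0 // => x /andP[_ xD].
rewrite pairingMnl; have [->|/Ke' Kx] := eqVneq (e' x) 0%N;
  first by rewrite mul0r.
apply/eqP; rewrite -/(pr x y) mulf_eq0; apply/orP; right.
by rewrite pr_eq0 ?base_root // orth.
Qed.

Lemma orth_cutC K : orth_cut K -> orth_cut (fun x => ~ K x).
Proof.
move=> orth a b aD bD Ka /contrapT Kb; apply/eqP.
by rewrite pr_eq0 ?base_root // orth.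
Qed.

(** Build b by simple reflections that each move it. A simple root on the other side of the cut is
    orthogonal to the root reached so far, so it never occurs. *)
Lemma spanned_split K b : orth_cut K -> posr b ->
  spanned K b \/ spanned (fun x => ~ K x) b.
Proof.
move=> orth; move: b; apply: pos_root_ind => [a aD|a b aD [bP pb] ba].
  by have [Ka|Ka] := pselect (K a); [left|right]; exact: spanned_base.
move=> Kb; have [Ka|Ka] := pselect (K a).
  have spa := spanned_base aD Ka.
  case: Kb => Kb; [by left; exact: spanned_refl|].
  by have [_ E] := spanned_orth orth spa Kb; rewrite E in ba.
have spa : spanned (fun x => ~ K x) a by exact: spanned_base.
case: Kb => Kb; [|by right; exact: spanned_refl].
by have [E _] := spanned_orth orth Kb spa; rewrite E in ba.
Qed.

(** The root datum provides expansions of roots only; the trivial cut transfers them to coroots. *)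
Lemma spanned_coroot b : posr b -> Ncomb (fun=> True) crt (crt b).
Proof.
have orth : orth_cut (fun=> True) by [].
by case/(spanned_split orth) => -[_]; apply: Ncomb_mono.
Qed.

Lemma coroot_neq0 b : b \in Phi -> crt b != 0.
Proof.
by move=> /pr_self; apply: contra_eq_neq => E; rewrite /cpair E pairing0r.
Qed.

Lemma ht_pos b : posr b -> 0 < ht (crt b).
Proof.
move=> pb; have [h0 h] := ht_Ncomb (spanned_coroot pb).
rewrite lt_def h0 andbT; apply/eqP => /h /eqP.
by rewrite (negPf (coroot_neq0 (proj1 pb))).
Qed.

Lemma htN y : ht (- y) = - ht y. Proof. exact: pairingNr. Qed.

Lemma htP b : b \in Phi -> posr b <-> 0 < ht (crt b).
Proof.
move=> bP; split; first exact: ht_pos.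
by case: (pos_or bP) => // /ht_pos; rewrite coroot_opp // htN; lia.
Qed.

Lemma ht_neq0 b : b \in Phi -> ht (crt b) != 0.
Proof.
move=> bP; case: (pos_or bP) => /ht_pos; rewrite ?coroot_opp // ?htN; lia.
Qed.

Definition typed K b : Prop := spanned K b \/ spanned K (- b).

Lemma typed_split K b : orth_cut K -> b \in Phi ->
  typed K b \/ typed (fun x => ~ K x) b.
Proof.
move=> orth bP; case: (pos_or bP) => /(spanned_split orth)[] H.
- by left; left.
- by right; left.
- by left; right.
- by right; right.
Qed.

Lemma typed_orth K a b : orth_cut K -> a \in Phi -> b \in Phi ->
  typed K a -> typed (fun x => ~ K x) b -> pr a b = 0 /\ pr b a = 0.
Proof.
move=> orth aP bP [] Ka [] /(spanned_orth orth Ka) //;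
  rewrite ?prNl ?prNr ?prNl //;
  lia.
Qed.

Lemma typed_component K b c : orth_cut K -> b \in Phi -> same_component R b c ->
  typed K b -> typed K c.
Proof.
move=> orth bP bc Kb; elim: bc => // c' d _ Kc' c'P dP ne.
case: (typed_split orth dP) => // Kd.
by have [_ E] := typed_orth orth c'P dP Kc' Kd; case/eqP: ne; exact: E.
Qed.

Lemma component_trans b c d : same_component R b c -> same_component R c d ->
  same_component R b d.
Proof. by move=> bc; elim=> // c' d' _ bc' c'P d'P;
  exact: same_component_step. Qed.

Lemma component_sym b c : b \in Phi -> same_component R b c ->
  same_component R c b.
Proof.
move=> bP; elim=> [|c' d _ IH c'P dP ne]; first exact: same_component_refl.
apply: component_trans IH.
by apply: (same_component_step (same_component_refl R d) dP c'P);
  rewrite -[_ == 0]/(pr c' d == 0) pr_eq0.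
Qed.

Lemma base_obtuse a b : a \in Delta -> b \in Delta -> a <> b -> pr a b <= 0.
Proof.
move=> aD bD ab; have aP := base_root aD; have bP := base_root bD.
have [_ [e E]] := simple_refl_pos bD (base_pos aD) ab.
have H c : c \in Delta ->
  (e c)%:Z = (if c == a then 1 else 0) - (if c == b then pr a b else 0).
  apply: (@base_coef_uniq _ _ (fun c => (e c)%:Z)
    (fun c => (if c == a then 1 else 0) - (if c == b then pr a b else 0))).
  under [RHS]eq_bigr do rewrite scalerBl.
  rewrite sumrB !base_delta // scale1r -reflE E.
  by apply: eq_bigr => x _; rewrite mulrn_scale.
have := H b bD; rewrite eqxx; case: eqP => [ba|_]; first by case: ab.
lia.
Qed.

(** Dominance of the coroot of d, tested on the simple roots. *)
Definition fdominant d : Prop := forall a, a \in Delta -> 0 <= pr a d.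

Lemma fdominant_pos d : d \in Phi -> fdominant d -> posr d.
Proof.
move=> dP dom; have [//|[_ [e E]]] := pos_or dP.
have : pr (- d) d = - 2%:Z by rewrite prNl pr_self.
suff : 0 <= pr (- d) d by move=> + E'; rewrite E'.
rewrite /cpair E pairing_suml big_seq; apply: sumr_ge0 => a aD.
by rewrite pairingMnl; have := dom a aD; rewrite /cpair; nia.
Qed.

Lemma fdominant_pr_ge0 b d : posr b -> fdominant d -> 0 <= pr b d.
Proof.
move=> [bP [e E]] dom; rewrite /cpair E pairing_suml big_seq.
apply: sumr_ge0 => a aD.
by rewrite pairingMnl; have := dom a aD; rewrite /cpair; nia.
Qed.

(* Were b and d orthogonal, the support of b would split off as a component on
   which d vanishes. *)
Lemma fdominant_pr_gt0 b d : b \in Phi -> d \in Phi -> fdominant b ->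
  fdominant d ->
  same_component R b d -> 0 < pr b d.
Proof.
move=> bP dP db dd bd; have pb := fdominant_pos bP db.
rewrite lt_def fdominant_pr_ge0 // andbT; apply/eqP => bd0.
have [_ [e E]] := pb; pose K x := e x != 0%N.
have ebd a : a \in Delta -> K a -> pr a d = 0.
  move=> aD Ka; have /eqP := bd0; rewrite /cpair {1}E pairing_suml big_seq_cond.
  rewrite psumr_eq0 => [|x /andP[xD _]]; last first.
    by rewrite pairingMnl; have := dd x xD; rewrite /cpair; nia.
  move/allP/(_ a aD); rewrite aD /= pairingMnl -/(pr a d) mulf_eq0.
  by move: Ka; rewrite /K; case: (e a) => // m _ /orP[|/eqP].
(* A simple y outside the support of b pairs nonpositively with b, and nonnegatively as b is
   dominant; hence each term of the sum vanishes. *)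
have orth : orth_cut K.
  move=> x y xD yD Kx /negP; rewrite negbK => /eqP ey.
  have yb : pr b y <= 0.
    rewrite /cpair {1}E pairing_suml big_seq; apply: sumr_le0 => z zD.
    rewrite pairingMnl; have [zy|zy] := eqVneq z y;
      first by rewrite zy ey mul0r.
    by have := base_obtuse zD yD (elimN eqP zy); rewrite /cpair; nia.
  have yb0 : pr b y = 0.
    have := db y yD; rewrite le_eqVlt eq_sym (pr_eq0 (base_root yD) bP).
    by rewrite (pr_gt0 (base_root yD) bP) => /orP[/eqP //|]; lia.
  have /eqP := yb0; rewrite /cpair {1}E pairing_suml big_seq_cond.
  rewrite -oppr_eq0 -sumrN psumr_eq0 => [|z /andP[zD _]]; last first.
    rewrite pairingMnl; have [zy|zy] := eqVneq z y;
      first by rewrite zy ey mul0r oppr0.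
    by have := base_obtuse zD yD (elimN eqP zy); rewrite /cpair; nia.
  move/allP/(_ x xD); rewrite xD /= pairingMnl -/(pr x y) oppr_eq0 mulf_eq0.
  by move: Kx; rewrite /K; case: (e x) => // m _ /orP[|/eqP].
have Kb : typed K b.
  case: (typed_split orth bP) => // -[[[e' [Ke' Eb]] _]|[[e' [Ke' Eb]] _]];
    exfalso.
    have H a : a \in Delta -> (e a)%:Z = (e' a)%:Z.
      apply: (@base_coef_uniq _ _ (fun a => (e a)%:Z) (fun a => (e' a)%:Z)).
      under eq_bigr do rewrite -mulrn_scale.
      under [in RHS]eq_bigr do rewrite -mulrn_scale.
      by rewrite -E -Eb.
    have := root_neq0 bP; rewrite E big1_seq ?eqxx // => a /andP[_ aD].
    have := Ke' a; have := H a aD; rewrite /K; case: (e' a) => [|m] ea.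
      by have -> : e a = 0%N by lia.
    by move=> /(_ isT); case; lia.
  by apply: (pos_not pb); split; [exact: root_opp|exists e'].
have := pr_self dP.
case: (typed_component orth bP bd Kb) => -[[f [Kf Ed]] _].
  rewrite /cpair {1}Ed pairing_suml big1_seq // => a /andP[_ aD].
  rewrite pairingMnl -/(pr a d); have [->|/Kf Ka] := eqVneq (f a) 0%N;
    first by rewrite mul0r.
  by rewrite ebd // mulr0.
rewrite -[X in pr X _]opprK prNl {1}Ed /cpair pairing_suml big1_seq // =>
  a /andP[_ aD].
rewrite pairingMnl -/(pr a d); have [->|/Kf Ka] := eqVneq (f a) 0%N;
  first by rewrite mul0r.
by rewrite ebd // mulr0.
Qed.

(** If one of the two pairings is 1, a reflection shows that the difference is itself a coroot,
    positive by the comparison of heights. Otherwise Cauchy-Schwarz makes both pairings 2, so b - d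
    is isotropic and the coroots agree. *)
Lemma acute_coroot b d : b \in Phi -> d \in Phi -> 0 < pr d b ->
  ht (crt d) <= ht (crt b) ->
  Ncomb (fun=> True) crt (crt b - crt d).
Proof.
move=> bP dP db hbd; have bd : 0 < pr b d by rewrite pr_gt0.
have key e : e \in Phi -> crt e = crt b - crt d ->
  Ncomb (fun=> True) crt (crt b - crt d).
  move=> eP Ee; rewrite -Ee; apply: spanned_coroot; apply/htP => //.
  by rewrite lt_def ht_neq0 //= Ee /cht pairingBr subr_ge0.
have fb := form_gt0 bP; have fd := form_gt0 dP.
have E1 := form_pr b dP; have E2 := form_pr d bP; rewrite (formC _ b d) in E2.
have [p1|p1] := eqVneq (pr d b) 1.
  apply: (key (refl d *m b)); first exact: refl_root.
  by rewrite coroot_refl // p1 scale1r.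
have [q1|q1] := eqVneq (pr b d) 1.
  apply: (key (- (refl b *m d))); first by apply: root_opp; apply: refl_root.
  by rewrite coroot_opp ?refl_root // coroot_refl // q1 scale1r opprB.
have CS : form d b * form d b <= form b b * form d d.
  rewrite -subr_ge0 -(pmulr_rge0 _ fd).
  apply: le_trans (form_ge0 R (form d d *: b - form d b *: d)) _.
  rewrite formDl !formDr !(formNl, formNr, formZl, formZr) (formC _ b d).
  by rewrite le_eqVlt; apply/orP; left; apply/eqP; ring.
have pq : pr d b * pr b d <= 4%:Z.
  rewrite -(ler_pM2l (mulr_gt0 fb fd)).
  have -> : form b b * form d d * (pr d b * pr b d) = (form b b * pr d b) *
    (form d d * pr b d) by ring.
  by rewrite -E1 -E2; nia.
have p2 : pr d b = 2%:Z by nia.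
have q2 : pr b d = 2%:Z by nia.
have -> : crt b = crt d; last by rewrite subrr; exact: Ncomb0.
have f0 : form (d - b) (d - b) = 0.
  by rewrite formDl !formDr !(formNl, formNr) (formC _ b d); lia.
apply: coroot_form_inj => // [|mu]; first by lia.
by have := form_eq0 mu f0; rewrite formDl formNl; lia.
Qed.

(** Take b of greatest coroot height in the component. A simple root pairing negatively with a
    coroot gives a reflection raising the height, so b is dominant, and any other d climbs to a
    dominant root, where [fdominant_pr_gt0] and [acute_coroot] apply. *)
Lemma highest_exists c : c \in Phi -> exists2 b,
  highest_coroot R b & same_component R b c.
Proof.
move=> cP.
have [|b [bP cb maxb]] := @seq_argmax _ Phi (same_component R c) (fun b =>
  ht (crt b)).
  by exists c => //; exact: same_component_refl.
have step d a : d \in Phi -> same_component R c d -> a \in Delta ->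
  pr a d < 0 ->
    [/\ refl a *m d \in Phi, same_component R c (refl a *m d) &
        ht (crt d) < ht (crt (refl a *m d))].
  move=> dP cd aD ad; have aP := base_root aD; split; first exact: refl_root.
    apply: (same_component_step (c := a)) => //.
    - apply: (same_component_step (c := d)) => //.
      by rewrite -[_ == 0]/(pr a d == 0); lia.
    - exact: refl_root.
    - rewrite -[_ == 0]/(pr (refl a *m d) a == 0) pr_refl_self // oppr_eq0
      pr_eq0 //.
      lia.
  rewrite coroot_refl // /cht pairingBr pairingZr -/(pr rho2 a) rho2_simple //.
  lia.
have domb : fdominant b.
  move=> a aD; rewrite leNgt; apply/negP => ab.
  have [P1 P2] := step b a bP cb aD ab.
  by have := maxb _ P1 P2; rewrite leNgt => /negP.
exists b; last exact: component_sym.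
split=> // d dP bd.
suff : Ncomb (fun=> True) crt (crt b - crt d) by case=> e [_ E]; exists e.
have cd : same_component R c d by apply: component_trans bd.
have [k] := ubnP `|ht (crt b) - ht (crt d)|%N.
elim: k => // k IH in d dP cd {bd} *; move=> lek.
have hbd := maxb d dP cd.
have [domd|] := pselect (fdominant d).
  apply: acute_coroot => //.
  apply: fdominant_pr_gt0 => //; apply: component_trans cb.
  exact: component_sym.
move=> /existsNP[a /not_implyP[aD /negP]]; rewrite -ltNge => ad.
have aP := base_root aD.
have [P1 P2 P3] := step d a dP cd aD ad.
have -> : crt b - crt d = (crt b - crt (refl a *m d)) + crt a *+ `|pr a d|%N.
  rewrite coroot_refl // mulrn_scale opprB.
  have -> : `|pr a d|%N%:Z = - pr a d by lia.
  by rewrite scaleNr addrA addrAC addrK.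
apply: (@NcombD _ _ crt); last by apply: NcombMn; exact: Ncomb_base.
by apply: IH => //; have := maxb _ P1 P2; lia.
Qed.

End HighestCoroot.

(** * Affine roots and the length function *)
Section AffineRoots.
Variables (n : nat) (R : rootDatum n).
Notation X := 'cV[int]_n.
Notation Phi := (roots R).
Notation Delta := (base R).
Notation crt := (coroot R).
Notation rmx := (reflection_mx R).
Notation posr := (positive_root R).
Notation pr := (cpair R).
Notation form := (form R).
Notation rho2 := (rho2 R).
Notation ht := (cht R).
Implicit Types (a b c d : X) (mu nu q : X) (w : weyl R) (x y : extWeyl R).

Lemma weyl_ind (Q : 'M[int]_n -> Prop) : Q 1%:M ->
  (forall a M, a \in Phi -> Q M -> Q (rmx a *m M)) -> forall w, Q (weyl_mx w).
Proof. by move=> Q1 QM w; elim: (in_weylP w) => // a M aP _; exact: QM. Qed.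

Lemma weyl_root_pr w mu a : a \in Phi ->
  w *m a \in Phi /\ pr (w *m mu) (w *m a) = pr mu a.
Proof.
move=> aP; move: w.
apply: (weyl_ind (Q := fun M =>
  M *m a \in Phi /\ pr (M *m mu) (M *m a) = pr mu a)).
  by rewrite !mul1mx.
by move=> b M bP [MaP IH]; rewrite -!mulmxA refl_root // pr_refl.
Qed.

Lemma weyl_root w a : a \in Phi -> w *m a \in Phi.
Proof. by case/(weyl_root_pr w a). Qed.

Lemma weyl_pr w mu a : a \in Phi -> pr (w *m mu) (w *m a) = pr mu a.
Proof. by case/(weyl_root_pr w mu). Qed.

Lemma rmx_weyl w a : a \in Phi -> rmx (w *m a) *m w = w *m rmx a.
Proof.
move=> aP; suff : w *m a \in Phi /\ rmx (w *m a) *m w = w *m rmx a by case.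
move: w; apply: (weyl_ind (Q := fun M =>
  M *m a \in Phi /\ rmx (M *m a) *m M = M *m rmx a)).
  by rewrite !mul1mx mulmx1.
move=> b M bP [MaP IH]; rewrite -!mulmxA refl_root //.
by rewrite mulmxA refl_refl // -!mulmxA IH.
Qed.

Lemma weyl_mxM w w' : weyl_mx (w * w')%g = w *m w'. Proof. by []. Qed.
Lemma weyl_mx1 : weyl_mx (1%g : weyl R) = 1%:M. Proof. by []. Qed.

Definition sref a : weyl R := insubd (1%g : weyl R) (rmx a).

Lemma srefE a : a \in Phi -> weyl_mx (sref a) = rmx a.
Proof.
move=> aP; rewrite /sref -[LHS]/(val _) insubdK //; apply/asboolP.
by rewrite -[rmx a]mulmx1; apply: in_weylM => //; exact: in_weyl1.
Qed.

(* The affine root (a, k) is the function q |-> <q, a^vee> + k on X(T) (x) Q;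
   clearing denominators, points are scaled by level, which is chosen so large
   that the point rho2 lies in the fundamental alcove. *)
Definition aroot : Type := (X * int)%type.
Implicit Types h f e : aroot.

Definition level : int := 1 + \sum_(b <- undup Phi) `|ht (crt b)|.

Lemma level_gt b : b \in Phi -> `|ht (crt b)| < level.
Proof.
move=> bP; rewrite /level (bigD1_seq b) ?mem_undup ?undup_uniq //=.
by rewrite addrCA ltrDl ltr_pwDl // sumr_ge0.
Qed.

Definition aev h q : int := pr q h.1 + h.2 * level.
(** The second coordinate is forced by the invariance [aev_act] under the action [ptact] on scaled
    points. Likewise [arefl h] is the map q |-> q - h(q) a, with a the gradient root of h. *)
Definition aact x h : aroot := (x.2 *m h.1, h.2 - pr x.1 (x.2 *m h.1)).
Definition aopp h : aroot := (- h.1, - h.2).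
Definition arefl h : extWeyl R := (- h.2 *: h.1, sref h.1).
Definition ptact x q : X := x.2 *m q + level *: x.1.
Definition apos h : bool := 0 < aev h rho2.
Definition is_aroot h : Prop := h.1 \in Phi.
(** The root (-b, 1) is the one whose reflection is t_b s_b. *)
Definition asimple h : Prop :=
  (h.1 \in Delta /\ h.2 = 0) \/
  exists b, [/\ posr b, highest_coroot R b & h = (- b, 1)].

Lemma ptactM x y q : ptact (x * y)%g q = ptact x (ptact y q).
Proof.
rewrite /ptact /= mulmxDr mulmxA -addrA; congr (_ + _).
by rewrite -scalemxAr scalerDr addrC.
Qed.

Lemma ptact1 q : ptact 1%g q = q.
Proof. by rewrite /ptact /= mul1mx scaler0 addr0. Qed.

Lemma ptactVK x q : ptact x (ptact x^-1%g q) = q.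
Proof. by rewrite -ptactM mulgV ptact1. Qed.

Lemma aev_act x h q : is_aroot h -> aev (aact x h) (ptact x q) = aev h q.
Proof.
move=> hP; rewrite /aev /aact /ptact /= {1}/cpair pairingDl pairingZl -!/(pr _
  _).
by rewrite weyl_pr //; ring.
Qed.

Lemma aev_actV x h q : is_aroot h -> aev (aact x h) q = aev h (ptact x^-1%g q).
Proof. by move=> hP; rewrite -{1}[q](ptactVK x) aev_act. Qed.

Lemma aev_opp h q : is_aroot h -> aev (aopp h) q = - aev h q.
Proof. by move=> hP; rewrite /aev /= prNr //; ring. Qed.

Lemma ptact_arefl h q : is_aroot h -> ptact (arefl h) q = q - aev h q *: h.1.
Proof.
move=> hP; rewrite /ptact /= srefE // reflE /aev scalerA mulrN scaleNr mulrC.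
by rewrite -addrA -opprD -scalerDl.
Qed.

(** Since [level] exceeds all coroot heights in absolute value, the constant term decides the sign
    unless it is 0. *)
Lemma aposE h : is_aroot h ->
  apos h = (0 < h.2) || ((h.2 == 0) && (0 < ht (crt h.1))).
Proof.
move=> hP; have := level_gt hP; rewrite /apos /aev -[pr _ _]/(ht (crt h.1)).
move: (ht _) level h.2 => t N k tN; have N0 : 0 < N by lia.
have [k0|k0|->] := ltrgt0P k; rewrite ?orbT /=; last by rewrite mul0r addr0.
  have : N <= k * N by nia.
  by lia.
have : k * N <= - N by nia.
by lia.
Qed.

Lemma aev_rho2_neq0 h : is_aroot h -> aev h rho2 != 0.
Proof.
move=> hP; have := level_gt hP; have := ht_neq0 hP;
  rewrite /aev -[pr _ _]/(ht (crt h.1)).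
move: (ht _) level h.2 => t N k t0 tN; have N0 : 0 < N by lia.
have [k0|k0|->] := ltrgt0P k; last by rewrite mul0r addr0.
  have : N <= k * N by nia.
  by lia.
have : k * N <= - N by nia.
by lia.
Qed.

Lemma aactM x y h : is_aroot h -> aact (x * y)%g h = aact x (aact y h).
Proof.
move=> hP; rewrite /aact /= -mulmxA; congr (_, _).
rewrite {1}/cpair pairingDl -!/(pr _ _) (weyl_pr _ y.1) ?weyl_root //; ring.
Qed.

Lemma aact1 h : aact 1%g h = h.
Proof. by case: h => a k; rewrite /aact /= mul1mx /cpair pairing0l subr0. Qed.

Lemma aact_root x h : is_aroot h -> is_aroot (aact x h).
Proof. by move=> hP; exact: weyl_root. Qed.

Lemma aact_opp x h : is_aroot h -> aact x (aopp h) = aopp (aact x h).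
Proof.
move=> hP; rewrite /aact /aopp /= mulmxN prNr ?weyl_root //; congr (_, _); ring.
Qed.

Lemma rmx_opp a : a \in Phi -> rmx (- a) = rmx a.
Proof. by move=> aP; rewrite /reflection_mx coroot_opp // mulNmx mulmxN opprK.
  Qed.

Lemma sref_opp a : a \in Phi -> sref (- a) = sref a.
Proof. by move=> aP; apply: val_inj => /=;
  rewrite !srefE ?root_opp // rmx_opp. Qed.

Lemma arefl_opp h : is_aroot h -> arefl (aopp h) = arefl h.
Proof. by move=> hP; rewrite /arefl /= sref_opp // opprK scalerN scaleNr. Qed.

Lemma arefl_act x h : is_aroot h -> arefl (aact x h) = (x * arefl h * x^-1)%g.
Proof.
move=> hP; suff E : (arefl (aact x h) * x = x * arefl h)%g by rewrite -E mulgK.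
have waP := weyl_root x.2 hP; congr (_, _) => /=; last first.
  by apply: val_inj => /=; rewrite !srefE ?rmx_weyl.
rewrite srefE // reflE -scalemxAr opprB scalerBl scaleNr.
by rewrite [LHS]addrC addrA subrK.
Qed.

Lemma areflK h : is_aroot h -> (arefl h * arefl h = 1)%g.
Proof.
move=> hP; congr (_, _) => /=; last first.
  by apply: val_inj; rewrite /= srefE // reflection_mxK.
by rewrite srefE // -scalemxAr reflection_mx_self // scalerN subrr.
Qed.

Lemma aact_refl_self h : is_aroot h -> aact (arefl h) h = aopp h.
Proof.
move=> hP; rewrite /aact /aopp /= srefE // reflection_mx_self //; congr (_, _).
by rewrite prNr // {1}/cpair pairingZl -/(pr _ _) pr_self //; ring.
Qed.

Lemma asimple_root f : asimple f -> is_aroot f.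
Proof.
by case=> [[/base_root]|[b [[bP _] _ ->]]] //; exact: root_opp.
Qed.

Lemma asimple_pos f : asimple f -> apos f.
Proof.
move=> sf; rewrite aposE; last exact: asimple_root.
by case: sf => [[aD ->]|[b [_ _ ->]]] //=; rewrite (ht_pos (base_pos aD)).
Qed.

Lemma aopp_pos h : is_aroot h -> apos (aopp h) = ~~ apos h.
Proof.
by move=> hP; rewrite /apos aev_opp //; have := aev_rho2_neq0 hP; lia.
Qed.

Lemma highest_ge b d : highest_coroot R b -> d \in Phi ->
  same_component R b d ->
  Ncomb R (fun=> True) crt (crt b - crt d).
Proof. by move=> [_ H] dP bd; have [e E] := H d dP bd; exists e. Qed.

Lemma highest_pos b : highest_coroot R b -> posr b.
Proof.
move=> hb; have [bP _] := hb; have [//|pb] := pos_or bP.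
have := ht_pos pb; rewrite coroot_opp // htN.
have bNb : same_component R b (- b).
  apply: (same_component_step (same_component_refl R b)) => //;
    first exact: root_opp.
  by rewrite -[_ == 0]/(pr (- b) b == 0) prNl pr_self.
have [+ _] := ht_Ncomb (highest_ge hb (root_opp bP) bNb).
rewrite coroot_opp // opprK /cht pairingDr; lia.
Qed.

Lemma component_opp b d : d \in Phi -> same_component R b d ->
  same_component R b (- d).
Proof.
move=> dP bd; apply: (same_component_step bd) => //; first exact: root_opp.
by rewrite -[_ == 0]/(pr (- d) d == 0) prNl pr_self.
Qed.

(** For f = (-b, 1) the root (c, k) goes to (s_b c, k + m) with m = <b, c^vee>. As b^vee is highest,
    the coroots of c, of s_b c and of their negatives have height at most that of b^vee. Hence |m|
    <= 2, and comparing heights decides the sign in each case. *)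
Lemma arefl_pos f h : asimple f -> is_aroot h -> apos h -> h <> f ->
  apos (aact (arefl f) h).
Proof.
move=> sf hP; have fP := asimple_root sf.
rewrite !aposE //; last exact: aact_root.
rewrite /aact /= srefE //.
case: h hP => c k /= cP; case: sf => [[]|[b [pb hb ->{f fP}]]].
  case: f fP => a l /= aP aD l0; subst l;
    rewrite oppr0 scale0r /cpair pairing0l subr0.
  move=> + hf; case: ltrgt0P => //= k0 hc; rewrite ?orbF //.
  have pc : posr c by apply/htP.
  have ca : c <> a by move=> ca; apply: hf; rewrite ca k0.
  by rewrite ht_pos ?andbT //; apply: simple_refl_pos.
have [bP _] := pb.
rewrite rmx_opp // scalerN scaleNr scale1r opprK.
set l := k - _; have -> : l = k + pr b c.
  rewrite /l -{1}(reflKv b bP) pr_refl // reflection_mx_self // prNl; ring.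
move=> pk hf; have [c0|c0] := eqVneq (pr b c) 0.
  have -> : rmx b *m c = c.
    by rewrite reflE; have /eqP := c0; rewrite pr_eq0 // => /eqP ->;
      rewrite scale0r subr0.
  by rewrite c0 addr0.
have bc : same_component R b c.
  apply: (same_component_step (same_component_refl R b)) => //.
  by rewrite -[_ == 0]/(pr c b == 0) pr_eq0.
have eP : rmx b *m c \in Phi by exact: refl_root.
have be : same_component R b (rmx b *m c).
  apply: (same_component_step (same_component_refl R b)) => //.
  by rewrite -[_ == 0]/(pr (rmx b *m c) b == 0) pr_refl_self // oppr_eq0 pr_eq0.
have crte : crt (rmx b *m c) = crt c - pr b c *: crt b by rewrite coroot_refl.
have [h1 _] := ht_Ncomb (highest_ge hb cP bc).
have [h2 h2'] := ht_Ncomb (highest_ge hb (root_opp cP) (component_opp cP bc)).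
have [h3 _] := ht_Ncomb (highest_ge hb eP be).
have [h4 _] := ht_Ncomb (highest_ge hb (root_opp eP) (component_opp eP be)).
have e0 := ht_neq0 eP.
have c0' := ht_neq0 cP.
have b0 := ht_pos pb.
have hte : ht (crt (rmx b *m c)) = ht (crt c) - pr b c * ht (crt b).
  by rewrite crte /cht pairingBr pairingZr.
rewrite !coroot_opp // !opprK in h2 h2' h4.
rewrite /cht !(pairingBr, pairingDr) -!/(ht _) in h1 h2 h2' h3 h4.
rewrite hte in h3 h4 e0.
(* Equality of heights occurs only for c = -b; then k = 1 would make the root equal to f. *)
have cNb : ht (crt b) + ht (crt c) = 0 -> c = - b.
  move/h2' => E; apply: (coroot_inj cP (root_opp bP)).
  by rewrite coroot_opp //; apply/eqP; rewrite -addr_eq0 addrC E.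
have {}cNb : ht (crt b) + ht (crt c) = 0 -> k != 1.
  by move/cNb => cb; apply/eqP => k1; apply: hf; rewrite cb k1.
rewrite hte; move: pk cNb h1 h2 h3 h4 e0 c0' b0 c0; clear.
move: (ht (crt b)) (ht (crt c)) (pr b c) =>
  B C m pk cNb h1 h2 h3 h4 e0 c0' b0 c0.
have m2 : m <= 2.
  by rewrite leNgt; apply/negP => m3; have := ler_pM2r b0 3 m; lia.
have m2' : - 2 <= m.
  by rewrite leNgt; apply/negP => m3; have := ler_pM2r b0 m (- 3); lia.
have {m2 m2'} : m = 1 \/ m = - 1 \/ m = 2 \/ m = - 2 by lia.
by case=> [|[|[|]]] E; rewrite E in h3 h4 e0 *; lia.
Qed.

(** For k > 0 let b^vee be the highest coroot of the component of c: it dominates -c^vee, so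
    positivity of (-b, 1) at q implies that of (c, k). *)
Lemma alcove_pos q : (forall f, asimple f -> 0 < aev f q) ->
  forall h, is_aroot h -> apos h -> 0 < aev h q.
Proof.
move=> qs h hP; rewrite aposE //; case: h hP => c k /= cP.
have qa a : a \in Delta -> 0 < pr q a.
  by move=> aD; have := qs (a, 0) (or_introl (conj aD erefl));
    rewrite /aev mul0r addr0.
case/orP=> [k0|/andP[/eqP -> hc]]; last first.
  rewrite /aev /= mul0r addr0.
  have pc : posr c by apply/htP.
  have [h0 h1] := Ncomb_pairing qa (spanned_coroot pc).
  rewrite lt_def h0 andbT; apply/eqP => /h1 /eqP.
  by rewrite (negPf (coroot_neq0 cP)).
have [b hb bc] := highest_exists cP.
have sb : asimple (- b, 1) by right; exists b; split=> //; exact: highest_pos.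
have := qs _ sb; rewrite /aev /= prNr ?(proj1 hb) // mul1r.
have [+ _] := Ncomb_pairing qa (highest_ge hb (root_opp cP) (component_opp cP
  bc)).
rewrite coroot_opp // opprK pairingDr -!/(pr _ _).
have : 0 < level by have := level_gt cP; lia.
move: level => N N0; have : N <= k * N by nia.
by rewrite /=; lia.
Qed.

(** The hypothesis says that x^-1 moves the base point [rho2] to a point satisfying the inequalities
    of the alcove. *)
Lemma asimple_stab x : (forall f, asimple f -> apos (aact x f)) ->
  forall h, is_aroot h -> apos h -> apos (aact x h).
Proof.
move=> xs h hP ph; rewrite /apos aev_actV //; apply: alcove_pos => // f sf.
by rewrite -aev_actV; [exact: xs|exact: asimple_root].
Qed.

(* A simple affine reflection whose wall separates the points x rho2 and rho2
   decreases their squared distance. *)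
Definition adist x : nat :=
  `|form (ptact x rho2 - rho2) (ptact x rho2 - rho2)|%N.

Lemma form_subZ D a (F : int) : form (D - F *: a) (D - F *: a) =
  form D D - F * (2%:Z * form a D) + F * (F * form a a).
Proof.
rewrite formDl !formDr !(formNl, formNr) !(formZl, formZr) (formC _ D a); ring.
Qed.

Lemma adist_desc x f : asimple f -> ~~ apos (aact x^-1%g f) ->
  (adist (arefl f * x)%g < adist x)%N.
Proof.
move=> sf; have fP := asimple_root sf.
have x0 := aev_rho2_neq0 (aact_root x^-1%g fP).
rewrite /apos; rewrite aev_actV // invgK in x0 *.
rewrite /adist ptactM ptact_arefl //.
have pf : 0 < aev f rho2 by exact: asimple_pos.
set Q := ptact x rho2 in x0 *; move=> nQ.
have E := form_pr (Q - rho2) fP.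
have E' : pr (Q - rho2) f.1 = aev f Q - aev f rho2.
  by rewrite /cpair pairingBl /aev /cpair; ring.
have fa := form_gt0 fP.
have -> : Q - aev f Q *: f.1 - rho2 = (Q - rho2) - aev f Q *: f.1 by rewrite
  addrAC.
(* The squared distance changes by (a, a) f(Q) f(rho2), where a is the gradient of f; only the
   middle factor is negative. *)
have Dexp : form (Q - rho2 - aev f Q *: f.1) (Q - rho2 - aev f Q *: f.1) =
    form (Q - rho2) (Q - rho2) + form f.1 f.1 * aev f Q * aev f rho2.
  by rewrite form_subZ E E'; ring.
have g0 := form_ge0 R (Q - rho2 - aev f Q *: f.1).
have g1 := form_ge0 R (Q - rho2).
suff : form (Q - rho2 - aev f Q *: f.1) (Q - rho2 - aev f Q *: f.1) <
    form (Q - rho2) (Q - rho2) by lia.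
rewrite Dexp -ltrBrDl subrr pmulr_llt0 // pmulr_rlt0 //.
by lia.
Qed.

(** Transparent, so that [act], [refl] and [pos] at this instance reduce to the affine versions. *)
Definition affine_roots : posRoots (extWeyl R).
Proof.
refine (@PosRoots _ aroot aact aopp arefl apos is_aroot asimple _ _ _ _ _ _ _ _
  _ _ _ _ _ _ _ adist _).
- by move=> h _; exact: aact1.
- exact: aactM.
- exact: aact_root.
- by move=> h hP; exact: root_opp.
- exact: asimple_root.
- exact: asimple_pos.
- by move=> [a k] _; rewrite /aopp /= !opprK.
- exact: aopp_pos.
- exact: aact_opp.
- exact: arefl_opp.
- exact: arefl_act.
- exact: aact_refl_self.
- exact: areflK.
- exact: arefl_pos.
- exact: asimple_stab.
- exact: adist_desc.
Defined.

End AffineRoots.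

(** * W_af, Gamma and the length in terms of affine roots *)

Section AffineWeyl.
Variables (n : nat) (R : rootDatum n).
Notation X := 'cV[int]_n.
Notation Phi := (roots R).
Notation Delta := (base R).
Notation crt := (coroot R).
Notation rmx := (reflection_mx R).
Notation posr := (positive_root R).
Notation pr := (cpair R).
Notation rho2 := (rho2 R).
Notation ht := (cht R).
Notation AR := (affine_roots R).
Notation Saf := (affine_simple_refl (R := R)).
Implicit Types (a b c d : X) (q : X) (w : weyl R) (x y g : extWeyl R).
Implicit Types (h f e : aroot n).

Lemma weyl_mx_inj w w' : weyl_mx w = weyl_mx w' -> w = w'.
Proof. exact: val_inj. Qed.

Lemma translation_fin a w : (translation R a * fin w)%g = (a, w).
Proof. by congr (_, _); rewrite /= ?mulmx0 ?addr0 // mul1g. Qed.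

Lemma finM w w' : fin (w * w')%g = (fin w * fin w')%g.
Proof. by congr (_, _); rewrite /= mulmx0 addr0. Qed.

Lemma arefl_fin a : arefl R (a, 0) = fin (sref R a).
Proof. by rewrite /arefl /= oppr0 scale0r. Qed.

Lemma arefl_affine b : arefl R (- b, 1) = (b, sref R (- b)).
Proof. by rewrite /arefl /= scalerN scaleNr scale1r opprK. Qed.

Lemma affine_simple_reflE : Saf = simples AR.
Proof.
apply/predeqP => x; split.
  case=> [[s [a aD sa] ->]|[b [s [pb hb sb ->]]]].
    exists (a, 0); first by left.
    rewrite /= arefl_fin; congr (fin _); apply: weyl_mx_inj.
    by rewrite sa srefE ?base_root.
  exists (- b, 1); first by right; exists b.
  rewrite /= arefl_affine translation_fin; congr (_, _); apply: weyl_mx_inj.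
  by rewrite sb sref_opp ?(proj1 pb) // srefE ?(proj1 pb).
case=> [[a k]] /= [[/= aD ->]|[b [pb hb [-> ->]]]] <-.
  left; exists (sref R a); last exact: arefl_fin.
  by exists a => //; rewrite srefE ?base_root.
right; exists b, (sref R b); split=> //; first by rewrite srefE ?(proj1 pb).
by rewrite arefl_affine translation_fin sref_opp ?(proj1 pb).
Qed.

Lemma affine_weylE : affine_weyl (R := R) = generated (simples AR).
Proof.
have Sfin a : a \in Phi -> generated (simples AR) (fin (sref R a)).
  by move=> aP; rewrite -arefl_fin; apply: (@refl_gen _ AR (a, 0)).
apply/predeqP => x; split.
  elim=> [|y|y z _ Sy _ Sz|y _ Sy].
  - exact: generated1.
  - case=> [[w ->]|[a aP ->]].
      move: w; suff H M : in_weyl R M -> forall w,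
        weyl_mx w = M -> generated (simples AR) (fin w).
        by move=> w; apply: (H w); first exact: in_weylP.
      elim=> [|a {}M aP HM IH] w wM.
        have -> : w = 1%g by exact: weyl_mx_inj.
        exact: generated1.
      have aM : rmx a *m w = M by rewrite wM mulmxA reflection_mxK // mul1mx.
      have -> : w = (sref R a * (sref R a * w))%g.
        by apply: weyl_mx_inj;
          rewrite /= srefE // mulmxA reflection_mxK // mul1mx.
      rewrite finM; apply: generatedM; first exact: Sfin.
      by apply: IH; rewrite /= srefE.
    (* The reflections in (-a, 1) and in (a, 0) have parallel walls, and their product is t_a. *)
    have -> : translation R a = (arefl R (- a, 1)%R * fin (sref R a))%g.
      rewrite arefl_affine sref_opp // -translation_fin -mulgA -finM.
      have -> : (sref R a * sref R a = 1)%g.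
        by apply: weyl_mx_inj; rewrite /= srefE // reflection_mxK.
      by congr (_, _); rewrite /= ?mul1mx ?addr0 // mul1g.
    apply: generatedM; last exact: Sfin.
    by apply: (@refl_gen _ AR (- a, 1)); exact: root_opp.
  - exact: generatedM.
  - exact: generatedV.
elim=> [|y|y z _ Sy _ Sz|y _ Sy].
- exact: generated1.
- rewrite -affine_simple_reflE => -[[s _ ->]|[b [s [[bP _] _ _ ->]]]].
    by apply: generated_in; left; exists s.
  apply: generatedM; apply: generated_in; first by right; exists b.
  by left; exists s.
- exact: generatedM.
- exact: generatedV.
Qed.

(* Evaluate h at the sum of rho2 and its mirror images in the walls of f and f'. *)
Lemma no_mixed_root f f' h (c : int) : asimple R f -> asimple R f' -> f <> f' ->
  is_aroot R h -> 0 < c -> (forall q,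
    aev R h q = aev R f' q - c * aev R f q) -> False.
Proof.
move=> sf sf' ff' hP c0 E.
have fP := asimple_root sf; have fP' := asimple_root sf'.
have pf := asimple_pos sf; have pf' := asimple_pos sf'.
have mir e e' : asimple R e -> is_aroot R e' ->
    aev R e' (ptact (arefl R e) rho2) = aev R (aact (arefl R e) e') rho2.
  move=> se eP'; rewrite aev_actV //; congr (aev R e' (ptact _ rho2)).
  have eP := asimple_root se.
  by apply/esym/mulg1_eq; exact: areflK.
have mirs e : asimple R e -> aev R e (ptact (arefl R e) rho2) = - aev R e rho2.
  move=> se; have eP := asimple_root se.
  by rewrite mir // aact_refl_self // aev_opp.
have mirp e e' : asimple R e -> is_aroot R e' -> apos R e' -> e' <> e ->
    0 < aev R e' (ptact (arefl R e) rho2).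
  by move=> se eP' pe' ne; rewrite mir //; exact: arefl_pos.
have ppf : 0 < aev R f rho2 := pf.
have ppf' : 0 < aev R f' rho2 := pf'.
have h1 : 0 < aev R h rho2 + aev R h (ptact (arefl R f) rho2).
  rewrite !E mirs //; have := mirp f f' sf fP' pf' (nesym ff'); lia.
have h2 : aev R h rho2 + aev R h (ptact (arefl R f') rho2) < 0.
  rewrite !E mirs //; have := mirp f' f sf' fP pf ff'; nia.
have hP' := opp_root (p := AR) hP.
have [ph|nh] := boolP (apos R h).
  have pph : 0 < aev R h rho2 := ph.
  have [hf'|hf'] := pselect (h = f'); first by move: h2; rewrite hf' mirs //;
    lia.
  by have := mirp f' h sf' hP ph hf'; lia.
have ph : apos R (aopp h) by rewrite aopp_pos.
have pph : 0 < aev R (aopp h) rho2 := ph.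
have [hf|hf] := pselect (aopp h = f).
  by move: h1; have := mirs f sf; rewrite -hf !aev_opp //; lia.
by have := mirp f (aopp h) sf hP' ph hf; move: pph; rewrite !aev_opp //; lia.
Qed.

Section GammaPos.
Variable g : extWeyl R.
Hypothesis Gg : Gamma g.

(** Conjugation by g permutes S_af, and a reflection determines its root up to sign. *)
Lemma Gamma_simple f : asimple R f ->
  asimple R (aact g f) \/ asimple R (aopp (aact g f)).
Proof.
move=> sf; have fP := asimple_root sf; set e := aact g f.
have eP : is_aroot R e by exact: aact_root.
have [f' sf' E] : simples AR (arefl R e).
  rewrite -affine_simple_reflE -Gg affine_simple_reflE; exists (arefl R f).
    by exists f.
  by rewrite arefl_act.
have H e' : is_aroot R e' -> apos R e' -> arefl R e' = arefl R e -> e' = f'.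
  move=> eP' pe' E'; apply: contrapT => ne.
  have := arefl_pos sf' eP' pe' ne; rewrite [arefl R f']E -E' aact_refl_self //.
  by rewrite aopp_pos // pe'.
have [pe|ne] := boolP (apos R e); first by left; rewrite (H e).
right; rewrite (H (aopp e)) //; first exact: (opp_root (p := AR) eP).
  by rewrite aopp_pos.
exact: arefl_opp.
Qed.

(** Let d = <f, f'^vee>, with f made negative and f' kept positive by g. The root s_f f' = f' - d f
    is excluded by [no_mixed_root] if d > 0; if d < 0, its image under g is g f' - (-d)(-g f),
    excluded in the same way. *)
Lemma Gamma_orth f f' : asimple R f -> asimple R f' ->
  ~~ apos R (aact g f) -> apos R (aact g f') -> pr f.1 f'.1 = 0.
Proof.
move=> sf sf' nf pf'.
have fP := asimple_root sf; have fP' := asimple_root sf'.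
have ff' : f <> f' by move=> ff'; rewrite ff' pf' in nf.
have hP : is_aroot R (aact (arefl R f) f') by exact: aact_root.
have E q : aev R (aact (arefl R f) f') q = aev R f' q - pr f.1 f'.1 * aev R f q.
  rewrite aev_actV // -(mulg1_eq (areflK fP)) invgK ptact_arefl //.
  by rewrite [LHS]/aev /cpair pairingBl pairingZl -!/(pr _ _) /aev; ring.
have [d0|d0|//] := ltrgt0P (pr f.1 f'.1); exfalso.
  exact: (no_mixed_root sf sf' ff' hP d0 E).
have eP := aact_root g fP; have eP' := aact_root g fP'.
have sf2 : asimple R (aopp (aact g f)).
  by case: (Gamma_simple sf) => // /asimple_pos; rewrite (negPf nf).
have sf2' : asimple R (aact g f').
  by case: (Gamma_simple sf') => // /asimple_pos; rewrite aopp_pos // pf'.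
have ne : aopp (aact g f) <> aact g f'.
  move=> E2; have /asimple_pos : asimple R (aopp f); last first.
    by rewrite aopp_pos // (asimple_pos sf).
  rewrite -[aopp f](actVK (P := AR) g) /=; last exact: (opp_root (p := AR) fP).
  by rewrite aact_opp // E2 -aactM // mulVg aact1.
have d0' : 0 < - pr f.1 f'.1 by rewrite oppr_gt0.
apply: (no_mixed_root sf2 sf2' ne (aact_root g hP) d0') => q.
by rewrite aev_actV // E aev_opp // !aev_actV //; ring.
Qed.

Definition kept a : Prop := a \in Delta /\ apos R (aact g (a, 0)).

Lemma asimple_base a : a \in Delta -> asimple R (a, 0).
Proof. by move=> aD; left. Qed.

Lemma kept_cut : orth_cut R kept.
Proof.
move=> a b aD bD [_ pa] nb; apply/eqP; rewrite pr_eq0 ?base_root //; apply/eqP.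
apply: (Gamma_orth (asimple_base bD) (asimple_base aD)) => //.
by apply/negP => pb; apply: nb.
Qed.

Lemma spanned_nonorth (K : X -> Prop) b d : d \in Phi ->
  spanned R K b \/ spanned R K (- b) ->
  (forall a, a \in Delta -> K a -> pr a d = 0) -> pr b d = 0.
Proof.
move=> dP Kb H; have H' c : spanned R K c -> pr c d = 0.
  move=> [[e [Ke ->]] _]; rewrite /cpair pairing_suml;
    apply: big1_seq => a /andP[_ aD].
  rewrite pairingMnl; have [->|/Ke Ka] := eqVneq (e a) 0%N;
    first by rewrite mul0r.
  by rewrite -/(pr a d) H ?mulr0.
by case: Kb => /H' //; rewrite prNl; lia.
Qed.

(** Otherwise (-b, 1) would be orthogonal to all simple roots kept positive; up to sign b is a
    combination of these, so <b, b^vee> would be 0. *)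
Lemma affine_kept b : highest_coroot R b -> typed R kept b ->
  apos R (aact g (- b, 1)).
Proof.
move=> hb Kb; have [bP _] := hb; apply: contraT => nb.
have sb : asimple R (- b, 1) by right; exists b; split=> //; exact: highest_pos.
have /eqP := pr_self bP; rewrite (spanned_nonorth bP Kb) // => a aD [_ pa].
have := Gamma_orth sb (asimple_base aD) nb pa; rewrite /= prNl => /eqP.
by rewrite oppr_eq0 (pr_eq0 bP (base_root aD)) => /eqP.
Qed.

Lemma affine_not_kept b : highest_coroot R b -> typed R (fun a => ~ kept a) b ->
  ~~ apos R (aact g (- b, 1)).
Proof.
move=> hb Kb; have [bP _] := hb; apply/negP => pb.
have sb : asimple R (- b, 1) by right; exists b; split=> //; exact: highest_pos.
have /eqP := pr_self bP; rewrite (spanned_nonorth bP Kb) // => a aD nka.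
have na : ~~ apos R (aact g (a, 0)) by apply/negP => pa; apply: nka.
have := Gamma_orth (asimple_base aD) sb na pb; rewrite /= prNr // => /eqP.
by rewrite oppr_eq0 => /eqP.
Qed.

(* The simple affine roots sent by g to negative ones form a union of
   components; were one of these not empty, g would send the constant function
   b^vee + (1 - b^vee) to a negative function. *)
Lemma Gamma_domp : domp AR g.
Proof.
apply: (simple_stab (p := AR)) => f sf; apply: contraT => nf.
suff [b hb Kb] : exists2 b, highest_coroot R b & typed R (fun a => ~ kept a) b.
  have [bP _] := hb; have pb := highest_pos hb.
  have sbP : is_aroot R (- b, 1) by exact: root_opp.
  have := affine_not_kept hb Kb; rewrite /apos aev_actV // -leNgt.
  set q := ptact _ _; rewrite /aev /= prNr // mul1r => lt.
  have le a : a \in Delta -> ~ kept a -> pr q a <= 0.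
    move=> aD nka; have : ~~ apos R (aact g (a, 0)) by apply/negP => pa;
      apply: nka.
    rewrite /apos aev_actV; last exact: base_root.
    by rewrite -leNgt /aev /= mul0r addr0.
  have : pr q b <= 0.
    case: Kb => [[_ [e [Ke E]]]|[[e [_ E]] _]]; last first.
      by case: (pos_not pb); split; [exact: root_opp|exists e].
    rewrite /cpair E pairing_sumr big_seq; apply: sumr_le0 => a aD.
    rewrite pairingMnr; have [->|/Ke Ka] := eqVneq (e a) 0%N;
      first by rewrite mul0r.
    by have := le a aD Ka; rewrite /cpair; nia.
  by have := level_gt bP; lia.
case: sf nf => [[aD f2]|[b [pb hb E]]] nf.
  have aP := base_root aD; have [b hb ba] := highest_exists aP.
  exists b => //; have [bP _] := hb.
  apply: (typed_component (orth_cutC kept_cut) aP (component_sym bP ba)).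
  left; apply: spanned_base => // -[_]; move: nf;
    rewrite /= -f2 => /negP nf pf; apply: nf.
  by case: (f) pf.
exists b => //; have [bP _] := hb; case: (typed_split kept_cut bP) => // Kb.
by move: nf; rewrite /= E (affine_kept hb Kb).
Qed.

End GammaPos.

Lemma GammaE g : Gamma g <-> domp AR g.
Proof.
split; first exact: Gamma_domp.
move=> dg; rewrite /Gamma /= affine_simple_reflE; apply/predeqP => x; split.
  case=> _ [f sf <-] <-; exists (act (p := AR) g f); first exact: domp_simple.
  by rewrite refl_act //; exact: simple_root.
case=> f sf <-; have sf' := domp_simple (dompV dg) sf.
exists (refl (p := AR) (act (p := AR) g^-1%g f));
  first by exists (act (p := AR) g^-1%g f).
rewrite refl_act; last exact: (simple_root (p := AR)).
by rewrite invgK !mulgA mulgV mul1g mulgK.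
Qed.

Lemma coxeter_lengthE y : generated (simples AR) y ->
  coxeter_length (simples AR) y = len AR y.
Proof.
move=> Sy; rewrite /coxeter_length.
have [s [Ss Es sz]] := gen_reduced (@subset_refl _ _) Sy.
apply: xget_unique.
  split; first by exists s; split.
  move=> j [s' [<- Ss' ->]]; exact: len_word.
move=> j [[s' [<- Ss' Es']] /(_ (len AR y))].
move=> H; apply/eqP; rewrite eqn_leq H; last by exists s; split.
by rewrite Es'; exact: len_word.
Qed.

(** Every decomposition y g yields the value [len], so the choice made by [xget] is harmless. *)
Lemma ellE x : ell x = len AR x.
Proof.
have key y g : affine_weyl y -> Gamma g ->
  len AR (y * g)%g = coxeter_length Saf y.
  rewrite affine_weylE affine_simple_reflE => Sy /GammaE dg.
  by rewrite coxeter_lengthE // len_mul_domp.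
rewrite /ell; apply: xget_unique.
  have [s [g [Ss dg E sz]]] := lenP AR x.
  have Ws : affine_weyl (gprod s) by rewrite affine_weylE; exact: gen_word.
  have Gg : Gamma g by exact/GammaE.
  exists (gprod s), g; split=> //; rewrite {1}E; exact: key.
by move=> k [y [g [Wy Gg -> ->]]]; rewrite key.
Qed.

Lemma bruhat_lt_ell x x' : bruhat_lt x x' -> (ell x < ell x')%N.
Proof.
have key y y' : bruhat Saf y y' ->
  y = y' \/ (coxeter_length Saf y < coxeter_length Saf y')%N.
  elim=> [z|z z' t _ IH _ lt]; first by left.
  by right; case: IH => [->|/ltn_trans]; [|apply].
case=> -[y [y' [g [Wy Wy' Gg [-> ->] yy']]]] ne; rewrite !ellE.
move: Wy Wy' Gg yy' key; rewrite affine_weylE affine_simple_reflE.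
move=> Wy Wy' /GammaE Gg yy' key; rewrite !len_mul_domp // -!coxeter_lengthE //.
by case: (key _ _ yy') => // E; case: ne; rewrite E.
Qed.

End AffineWeyl.

(** * Minimal double coset representatives *)
Section Index.
Variables (n : nat) (R : rootDatum n).
Notation X := 'cV[int]_n.
Notation Phi := (roots R).
Notation Delta := (base R).
Notation rmx := (reflection_mx R).
Notation pr := (cpair R).
Notation form := (form R).
Notation rho2 := (rho2 R).
Notation AR := (affine_roots R).
Implicit Types (a b c : weyl R) (x y : extWeyl R) (lam mu : X).
Implicit Types (I J K : set (weyl R)).

Definition fins I : set (extWeyl R) := [set fin a | a in I].

Lemma fin_inj : injective (fin (R := R)).
Proof. by move=> a b []. Qed.

Lemma fin1 : fin (1%g : weyl R) = 1%g.
Proof. by []. Qed.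

Lemma finV a : fin (a^-1)%g = ((fin a)^-1)%g.
Proof. by apply/esym/mulg1_eq; rewrite -finM mulgV. Qed.

Lemma fin_simples I : I `<=` simple_refl R -> fins I `<=` simples AR.
Proof.
move=> hI _ [s /hI Ss <-]; rewrite -affine_simple_reflE; left; by exists s.
Qed.

Lemma gen_fin I a : generated I a -> generated (fins I) (fin a).
Proof.
elim=> [|b Ib|b c _ Ib _ Ic|b _ Ib].
- by rewrite fin1; exact: generated1.
- by apply: generated_in; exists b.
- by rewrite finM; exact: generatedM.
- by rewrite finV; exact: generatedV.
Qed.

Lemma fin_gen I x : generated (fins I) x -> exists2 a,
  generated I a & x = fin a.
Proof.
elim=> [|y [a Ia <-]|y z _ [a Ia ->] _ [b Ib ->]|y _ [a Ia ->]].
- by exists 1%g; [exact: generated1|rewrite fin1].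
- by exists a => //; exact: generated_in.
- by exists (a * b)%g; [exact: generatedM|rewrite finM].
- by exists (a^-1)%g; [exact: generatedV|rewrite finV].
Qed.

Lemma fin_genE I a : generated (fins I) (fin a) -> generated I a.
Proof. by case/fin_gen=> b Ib /fin_inj ->. Qed.

Lemma apos_fin a (al : X) : al \in Phi ->
  apos R (aact (fin a) (al, 0)) = apos R (a *m al, 0).
Proof. by rewrite /aact /= /cpair pairing0l subr0. Qed.

(** The element b a^-1 preserves the positive affine roots and lies in W_af, so it has length 0
    there. As there are finitely many sign patterns, W is finite. *)
Lemma weyl_sign_inj a b :
  {in Phi, forall al, apos R (a *m al, 0) = apos R (b *m al, 0)} -> a = b.
Proof.
move=> H; suff E : fin (b * a^-1)%g = fin 1%g.
  by have /fin_inj/divg1_eq := E.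
have gs : generated (simples AR) (fin (b * a^-1)%g).
  by rewrite -affine_weylE; apply: generated_in; left; exists (b * a^-1)%g.
rewrite fin1; apply: (gen_len0 (@subset_refl _ _) gs);
  apply: len_domp => -[c k] cP pc.
rewrite /= aposE; last exact: aact_root.
move: pc; rewrite -[pos _]/(apos R _) aposE //= /cpair pairing0l subr0.
case/orP=> [->//|/andP[k0 hc]]; apply/orP; right; rewrite k0 /=.
have cP' : (a^-1)%g *m c \in Phi by exact: weyl_root.
have := H _ cP'; rewrite -[a *m _]/(weyl_mx a *m _) mulmxA -weyl_mxM mulgV
  weyl_mx1 mul1mx.
rewrite aposE //= hc aposE /=; last exact: weyl_root.
by rewrite mulmxA.
Qed.

Lemma finite_weyl : finite_set [set: weyl R].
Proof.
pose f (a : weyl R) := [ffun i : 'I_(size Phi) => apos R (a *m nth 0 Phi i, 0)].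
have -> : [set: weyl R] = f @^-1` [set: {ffun 'I_(size Phi) -> bool}] by [].
apply: finite_preimage; last exact: finite_finset.
move=> a b _ _ /ffunP E; apply: weyl_sign_inj => al /(nthP 0)[i isz <-].
by have := E (Ordinal isz); rewrite !ffunE.
Qed.

Lemma finite_gen I : finite_set (generated I).
Proof. exact: sub_finite_set finite_weyl. Qed.

(** * Dominant representatives of the orbits of a parabolic subgroup *)

Section DominantOrbits.
Variable K : set (weyl R).
Hypothesis KS : K `<=` simple_refl R.

Definition Kdominant lam : Prop :=
  forall al s, al \in Delta -> weyl_mx s = rmx al -> K s -> 0 <= pr lam al.

Definition Kspan (y : X) : Prop := exists d : X -> int,
  (forall al, d al != 0 -> exists2 s, K s & weyl_mx s = rmx al) /\
  y = \sum_(al <- Delta) d al *: al.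

Lemma Kspan_gen a (y : X) : generated K a -> Kspan y -> Kspan (a *m y).
Proof.
move=> /genP[s /KS[al aD sE]|w Kw ->{a}].
  by apply: weyl_mx_inj; rewrite /= sE reflection_mxK ?base_root.
elim: w Kw y => [|s w IH] /= Kw y Ky; first by rewrite mul1mx.
have [Ks {}Kw] := word_in_consP Kw; have [al aD sE] := KS Ks.
have [d [Kd E]] := IH Kw y Ky.
rewrite sE -mulmxA E reflE -E; set m := pr _ _.
exists (fun be => d be - (if be == al then m else 0)); split.
  move=> be; have [->|_] := eqVneq be al; first by exists s.
  by rewrite subr0; exact: Kd.
under eq_bigr do rewrite scalerBl.
by rewrite sumrB base_delta // -E.
Qed.

Lemma Kdominant_uniq a lam : Kdominant lam -> Kdominant (a *m lam) ->
  generated K a -> a *m lam = lam.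
Proof.
have [k] := ubnP (len AR (fin a)); elim: k => // k IH in a * => lek dl dal Ka.
have [->|/eqP a1] := eqVneq a 1%g; first by rewrite mul1mx.
have [|_ [s Ks <-] E] := gen_descr (fin_simples KS) (gen_fin Ka).
  by rewrite -fin1 => /fin_inj.
have [al aD sE] := KS Ks; have alP := base_root aD.
have Es : fin s = refl (p := AR) (al, 0).
  by rewrite /= arefl_fin; congr fin; apply: weyl_mx_inj; rewrite sE srefE.
have neg : ~~ apos R (a *m al, 0).
  have := @len_mulr_pos _ AR (fin a) (al, 0) (or_introl (conj aD erefl)).
  rewrite -Es E ltnNge leqnSn /= => /esym.
  by rewrite apos_fin // => ->.
have aalP : a *m al \in Phi by exact: weyl_root.
have [f Ef] : exists f : X -> nat, - (a *m al) = \sum_(be <- Delta) be *+ f be.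
  case: (pos_or aalP) => [pal|[_ [f Ef]]]; last by exists f.
  by move: neg; rewrite aposE //= (ht_pos pal).
have [|d [Kd Ed]] := @Kspan_gen a al Ka.
  exists (fun be => if be == al then 1 else 0); split.
    by move=> be; have [->|] := eqVneq be al; [exists s|].
  by rewrite base_delta // scale1r.
have fd be : be \in Delta -> (f be)%:Z = - d be.
  apply: (@base_coef_uniq _ R (fun be => (f be)%:Z) (fun be => - d be)).
  under eq_bigr do rewrite -mulrn_scale.
  under [in RHS]eq_bigr do rewrite scaleNr.
  by rewrite sumrN -Ef -Ed.
have fge : 0 <= form (- (a *m al)) (a *m lam).
  rewrite Ef form_suml big_seq; apply: sumr_ge0 => be bD.
  rewrite mulrn_scale formZl; have [->|nz] := eqVneq (f be) 0%N.
    by rewrite mul0r.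
  have [s' Ks' sE'] : exists2 s, K s & weyl_mx s = rmx be.
    by apply: Kd; have := fd be bD; move: nz; lia.
  have := dal be s' bD sE' Ks'; have := form_pr (a *m lam) (base_root bD).
  have := form_gt0 (base_root bD).
  by move: (f be) nz => m nz; nia.
have lal := dl al s aD sE Ks.
have := form_pr (a *m lam) aalP; rewrite weyl_pr // => E2.
have f0 := form_gt0 aalP.
have al0 : pr lam al = 0 by rewrite formNl in fge; nia.
have slam : weyl_mx s *m lam = lam by rewrite sE reflE al0 scale0r subr0.
have alam : (a * s)%g *m lam = a *m lam by rewrite /= -mulmxA slam.
rewrite -alam; apply: IH => //; rewrite ?alam //; last first.
  by apply: generatedM => //; exact: generated_in.
by rewrite finM -ltnS -E.
Qed.

(** In the finite orbit choose a point with greatest product with 2 rho: reflecting in a simple root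
    of negative pairing would increase it. *)
Lemma Kdominant_exists lam : exists2 a, generated K a & Kdominant (a *m lam).
Proof.
have /finite_seqP[s sE] := @finite_gen K.
have memP a : generated K a <-> a \in s by rewrite sE.
have [|a [/memP Ka _ maxa]] :=
    @seq_argmax _ s (fun=> True) (fun a => form (a *m lam) rho2).
  by exists 1%g => //; apply/memP; exact: generated1.
exists a => // al t aD tE Kt; have aP := base_root aD.
rewrite leNgt; apply/negP => neg.
have Kta : generated K (t * a)%g by apply: generatedM => //;
  exact: generated_in.
have := maxa (t * a)%g (proj1 (memP _) Kta) I.
rewrite /= tE -mulmxA reflE formDl formNl formZl.
have := form_pr rho2 aP; rewrite rho2_simple //; have := form_gt0 aP.
rewrite leNgt => fa E /negP; apply.
by rewrite ltrDl oppr_gt0 pmulr_llt0 //; lia.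
Qed.

End DominantOrbits.

(** * The double cosets indexed by the pairs (lambda, z) *)

Section DoubleCosets.
Variables I J : set (weyl R).
Hypotheses (hI : I `<=` simple_refl R) (hJ : J `<=` simple_refl R).

Lemma translationJ a mu : translation R (a *m mu) = (fin a * translation R mu *
  fin (a^-1)%g)%g.
Proof.
congr (_, _); rewrite /= ?mulmx0 ?addr0 ?add0r //.
by rewrite mulg1 mulgV.
Qed.

Lemma min_eltP lam z : double_coset I J lam z (min_elt I J lam z) /\
  forall y, double_coset I J lam z y -> (ell (min_elt I J lam z) <= ell y)%N.
Proof.
apply: (@xgetPex _ 1%g [set m | double_coset I J lam z m /\
  forall y, double_coset I J lam z y -> (ell m <= ell y)%N]).
pose Q k := `[< exists2 y, double_coset I J lam z y & ell y = k >].
have exQ : exists k, Q k.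
  exists (ell (translation R lam * fin z)%g); apply/asboolP.
  exists (translation R lam * fin z)%g => //; exists 1%g, 1%g.
  by split; [exact: generated1|exact: generated1|rewrite !fin1 mul1g mulg1].
case: (ex_minnP exQ) => k /asboolP[m dm <-] H; exists m; split=> // y dy.
by apply: H; apply/asboolP; exists y.
Qed.

Lemma double_cosetM lam z a b y : generated I a -> generated J b ->
  double_coset I J lam z y -> double_coset I J lam z (fin a * y * fin b)%g.
Proof.
move=> Ia Jb [a' [b' [Ia' Jb' ->]]]; exists (a * a')%g, (b' * b)%g.
by split; [exact: generatedM|exact: generatedM|rewrite !finM !gmulA].
Qed.

Lemma double_coset_conn lam z x y : double_coset I J lam z x ->
  double_coset I J lam z y -> exists a b : extWeyl R, [/\ generated (fins I) a,
    generated (fins J) b & (a * y = x * b)%g].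
Proof.
move=> [a [b [Ia Jb ->]]] [a' [b' [Ia' Jb' ->]]].
exists (fin a * (fin a')^-1)%g, ((fin b)^-1 * fin b')%g; split.
- by apply: generatedM; [|apply: generatedV]; exact: gen_fin.
- by apply: generatedM; [apply: generatedV|]; exact: gen_fin.
- by rewrite !gmulA mulgVK mulgK.
Qed.

Notation red := (reduced AR (fins I) (fins J)).

Lemma reduced_min x : (forall a b, generated I a -> generated J b ->
  (ell x <= ell (fin a * x * fin b)%g)%N) -> red x.
Proof.
move=> minx; split=> [_ [s Is <-]|_ [s Js <-]].
  have := minx s 1%g (generated_in Is) (generated1 _); rewrite fin1 mulg1 !ellE.
  have [|->//|->] := @len_mull _ AR x (fin s); last by rewrite ltnn.
  by apply: (fin_simples hI); exists s.
have := minx 1%g s (generated1 _) (generated_in Js); rewrite fin1 mul1g !ellE.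
have [|->//|->] := @len_mulr _ AR x (fin s); last by rewrite ltnn.
by apply: (fin_simples hJ); exists s.
Qed.

Lemma min_elt_reduced lam z : red (min_elt I J lam z).
Proof.
have [dm minm] := min_eltP lam z.
by apply: reduced_min => a b Ia Jb; apply: minm; exact: double_cosetM.
Qed.

Lemma double_coset_reduced lam z x : double_coset I J lam z x -> red x ->
  x = min_elt I J lam z.
Proof.
move=> dx rx; have [dm _] := min_eltP lam z.
have [a [b [Ia Jb E]]] := double_coset_conn dm dx.
exact: (reduced_uniq (fin_simples hI) (fin_simples hJ) (min_elt_reduced lam z)
  rx Ia Jb E).
Qed.

Lemma min_coset_rep_reduced z : min_coset_rep I J z -> red (fin z).
Proof. by move=> minz; apply: reduced_min => a b Ia Jb; rewrite -!finM;
  exact: minz. Qed.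

Definition meet_conj z : set (weyl R) := I `&` [set s | J (z^-1 * s * z)%g].

Lemma meet_conj_simple z : meet_conj z `<=` simple_refl R.
Proof. by move=> s [/hI]. Qed.

Lemma meet_conj_gen z a : generated (meet_conj z) a ->
  generated I a /\ generated J (z^-1 * a * z)%g.
Proof.
elim=> [|b [Ib Jb]|b c _ [Ib Jb] _ [Ic Jc]|b _ [Ib Jb]].
- by rewrite mulg1 mulVg; split; exact: generated1.
- by split; exact: generated_in.
- split; first exact: generatedM.
  have -> : (z^-1 * (b * c) * z = (z^-1 * b * z) * (z^-1 * c * z))%g.
    by rewrite !gmulA mulgK.
  exact: generatedM.
- split; first exact: generatedV.
  have -> : (z^-1 * b^-1 * z = (z^-1 * b * z)^-1)%g by rewrite !ginvM invgK
    gmulA.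
  exact: generatedV.
Qed.

Lemma partial_dominantE z lam : partial_dominant I J z lam <-> Kdominant
  (meet_conj z) lam.
Proof.
split=> H al s aD sE; first by case; exact: H.
by move=> Is Js; exact: (H al s).
Qed.

(** Write x = t_mu w and let z = a w b be shortest in W_I w W_J. This turns mu into a mu, which is
    still free up to the elements c of W_I with z^-1 c z in W_J; such a c can make it dominant. *)
Lemma reduced_index x : red x ->
  exists p, indexIJ I J p /\ x = min_elt I J p.1 p.2.
Proof.
move=> rx; case: x rx => mu w rx.
pose Q k := `[< exists a b, [/\ generated I a,
  generated J b & ell (fin (a * w * b)%g) = k] >].
have exQ : exists k, Q k.
  exists (ell (fin w)); apply/asboolP; exists 1%g, 1%g.
  by split; [exact: generated1|exact: generated1|rewrite mul1g mulg1].
case: (ex_minnP exQ) => k /asboolP[a [b [Ia Jb Ek]]] mink.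
have [z zE] : exists z : weyl R, z = (a * w * b)%g by eexists.
rewrite -zE in Ek.
have minz : min_coset_rep I J z.
  move=> a' b' Ia' Jb'; rewrite Ek; apply: mink; apply/asboolP.
  exists (a' * a)%g, (b * b')%g; split; [exact: generatedM|exact: generatedM|].
  by rewrite zE !gmulA.
have [c Kc dc] := Kdominant_exists (meet_conj z) (a *m mu).
have [Ic Jc] := meet_conj_gen Kc.
exists (c *m (a *m mu), z); split; first by split=> //; exact/partial_dominantE.
apply: double_coset_reduced => //=.
(* Applying c to the translation part is undone by c^-1 on the left and z^-1 c z on the right. *)
exists (a^-1 * c^-1)%g, (z^-1 * c * z * b^-1)%g; split.
- by apply: generatedM; exact: generatedV.
- by apply: generatedM => //; exact: generatedV.
rewrite mulmxA -weyl_mxM translationJ -translation_fin.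
set B := (z^-1 * c * z * b^-1)%g; set A := (a^-1 * c^-1)%g; set d := (c * a)%g.
transitivity ((fin A * fin d) * translation R mu * fin (d^-1 * z * B))%g;
  last first.
  by rewrite !finM !gmulA.
rewrite -finM; have -> : (A * d = 1)%g by rewrite /A /d gmulA mulgVK mulVg.
rewrite fin1 mul1g; congr (_ * fin _)%g.
by rewrite /d /B ginvM !gmulA mulgK mulgVK zE !gmulA mulVg mul1g mulgK.
Qed.

(** Projecting to W recovers z. The remaining ambiguity A satisfies A z = z B, so it lies in the
    parabolic subgroup of I and z J z^-1, where dominant elements of one orbit coincide. *)
Lemma index_inj p p' : indexIJ I J p -> indexIJ I J p' ->
  min_elt I J p.1 p.2 = min_elt I J p'.1 p'.2 -> p = p'.
Proof.
case: p p' => lam z [lam' z'] /= [/= minz domz] [/= minz' domz'] E.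
have [[a [b [Ia Jb Em]]] _] := min_eltP lam z.
have [[a' [b' [Ia' Jb' Em']]] _] := min_eltP lam' z'.
rewrite -E Em !translation_fin in Em'.
have E1 : a *m lam = a' *m lam'.
  by have := congr1 fst Em'; rewrite /= !mulmx0 !addr0 !add0r.
have E2 : (a * z * b = a' * z' * b')%g by exact: (congr1 snd Em').
set A := (a^-1 * a')%g; set B := (b * b'^-1)%g.
have IA : generated I A by apply: generatedM => //; exact: generatedV.
have JB : generated J B by apply: generatedM => //; exact: generatedV.
have E3 : (fin A * fin z' = fin z * fin B)%g.
  rewrite -!finM; congr fin; rewrite /A /B.
  by apply: (mulIg b');
    rewrite -!gmulA (gmulA a') -E2 mulVg mulg1 -!gmulA mulKg.
have Ez : z' = z.
  apply: fin_inj; apply: (reduced_uniq (fin_simples hI) (fin_simples hJ))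
    (gen_fin IA) (gen_fin JB) E3;
    exact: min_coset_rep_reduced.
rewrite Ez in E3 domz' *; congr (_, _).
have := gen_meet_conj (fin_simples hI) (fin_simples hJ) (min_coset_rep_reduced
  minz) (gen_fin IA) (gen_fin JB) E3.
move=> KA.
have {}KA : generated (meet_conj z) A.
  apply: fin_genE; apply: gen_sub KA => _ [[s Is <-] [j Jj E4]].
  exists s => //; split=> //=.
  have -> : (z^-1 * s * z)%g = j; last by [].
  by apply: fin_inj; rewrite E4 !finM finV.
have lamE : lam = A *m lam'.
  have := congr1 (mulmx (weyl_mx a^-1%g)) E1; rewrite !mulmxA -!weyl_mxM mulVg.
  by rewrite weyl_mx1 mul1mx.
rewrite lamE; apply: Kdominant_uniq KA; first exact: (@meet_conj_simple z).
  exact/partial_dominantE.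
by rewrite -lamE; exact/partial_dominantE.
Qed.

End DoubleCosets.
End Index.

(** * Laurent polynomials *)
Section Laurent.
Local Notation A := laurent.
Local Notation "x %:F" := (tofrac x).

Lemma laurent_mulf_eq0 (c d : A) : c * d = 0 -> c = 0 \/ d = 0.
Proof.
move/(congr1 val) => /= /eqP; rewrite mulf_eq0.
by case/orP=> /eqP E; [left|right]; apply: val_inj.
Qed.

Definition polyV (p : {poly int}) : A := (map_poly (fun k : int =>
  k%:~R) p).[vinv].

Lemma val_polyv p : val (polyv p) = p%:F.
Proof.
elim/poly_ind: p => [|p c IH]; first by rewrite /polyv rmorph0 horner0 rmorph0.
have -> : polyv (p * 'X + c%:P) = polyv p * v + c%:~R.
  by rewrite /polyv rmorphD rmorphM /= map_polyX map_polyC /= hornerMXaddC.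
rewrite [LHS]/= IH tofracD tofracM; congr (_ * _ + _).
rewrite -[LHS]/(\val (c%:~R : laurent)) rmorph_int -[c in RHS]intz.
by rewrite (rmorph_int polyC) (rmorph_int (@tofrac _)).
Qed.

Lemma polyv_inj : injective polyv.
Proof. by move=> p q /(congr1 val); rewrite !val_polyv => /eqP;
  rewrite tofrac_eq => /eqP. Qed.

Lemma polyvM p q : polyv (p * q) = polyv p * polyv q.
Proof. by rewrite /polyv rmorphM hornerM. Qed.

Lemma polyvXn k : polyv 'X^k = v ^+ k.
Proof. by rewrite /polyv map_polyXn hornerXn. Qed.

Lemma polyv_sum (p : {poly int}) k : (size p <= k)%N ->
  polyv p = \sum_(i < k) (p`_i)%:~R * v ^+ i.
Proof.
move=> sp; rewrite /polyv (horner_coef_wide (n := k)) //; last first.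
  exact: leq_trans (size_poly _ _) sp.
by apply: eq_bigr => i _; rewrite coef_map.
Qed.

Lemma polyV_sum (p : {poly int}) k : (size p <= k)%N ->
  polyV p = \sum_(i < k) (p`_i)%:~R * vinv ^+ i.
Proof.
move=> sp; rewrite /polyV (horner_coef_wide (n := k)) //; last first.
  exact: leq_trans (size_poly _ _) sp.
by apply: eq_bigr => i _; rewrite coef_map.
Qed.

Lemma vinv_v : vinv * v = 1. Proof. by rewrite mulrC v_vinv. Qed.

Lemma vvinvX k : v ^+ k * vinv ^+ k = 1.
Proof. by rewrite -exprMn v_vinv expr1n. Qed.

(** The set v^-1 Z[v^-1]. *)
Definition negl (c : A) : Prop := exists p, c = vinv * polyV p.

Lemma polyVD p q : polyV (p + q) = polyV p + polyV q.
Proof. by rewrite /polyV rmorphD hornerD. Qed.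

Lemma polyVM p q : polyV (p * q) = polyV p * polyV q.
Proof. by rewrite /polyV rmorphM hornerM. Qed.

Lemma polyVN p : polyV (- p) = - polyV p.
Proof. by rewrite /polyV rmorphN hornerN. Qed.

Lemma polyVC (k : int) : polyV k%:P = k%:~R.
Proof. by rewrite /polyV map_polyC hornerC. Qed.

Lemma polyVX : polyV 'X = vinv.
Proof. by rewrite /polyV map_polyX hornerX. Qed.

Lemma negl0 : negl 0.
Proof. by exists 0; rewrite (polyVC 0) mulr0. Qed.

Lemma neglD c d : negl c -> negl d -> negl (c + d).
Proof. by move=> [p ->] [q ->]; exists (p + q); rewrite polyVD mulrDr. Qed.

Lemma neglN c : negl c -> negl (- c).
Proof. by move=> [p ->]; exists (- p); rewrite polyVN mulrN. Qed.

Lemma negl_polyV p c : negl c -> negl (polyV p * c).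
Proof. by move=> [q ->]; exists (p * q); rewrite polyVM mulrCA. Qed.

Lemma negl_int (m : int) c : negl c -> negl (m%:~R * c).
Proof. by rewrite -polyVC; exact: negl_polyV. Qed.

Lemma negl_vinv c : negl c -> negl (vinv * c).
Proof. by rewrite -polyVX; exact: negl_polyV. Qed.

Lemma negl_sum (T : eqType) (s : seq T) (F : T -> A) :
  (forall i, i \in s -> negl (F i)) -> negl (\sum_(i <- s) F i).
Proof.
elim: s => [|a s IH] H; first by rewrite big_nil; exact: negl0.
rewrite big_cons; apply: neglD; first by apply: H; exact: mem_head.
by apply: IH => i si; apply: H; rewrite inE si orbT.
Qed.

Lemma negl_vinv1 : negl vinv.
Proof. by exists 1; rewrite (polyVC 1) mulr1. Qed.

Lemma negl_poly (p : {poly int}) d : (size p <= d)%N ->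
  negl (vinv ^+ d * polyv p).
Proof.
move=> sp; rewrite (polyv_sum sp) mulr_sumr; apply: negl_sum => i _.
rewrite mulrCA; apply: negl_int.
have : (d = i + (d - i.+1).+1)%N by have := ltn_ord i; lia.
move: (nat_of_ord i) => j {1}->.
rewrite exprD mulrAC -exprMn vinv_v expr1n mul1r exprSr.
elim: (d - _)%N => [|k IH]; first by rewrite expr0 mul1r; exact: negl_vinv1.
by rewrite exprS -mulrA; exact: negl_vinv.
Qed.

(* Compare degrees after multiplying by a power of v. *)
Lemma negl_fix p : v * polyv p = vinv * polyV p -> p = 0.
Proof.
move=> E; apply/eqP; apply: contraT => p0; set d := size p.
pose q := \sum_(i < d) p`_i *: 'X^(d - i) : {poly int}.
have Eq : polyv ('X^(d.+2) * p) = polyv q.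
  rewrite polyvM polyvXn exprSr -mulrA E mulrA exprSr -[_ * v * vinv]mulrA
    v_vinv mulr1.
  rewrite (polyV_sum (leqnn _)) mulr_sumr.
  have -> : polyv q = \sum_(i < d) polyv (p`_i *: 'X^(d - i)).
    by rewrite /q /polyv raddf_sum /= horner_sum.
  apply: eq_bigr => i _; rewrite -mul_polyC polyvM polyvXn mulrCA.
  have -> : polyv (p`_i)%:P = (p`_i)%:~R by rewrite /polyv map_polyC hornerC.
  congr (_ * _); have {1}-> : d = ((d - i) + i)%N by rewrite subnK // ltnW.
  by rewrite exprD -mulrA vvinvX mulr1.
have := congr1 (fun r : {poly int} => size r) (polyv_inj Eq).
rewrite /= size_monicM ?monicXn // size_polyXn.
have : (size q <= d.+1)%N.
  apply: leq_trans (size_sum _ _ _) _; apply/bigmax_leqP => i _;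
    apply: leq_trans (size_scale_leq _ _) _.
  by rewrite size_polyXn; lia.
have := p0; rewrite -size_poly_gt0 /d; move: (size q) (size p) => a b; lia.
Qed.

Lemma v_plus_vinv_neq0 c : (v + vinv) * c = 0 -> c = 0.
Proof.
case/laurent_mulf_eq0=> // E; exfalso.
have : polyv ('X^2 + 1) = polyv 0.
  have -> : polyv ('X^2 + 1) = v * (v + vinv).
    rewrite /polyv rmorphD /= map_polyXn rmorph1 hornerD hornerXn hornerC
      mulrDr.
    by rewrite v_vinv expr2.
  by rewrite E mulr0 /polyv rmorph0 horner0.
move/polyv_inj/(congr1 (fun p : {poly int} => p.[1])).
by rewrite !hornerE.
Qed.

(** Congruence modulo v - 1, that is, equality after setting v = 1. *)
Definition eq1 (c d : A) : Prop := exists e, c - d = (v - 1) * e.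

Lemma eq1_refl c : eq1 c c.
Proof. by exists 0; rewrite subrr mulr0. Qed.

Lemma eq1_trans c d e : eq1 c d -> eq1 d e -> eq1 c e.
Proof.
move=> [x E] [y E']; exists (x + y); rewrite mulrDr -E -E'.
by rewrite addrA subrK.
Qed.

Lemma eq1D c d c' d' : eq1 c c' -> eq1 d d' -> eq1 (c + d) (c' + d').
Proof.
by move=> [x E] [y E']; exists (x + y); rewrite mulrDr -E -E' opprD addrACA.
Qed.

Lemma eq1M c d c' d' : eq1 c c' -> eq1 d d' -> eq1 (c * d) (c' * d').
Proof.
move=> [x E] [y E']; exists (x * d + c' * y); rewrite mulrDr mulrA -E.
by rewrite (mulrCA _ c') -E'; ring.
Qed.

Lemma eq1X c d k : eq1 c d -> eq1 (c ^+ k) (d ^+ k).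
Proof.
move=> cd; elim: k => [|k IH]; first exact: eq1_refl.
by rewrite !exprS; exact: eq1M.
Qed.

Lemma eq1N c d : eq1 c d -> eq1 (- c) (- d).
Proof. by move=> [x E]; exists (- x); rewrite mulrN -E opprD. Qed.

Lemma eq1_sum (T : eqType) (s : seq T) (F G : T -> A) :
  (forall i, i \in s -> eq1 (F i) (G i)) ->
    eq1 (\sum_(i <- s) F i) (\sum_(i <- s) G i).
Proof.
elim: s => [|a s IH] H; first by rewrite !big_nil; exact: eq1_refl.
rewrite !big_cons; apply: eq1D; first by apply: H; exact: mem_head.
by apply: IH => i si; apply: H; rewrite inE si orbT.
Qed.

Lemma eq1_v : eq1 v 1.
Proof. by exists 1; rewrite mulr1. Qed.

Lemma eq1_vinv : eq1 vinv 1.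
Proof. by exists (- vinv); rewrite mulrN mulrBl v_vinv mul1r opprB. Qed.

(** Clear the denominator v^j of the quotient by v - 1 and evaluate the resulting polynomial
    identity at 1. *)
Lemma eq1_nat k (e : bool) : eq1 0 ((-1) ^+ e * k%:R) -> k = 0%N.
Proof.
move=> H; have {H} [c E] : eq1 k%:R 0.
  have -> : k%:R = (-1) ^+ e * ((-1) ^+ e * k%:R) :> A by rewrite signrMK.
  rewrite -[X in eq1 _ X](mulr0 ((-1) ^+ e)); apply: eq1M;
    first exact: eq1_refl.
  by case: H => c E; exists (- c); rewrite mulrN -E opprB.
have /asboolP[j [p Ep]] : val c \in is_laurent by exact: valP.
have {Ep} : (('X^j * k%:R : {poly int})%:F = (('X - 1) * p)%:F).
  rewrite !tofracM -Ep tofracB tofrac1 mulrCA; congr (_ * _).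
  have /(congr1 val) := E; rewrite subr0 /= => <-.
  by rewrite -[RHS]/(\val (k%:R : laurent)) !rmorph_nat.
move/eqP; rewrite tofrac_eq => /eqP/(congr1 (fun q : {poly int} => q.[1])).
by rewrite !hornerE expr1n mul1r -polyC_natr hornerC natz => -[].
Qed.

End Laurent.

(** * Coefficients in the Hecke algebra *)
Section Combinations.
Variables (K : choiceType) (M : lmodType laurent) (f : K -> M).

Lemma sum_collect (l : seq (laurent * K)) : exists c : K -> laurent,
  (forall k, k \notin [seq p.2 | p <- l] -> c k = 0) /\
  \sum_(p <- l) p.1 *: f p.2 = \sum_(k <- undup [seq p.2 | p <- l]) c k *: f k.
Proof.
exists (fun k => \sum_(p <- l | p.2 == k) p.1); split.
  move=> k kl; rewrite big_seq_cond big1 // => p /andP[pl /eqP pk].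
  by case/negP: kl; rewrite -pk map_f.
under [RHS]eq_bigr do rewrite scaler_suml.
rewrite (exchange_big_dep xpredT) //=; apply: eq_big_seq => p pl.
rewrite -big_filter (bigD1_seq p.2) ?mem_filter ?eqxx ?mem_undup ?map_f
  ?filter_uniq ?undup_uniq //=.
rewrite big_seq_cond big1 ?addr0 // => k /andP[].
by rewrite mem_filter => /andP[/eqP <-]; rewrite eqxx.
Qed.

Lemma sum_widen (s u : seq K) (c : K -> laurent) : uniq s -> uniq u ->
  {subset s <= u} -> (forall k, k \notin s -> c k = 0) ->
  \sum_(k <- s) c k *: f k = \sum_(k <- u) c k *: f k.
Proof.
move=> us uu su c0; rewrite [RHS](bigID (mem s)) /= [X in _ + X]big1 ?addr0 =>
  [|k].
  rewrite -[RHS]big_filter; apply: perm_big; apply: uniq_perm => //.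
    exact: filter_uniq.
  move=> k; rewrite mem_filter andbC; have [/su ->//|] := boolP (k \in s).
  by rewrite andbF.
by move/c0 ->; rewrite scale0r.
Qed.

End Combinations.

Section Coefficients.
Variables (n : nat) (R : rootDatum n) (H : affineHecke R).
Notation W := (extWeyl R).
Implicit Types (h : H) (x y z : W) (c d : laurent) (s : seq W).

(* Locked, lest rewriting with linearity lemmas unfold it. *)
Definition Tt x : H := locked (vinv ^+ ell x *: T H x).

Lemma TtE x : Tt x = vinv ^+ ell x *: T H x.
Proof. by rewrite /Tt -lock. Qed.

Lemma Tt_T x : T H x = v ^+ ell x *: Tt x.
Proof. by rewrite TtE scalerA vvinvX scale1r. Qed.

Lemma Tt_free s (c : W -> laurent) : uniq s ->
  \sum_(x <- s) c x *: Tt x = 0 -> forall x, x \in s -> c x = 0.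
Proof.
move=> us E x xs; have [_ free _] := T_basis H.
have D : \sum_(k <- s) (c k * vinv ^+ ell k) *: T H k = 0.
  by rewrite -[RHS]E; refine (eq_bigr _ _) => k _; rewrite TtE scalerA.
have /(congr1 (fun e => v ^+ ell x * e)) := free s _ us (fun _ _ => I) D x xs.
by rewrite mulrCA vvinvX mulr1 mulr0.
Qed.

Lemma tc_exists h : exists c : W -> laurent, exists s,
  [/\ uniq s, forall x, (x \in s) = (c x != 0) & h = \sum_(x <- s) c x *: Tt x].
Proof.
have [_ _ span] := T_basis H; have [//|s [c [_ ->]]] := span h.
have -> : \sum_(k <- s) c k *: T H k =
    \sum_(p <- [seq (c x * v ^+ ell x, x) | x <- s]) p.1 *: Tt p.2.
  by rewrite big_map; refine (eq_bigr _ _) => x _; rewrite /= -scalerA -Tt_T.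
set l := [seq _ | _ <- s].
have [d [d0 ->]] := sum_collect Tt l; set u := undup _.
exists d, [seq x <- u | d x != 0]; split.
- by rewrite filter_uniq ?undup_uniq.
- move=> x; rewrite mem_filter; have [//|dx] := eqVneq (d x) 0.
  rewrite /= mem_undup; apply: contraNT dx => /d0 ->; exact: eqxx.
- rewrite big_filter [RHS]big_mkcond /=; apply: eq_bigr => x _.
  by have [->|//] := eqVneq (d x) 0; rewrite scale0r.
Qed.

(** In the normalized basis C'_x has leading coefficient 1 and all others in v^-1 Z[v^-1]. *)
Definition tc h : W -> laurent := projT1 (cid (tc_exists h)).

Lemma tcP h : exists s,
  [/\ uniq s, forall x,
    (x \in s) = (tc h x != 0) & h = \sum_(x <- s) tc h x *: Tt x].
Proof. exact: (projT2 (cid (tc_exists h))). Qed.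

Lemma tc_uniq h s (c : W -> laurent) : uniq s -> (forall x,
  x \notin s -> c x = 0) ->
  h = \sum_(x <- s) c x *: Tt x -> tc h =1 c.
Proof.
move=> us c0 E x; have [s' [us' ms' E']] := tcP h.
have tc0 y : y \notin s' -> tc h y = 0 by rewrite ms' negbK => /eqP.
pose u := undup (s ++ s'); have uu : uniq u by exact: undup_uniq.
have su : {subset s <= u} by move=> y ys; rewrite mem_undup mem_cat ys.
have su' : {subset s' <= u} by move=> y ys; rewrite mem_undup mem_cat ys orbT.
rewrite (sum_widen _ us uu su c0) in E;
  rewrite (sum_widen _ us' uu su' tc0) in E'.
have D : \sum_(y <- u) (tc h y - c y) *: Tt y = 0.
  under eq_bigr do rewrite scalerBl.
  by rewrite sumrB -E -E' subrr.
have [xu|xu] := boolP (x \in u).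
  by apply/eqP; rewrite -subr_eq0; apply/eqP; exact: (Tt_free uu D).
rewrite mem_undup mem_cat negb_or in xu; case/andP: xu => xs xs'.
by rewrite c0 // tc0.
Qed.

Lemma tc_list h (u : seq W) : exists s, [/\ uniq s, {subset u <= s},
  forall x, x \notin s -> tc h x = 0 & h = \sum_(x <- s) tc h x *: Tt x].
Proof.
have [s' [us' ms' E']] := tcP h.
have tc0 y : y \notin s' -> tc h y = 0 by rewrite ms' negbK => /eqP.
exists (undup (u ++ s')); split.
- exact: undup_uniq.
- by move=> y ys; rewrite mem_undup mem_cat ys.
- by move=> y; rewrite mem_undup mem_cat negb_or => /andP[_]; exact: tc0.
- rewrite {1}E'; apply: sum_widen => //; first exact: undup_uniq.
  by move=> y ys; rewrite mem_undup mem_cat ys orbT.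
Qed.

Lemma tc_Tt x y : tc (Tt x) y = if y == x then 1 else 0.
Proof.
apply: (@tc_uniq _ [:: x] (fun y => if y == x then 1 else 0)) => //.
  by move=> z; rewrite inE => /negPf ->.
by rewrite big_seq1 eqxx scale1r.
Qed.

Lemma tcD h h' x : tc (h + h') x = tc h x + tc h' x.
Proof.
have [s [us _ s0 E]] := tc_list h [::].
have [s' [us' ss' s0' E']] := tc_list h' s.
apply: (@tc_uniq _ s' (fun x => tc h x + tc h' x)) => //.
  move=> y ys'; rewrite s0' // s0 ?addr0 //; apply: contra ys'; exact: ss'.
under eq_bigr do rewrite scalerDl.
by rewrite big_split /= -E' {1}E; congr (_ + _); exact: sum_widen.
Qed.

Lemma tcZ c h x : tc (c *: h) x = c * tc h x.
Proof.
have [s [us _ s0 E]] := tc_list h [::].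
apply: (@tc_uniq _ s (fun x => c * tc h x)) => //.
  by move=> y ys; rewrite s0 // mulr0.
by rewrite {1}E scaler_sumr; apply: eq_bigr => y _; rewrite scalerA.
Qed.

Lemma tc0 x : tc 0 x = 0.
Proof. by rewrite -(scale0r 0) tcZ mul0r. Qed.

Lemma tcN h x : tc (- h) x = - tc h x.
Proof. by rewrite -scaleN1r tcZ mulN1r. Qed.

Lemma tc_sum (U : Type) (s : seq U) (P : pred U) (F : U -> H) x :
  tc (\sum_(i <- s | P i) F i) x = \sum_(i <- s | P i) tc (F i) x.
Proof. exact: (big_morph (fun h => tc h x) (fun a b => tcD a b x) (tc0 x)). Qed.

Lemma tc_ext h h' : tc h =1 tc h' -> h = h'.
Proof.
move=> E; apply/eqP; rewrite -subr_eq0; apply/eqP.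
have [s [_ ms ->]] := tcP (h - h'); apply: big1_seq => x /andP[_].
by rewrite ms tcD tcN E subrr eqxx.
Qed.

Lemma Tt_ind (Q : H -> Prop) : Q 0 -> (forall h h',
  Q h -> Q h' -> Q (h + h')) ->
  (forall c x, Q (c *: Tt x)) -> forall h, Q h.
Proof.
move=> Q0 QD QT h; have [s [_ _ ->]] := tcP h.
by elim: s => [|x s IH]; rewrite ?big_nil ?big_cons //; exact: QD.
Qed.

Lemma tc_linear (F : H -> H) h y : (forall h h', F (h + h') = F h + F h') ->
  (forall c h, F (c *: h) = c *: F h) -> exists s,
  [/\ uniq s, forall x, (x \in s) = (tc h x != 0) &
      tc (F h) y = \sum_(x <- s) tc h x * tc (F (Tt x)) y].
Proof.
move=> FD FZ; have [s [us ms E]] := tcP h; exists s; split=> //.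
have F0 : F 0 = 0 by have := FZ 0 0; rewrite !scale0r.
rewrite {1}E (big_morph F FD F0) tc_sum; apply: eq_bigr => x _.
by rewrite FZ tcZ.
Qed.

Lemma hecke_torsion_free c h : (forall d,
  c * d = 0 -> d = 0) -> c *: h = 0 -> h = 0.
Proof.
move=> c0 E; apply: tc_ext => x; rewrite tc0; apply: c0.
by rewrite -tcZ E tc0.
Qed.

End Coefficients.

(** * The bar involution and Kazhdan-Lusztig elements *)

Section KazhdanLusztig.
Variables (n : nat) (R : rootDatum n) (H : affineHecke R).
Variables (bar : {rmorphism H -> H}).
Hypothesis hbar : bar_involution bar.
Notation AR := (affine_roots R).
Notation W := (extWeyl R).
Notation S := (simples AR).
Notation Tt := (Tt H).
Implicit Types (h : H) (x y z s : W) (c d : laurent).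

Lemma T_one : T H 1%g = 1.
Proof. by rewrite -fin1; exact: (bernstein_T1 (hecke_rel H)). Qed.

Lemma ell1 : ell (1%g : W) = 0%N.
Proof. by rewrite ellE len1. Qed.

Lemma Tt_one : Tt 1%g = 1.
Proof. by rewrite !TtE ell1 expr0 scale1r T_one. Qed.

Lemma ell_S s : S s -> ell s = 1%N.
Proof.
move=> Ss; rewrite ellE; have := len_mull (1%g : W) Ss.
by rewrite mulg1 len1 => -[].
Qed.

Lemma ell_mull s x : S s ->
  ell (s * x)%g = (ell x).+1 \/ ell x = (ell (s * x)%g).+1.
Proof. by move=> Ss; rewrite !ellE; exact: len_mull. Qed.

Lemma ell_mulr s x : S s ->
  ell (x * s)%g = (ell x).+1 \/ ell x = (ell (x * s)%g).+1.
Proof. by move=> Ss; rewrite !ellE; exact: len_mulr. Qed.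

Lemma Tt_mul x y : ell (x * y)%g = (ell x + ell y)%N ->
  Tt x * Tt y = Tt (x * y)%g.
Proof.
move=> E; rewrite !TtE -scalerAl -scalerAr scalerA -exprD -E T_mul //.
Qed.

Lemma Tt_quad s : S s -> Tt s * Tt s = 1 + (v - vinv) *: Tt s.
Proof.
move=> Ss; rewrite !TtE ell_S // -scalerAl -scalerAr scalerA T_quad; last first.
  by rewrite affine_simple_reflE.
have E1 : vinv * vinv * v * v = 1 by rewrite -[vinv * vinv * v]mulrA vinv_v
  mulr1 vinv_v.
have E2 : vinv * vinv * (v ^+ 2 - 1) = (v - vinv) * vinv.
  by rewrite mulrBr mulr1 expr2 mulrA E1 mulrBl v_vinv.
by rewrite T_one expr1 !(scalerDr, scalerA, mulrA) E1 E2 scale1r.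
Qed.

Lemma Tt_mull_up s x : S s -> (ell x < ell (s * x)%g)%N ->
  Tt s * Tt x = Tt (s * x)%g.
Proof.
by move=> Ss lt; apply: Tt_mul; rewrite [ell s]ell_S //;
  have := ell_mull x Ss; lia.
Qed.

Lemma Tt_mull_down s x : S s -> (ell (s * x)%g < ell x)%N ->
  Tt s * Tt x = Tt (s * x)%g + (v - vinv) *: Tt x.
Proof.
move=> Ss lt; have ssx : (s * (s * x) = x)%g by rewrite gmulA (S_invol Ss)
  mul1g.
have E : Tt s * Tt (s * x)%g = Tt x by rewrite Tt_mull_up ?ssx.
by rewrite -{1}E mulrA Tt_quad // mulrDl mul1r -scalerAl E.
Qed.

Lemma Tt_mulr_up s x : S s -> (ell x < ell (x * s)%g)%N ->
  Tt x * Tt s = Tt (x * s)%g.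
Proof.
by move=> Ss lt; apply: Tt_mul; rewrite [ell s]ell_S //;
  have := ell_mulr x Ss; lia.
Qed.

Lemma Tt_mulr_down s x : S s -> (ell (x * s)%g < ell x)%N ->
  Tt x * Tt s = Tt (x * s)%g + (v - vinv) *: Tt x.
Proof.
move=> Ss lt; have ssx : (x * s * s = x)%g by rewrite -gmulA (S_invol Ss) mulg1.
have E : Tt (x * s)%g * Tt s = Tt x by rewrite Tt_mulr_up ?ssx.
by rewrite -{1}E -mulrA Tt_quad // mulrDr mulr1 -scalerAr E.
Qed.

(** The Kazhdan-Lusztig element C'_s = v^-1 (T_s + 1). *)
Definition Cs s : H := Tt s + vinv%:A.

(** As [bar] is a ring morphism of H only, its effect on scalars is recorded as a relation. *)
Definition barred c d : Prop := bar c%:A = d%:A.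

Lemma barZ c d h : barred c d -> bar (c *: h) = d *: bar h.
Proof. by move=> E; rewrite -mulr_algl rmorphM /= E mulr_algl. Qed.

Lemma algM c d : (c * d)%:A = c%:A * d%:A :> H.
Proof. by rewrite -scalerAl mul1r scalerA. Qed.

Lemma barredM c d c' d' : barred c d -> barred c' d' ->
  barred (c * c') (d * d').
Proof. by move=> E E'; rewrite /barred algM rmorphM /= E E' [RHS]algM. Qed.

Lemma barredD c d c' d' : barred c d -> barred c' d' ->
  barred (c + c') (d + d').
Proof. by move=> E E'; rewrite /barred scalerDl rmorphD /= E E' -scalerDl. Qed.

Lemma barred_int (k : int) : barred k%:~R k%:~R.
Proof. by rewrite /barred !scaler_int rmorphMz rmorph1. Qed.

Lemma barred_v : barred v vinv.
Proof. by have [_ E _] := hbar. Qed.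

Lemma barred_vinv : barred vinv v.
Proof.
have E : bar vinv%:A * vinv%:A = 1.
  have E : vinv%:A * v%:A = 1 :> H by rewrite -[LHS]algM vinv_v scale1r.
  by have := congr1 bar E; rewrite rmorphM rmorph1 /= barred_v.
have E' : vinv%:A * v%:A = 1 :> H by rewrite -[LHS]algM vinv_v scale1r.
rewrite /barred; transitivity (bar vinv%:A * (vinv%:A * v%:A)).
  by rewrite E' mulr1.
by rewrite mulrA E mul1r.
Qed.

Lemma barredX c d k : barred c d -> barred (c ^+ k) (d ^+ k).
Proof.
move=> E; elim: k => [|k IH]; first by rewrite !expr0 /barred scale1r rmorph1.
by rewrite !exprS; exact: barredM.
Qed.

Lemma barredN c d : barred c d -> barred (- c) (- d).
Proof. by move=> E; rewrite /barred !scaleNr rmorphN /= E. Qed.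

Lemma barred_polyV p : barred (polyV p) (polyv p).
Proof.
elim/poly_ind: p => [|p c IH].
  have -> : polyv 0 = 0 by rewrite /polyv rmorph0 horner0.
  by rewrite (polyVC 0); exact: (barred_int 0).
have -> : polyv (p * 'X + c%:P) = polyv p * v + c%:~R.
  by rewrite /polyv rmorphD rmorphM /= map_polyX map_polyC /= hornerMXaddC.
rewrite polyVD polyVM polyVX polyVC; apply: barredD; last exact: barred_int.
exact: barredM barred_vinv.
Qed.

Lemma bar_T_mul x : bar (T H x) * T H x^-1%g = 1 /\ T H x^-1%g * bar (T H x) =
  1.
Proof. by have [_ _] := hbar. Qed.

Lemma bar_Tt_S s : S s -> bar (Tt s) = Tt s - (v - vinv)%:A.
Proof.
move=> Ss; have E : Tt s * bar (Tt s) = 1.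
  have [_ E] := bar_T_mul s; rewrite (S_inv Ss) in E.
  rewrite !TtE (barZ _ (barredX _ barred_vinv)) ell_S // !expr1.
  by rewrite -scalerAl -scalerAr scalerA vinv_v scale1r.
have E' : (Tt s - (v - vinv)%:A) * Tt s = 1.
  by rewrite mulrBl mulr_algl Tt_quad // addrK.
transitivity ((Tt s - (v - vinv)%:A) * Tt s * bar (Tt s)).
  by rewrite E' mul1r.
by rewrite -mulrA E mulr1.
Qed.

Lemma bar_Cs s : S s -> bar (Cs s) = Cs s.
Proof.
move=> Ss; rewrite /Cs rmorphD /= bar_Tt_S // barred_vinv scalerBl opprB.
by rewrite -addrA subrK.
Qed.

Lemma bar_T0 x : ell x = 0%N -> bar (Tt x) = Tt x.
Proof.
move=> x0; have xV0 : ell x^-1%g = 0%N by rewrite ellE len_inv -ellE.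
rewrite !TtE x0 expr0 !scale1r; have [_ E] := bar_T_mul x.
have E' : T H x * T H x^-1%g = 1.
  by rewrite T_mul; rewrite mulgV ?T_one // x0 xV0 ell1.
by rewrite -[LHS]mul1r -E' -mulrA E mulr1.
Qed.

(* The common properties of left and right multiplication by C'_s. *)
Record kl_op (C : H -> H) (sig : W -> W) : Prop := KlOp {
  kl_opD : forall h h', C (h + h') = C h + C h';
  kl_opZ : forall c h, C (c *: h) = c *: C h;
  kl_op_bar : forall h, bar (C h) = C (bar h);
  kl_op_invol : involutive sig;
  kl_op_ell : forall x, ell (sig x) = (ell x).+1 \/ ell x = (ell (sig x)).+1;
  kl_op_up : forall x, (ell x < ell (sig x))%N ->
    C (Tt x) = Tt (sig x) + vinv *: Tt x;
  kl_op_down : forall x,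
    (ell (sig x) < ell x)%N -> C (Tt x) = Tt (sig x) + v *: Tt x
}.

Lemma kl_opl s : S s -> kl_op (fun h => Cs s * h) (fun x => (s * x)%g).
Proof.
move=> Ss; split.
- by move=> h h'; rewrite mulrDr.
- by move=> c h; rewrite scalerAr.
- by move=> h; rewrite rmorphM /= bar_Cs.
- by move=> x; rewrite gmulA (S_invol Ss) mul1g.
- by move=> x; exact: ell_mull.
- by move=> x lt; rewrite /Cs mulrDl mulr_algl Tt_mull_up.
- by move=> x lt; rewrite /Cs mulrDl mulr_algl Tt_mull_down // -addrA -scalerDl
  subrK.
Qed.

Lemma kl_opr s : S s -> kl_op (fun h => h * Cs s) (fun x => (x * s)%g).
Proof.
move=> Ss; split.
- by move=> h h'; rewrite mulrDl.
- by move=> c h; rewrite scalerAl.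
- by move=> h; rewrite rmorphM /= bar_Cs.
- by move=> x; rewrite -gmulA (S_invol Ss) mulg1.
- by move=> x; exact: ell_mulr.
- by move=> x lt; rewrite /Cs mulrDr mulr_algr Tt_mulr_up.
- by move=> x lt; rewrite /Cs mulrDr mulr_algr Tt_mulr_down // -addrA -scalerDl
  subrK.
Qed.

Section Op.
Variables (C : H -> H) (sig : W -> W).
Hypothesis op : kl_op C sig.

Lemma kl_op0 : C 0 = 0.
Proof. by have := kl_opZ op 0 0; rewrite !scale0r. Qed.

Lemma kl_opMz h k : C (h *~ k) = C h *~ k.
Proof. by rewrite -!scaler_int (kl_opZ op). Qed.

Lemma kl_opN h : C (- h) = - C h.
Proof. by rewrite -!scaleN1r (kl_opZ op). Qed.

Lemma kl_op_sum (U : Type) (l : seq U) (F : U -> H) :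
  C (\sum_(i <- l) F i) = \sum_(i <- l) C (F i).
Proof. exact: (big_morph C (kl_opD op) kl_op0). Qed.

(** The relation C'_s C'_s = (v + v^-1) C'_s, in operator form. *)
Lemma kl_opK h : C (C h) = (v + vinv) *: C h.
Proof.
move: h; apply: Tt_ind => [|h h' IH IH'|c x].
- by rewrite !kl_op0 scaler0.
- by rewrite !(kl_opD op) IH IH' scalerDr.
- rewrite !(kl_opZ op) scalerA mulrC -scalerA; congr (_ *: _).
  have sK := kl_op_invol op x.
  case: (kl_op_ell op x) => E.
    have U : C (Tt x) = Tt (sig x) + vinv *: Tt x by apply: (kl_op_up op);
      rewrite E.
    have D : C (Tt (sig x)) = Tt x + v *: Tt (sig x).
      by rewrite (kl_op_down op) ?sK // E.
    rewrite {1}U (kl_opD op) (kl_opZ op) D U !(scalerDr,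
      scalerDl) !scalerA v_vinv scale1r.
    by rewrite addrACA [Tt x + _]addrC addrACA; congr (_ + _); rewrite addrC.
  have U : C (Tt x) = Tt (sig x) + v *: Tt x by apply: (kl_op_down op);
    rewrite [ell x]E.
  have D : C (Tt (sig x)) = Tt x + vinv *: Tt (sig x).
    by rewrite (kl_op_up op) ?sK // [ell x]E.
  rewrite {1}U (kl_opD op) (kl_opZ op) D U !(scalerDr,
    scalerDl) !scalerA vinv_v scale1r.
  by rewrite addrACA [Tt x + _]addrC addrACA; congr (_ + _); rewrite addrC.
Qed.

Definition kap y : laurent := if (ell y < ell (sig y))%N then vinv else v.

Lemma tc_op h y : tc (C h) y = tc h (sig y) + kap y * tc h y.
Proof.
move: h; apply: Tt_ind => [|h h' IH IH'|c x].
- by rewrite kl_op0 !tc0 mulr0 addr0.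
- by rewrite (kl_opD op) !tcD IH IH' mulrDr addrACA.
- rewrite (kl_opZ op) !tcZ mulrCA -mulrDr; congr (_ * _).
  have Es : (sig y == x) = (y == sig x).
    by apply/eqP/eqP => [<-|->]; rewrite (kl_op_invol op).
  rewrite !tc_Tt Es /kap.
  case: (kl_op_ell op x) => E.
    rewrite (kl_op_up op) ?E // tcD tcZ !tc_Tt; congr (_ + _).
    by have [->|_] := eqVneq y x; rewrite ?mulr0 // E ltnSn.
  rewrite (kl_op_down op) ?E // tcD tcZ !tc_Tt; congr (_ + _).
  have [->|_] := eqVneq y x; rewrite ?mulr0 //.
  by rewrite {1}E ltnNge leqnSn.
Qed.

End Op.

Lemma left_ind (Q : W -> Prop) : (forall x, ell x = 0%N -> Q x) ->
  (forall s x, S s -> (ell x < ell (s * x)%g)%N -> Q x -> Q (s * x)%g) ->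
    forall x, Q x.
Proof.
move=> Q0 QS x; have [k] := ubnP (ell x); elim: k => // k IH in x * => lek.
have [/Q0 //|x0] := eqVneq (ell x) 0%N.
have [l [g [Sl dg E sz]]] := lenP AR x.
case: l Sl E sz => [|s l] Sl E sz; first by rewrite ellE -sz in x0.
have [Ss {}Sl] := word_in_consP Sl.
have lt : (ell (s * x)%g < ell x)%N.
  have -> : (s * x = gprod l * g)%g by rewrite E /= !gmulA (S_invol Ss) mul1g.
  by rewrite [ell x]ellE -sz ltnS ellE; exact: len_le.
have -> : x = (s * (s * x))%g by rewrite gmulA (S_invol Ss) mul1g.
apply: QS => //; first by rewrite gmulA (S_invol Ss) mul1g.
by apply: IH; apply: leq_trans lt _.
Qed.

Lemma Tt_Cs s x : S s -> (ell x < ell (s * x)%g)%N ->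
  Tt (s * x)%g = Cs s * Tt x - vinv *: Tt x.
Proof. by move=> Ss lt; rewrite (kl_op_up (kl_opl Ss)) // addrK. Qed.

Lemma bar_Tt_Cs s x : S s -> (ell x < ell (s * x)%g)%N ->
  bar (Tt (s * x)%g) = Cs s * bar (Tt x) - v *: bar (Tt x).
Proof.
by move=> Ss lt; rewrite Tt_Cs // rmorphB rmorphM /= bar_Cs // (barZ _
  barred_vinv).
Qed.

(** The bar involution is unitriangular for the length. For sx > x it sends the normalized T_sx to
    (C'_s - v) times the image of T_x; the diagonal factor [kap] - v vanishes at y = sx, where the
    coefficient is inherited from x. *)
Lemma bar_Tt x : tc (bar (Tt x)) x = 1 /\
  forall y, y <> x -> tc (bar (Tt x)) y != 0 -> (ell y < ell x)%N.
Proof.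
move: x; apply: left_ind => [x x0|s x Ss lt [IH1 IH]].
  rewrite bar_T0 // tc_Tt eqxx; split=> // y yx.
  by rewrite tc_Tt; case: (y =P x) => // _; rewrite eqxx.
have Esx : ell (s * x)%g = (ell x).+1 by have := ell_mull x Ss; lia.
have sK y : (s * (s * y) = y)%g by rewrite gmulA (S_invol Ss) mul1g.
have E y : tc (bar (Tt (s * x)%g)) y =
    tc (bar (Tt x)) (s * y)%g + (kap (fun x =>
      (s * x)%g) y - v) * tc (bar (Tt x)) y.
  by rewrite bar_Tt_Cs // tcD tcN tcZ (tc_op (kl_opl Ss)) mulrBl addrA.
split.
  rewrite E sK IH1 /kap sK ltnNge (ltnW lt) /= subrr mul0r addr0 //.
move=> y ysx; rewrite E Esx ltnS => nz.
have [E0|E0] := eqVneq (tc (bar (Tt x)) (s * y)%g) 0; last first.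
  have ysx' : (s * y)%g <> x by move=> ysx'; apply: ysx; rewrite -ysx' sK.
  by have := IH _ ysx' E0; have := ell_mull y Ss; lia.
have [yx|/eqP yx] := eqVneq y x; first by rewrite yx leqnn.
apply/ltnW/(IH _ yx); apply: contraNneq nz => E1.
by rewrite E0 E1 mulr0 addr0.
Qed.

(* Uniqueness of C'_x, without reference to the Bruhat order. *)
Lemma bar_negl_eq0 h : bar h = h -> (forall x, negl (tc h x)) -> h = 0.
Proof.
move=> bh nh; apply/eqP; apply: contraT => /eqP h0; exfalso.
have [s [us ms E]] := tcP h.
have [|y [ys _ maxy]] := @seq_argmax _ s (fun=> True) (fun x => (ell x)%:Z).
  case: s us ms E => [|x s] us ms E; first by case: h0; rewrite E big_nil.
  by exists x => //; exact: mem_head.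
have ny : tc h y != 0 by rewrite -ms.
have [p Ep] := nh y.
have barc c : negl c -> exists d, barred c d.
  by move=> [q ->]; exists (v * polyv q);
    exact: barredM barred_vinv (barred_polyV q).
pose d x := projT1 (cid (barc _ (nh x))).
have dP x : barred (tc h x) (d x) by exact: (projT2 (cid (barc _ (nh x)))).
(* At an element y of greatest length in the support, unitriangularity leaves only the barred
   coefficient of h at y. *)
have : tc (bar h) y = d y.
  rewrite {1}E rmorph_sum tc_sum (bigD1_seq y) //= (barZ _ (dP y)) tcZ.
  rewrite (proj1 (bar_Tt y)) mulr1 big1_seq ?addr0 // => x /andP[xy xs].
  rewrite (barZ _ (dP x)) tcZ.
  have [->|nz] := eqVneq (tc (bar (Tt x)) y) 0; first by rewrite mulr0.
  have yx : y <> x by move=> yx; rewrite yx eqxx in xy.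
  by have := proj2 (bar_Tt x) y yx nz; have := maxy x xs I; lia.
rewrite bh Ep => Ed; have /negP[] := ny; apply/eqP.
have : v * polyv p = vinv * polyV p.
  have Dd : barred (tc h y) (d y) := dP y.
  have D2 : barred (tc h y) (v * polyv p).
    by rewrite Ep; exact: barredM barred_vinv (barred_polyV p).
  have := etrans (esym Dd) D2 => /(congr1 (fun h => tc h (1%g : W))).
  by rewrite !tcZ -Tt_one tc_Tt eqxx !mulr1 => <-.
by move/negl_fix => p0; rewrite Ep p0 (polyVC 0) mulr0.
Qed.

(* What is_kl says about the coefficients of C'_x, with the Bruhat order
   weakened to the comparison of lengths. *)
Definition kl_form x h : Prop := [/\ bar h = h, tc h x = 1,
  forall y, y <> x -> negl (tc h y) &
  forall y, y <> x -> tc h y != 0 -> (ell y < ell x)%N].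

Lemma is_kl_form x h : is_kl bar x h -> kl_form x h.
Proof.
case=> bh [P [szP E]].
pose F y : H := (vinv ^+ ell x * polyv (P y)) *: T H y.
(* The sum over a set is by definition the sum over this list, which is duplicate-free and contained
   in the lower interval. *)
pose s := finite_support 0 [set y | bruhat_lt y x] F.
have {}E : h = Tt x + \sum_(y <- s) F y by rewrite E TtE.
have us : uniq s by exact: finite_support_uniq.
have sP y : y \in s -> bruhat_lt y x.
  by rewrite /s; case: finite_supportP => //= X XP _ _ /XP.
have tcE z : tc h z = (if z == x then 1 else 0) +
    (if z \in s then v ^+ ell z * (vinv ^+ ell x * polyv (P z)) else 0).
  rewrite E tcD tc_Tt; congr (_ + _); rewrite tc_sum.
  have F' y : tc (F y) z = if z == y then v ^+ ell z * (vinv ^+ ell x * polyv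
    (P z)) else 0.
    rewrite /F Tt_T !tcZ tc_Tt; case: eqP => [->|_]; last by rewrite !mulr0.
    by rewrite mulr1 mulrC.
  have [zs|zs] := boolP (z \in s).
    rewrite (bigD1_seq z) //= F' eqxx big1 ?addr0 // => y.
    by rewrite F' eq_sym => /negPf ->.
  by rewrite big1_seq // => y /andP[_ ys]; rewrite F'; case: eqP => // zy;
    rewrite zy ys in zs.
have xs : x \notin s by apply/negP => /sP[].
split=> //.
- by rewrite tcE eqxx (negPf xs) addr0.
- move=> z zx; rewrite tcE (introF eqP zx) add0r; case: ifP => [zs|_];
  last exact: negl0.
  have lt := sP z zs; have := szP z lt; have := bruhat_lt_ell lt => l1 l2.
  (* The bound deg P < l(x) - l(z) puts the normalized coefficient in v^-1 Z[v^-1]. *)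
  have -> : v ^+ ell z * (vinv ^+ ell x * polyv (P z)) =
      vinv ^+ (ell x - ell z) * polyv (P z); last exact: negl_poly.
  by rewrite mulrA -{1}(subnK (ltnW l1)) exprD mulrCA vvinvX mulr1.
- move=> z zx; rewrite tcE (introF eqP zx) add0r; case: ifP => [zs _|];
  last by rewrite eqxx.
  exact: bruhat_lt_ell (sP z zs).
Qed.

(** The integer is the coefficient of v^-1 in c; for coefficients of C'_w it plays the part of mu(y,
    w). *)
Lemma negl_v c : negl c -> exists m : int, negl (v * c - m%:~R).
Proof.
case=> p ->; exists p`_0; rewrite mulrA v_vinv mul1r.
have [sp|sp] := leqP (size p) 0.
  by move: sp; rewrite leqn0 size_poly_eq0 => /eqP ->;
    rewrite coef0 (polyVC 0) subrr; exact: negl0.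
have [q Eq] : exists q, p = (p`_0)%:P + q * 'X.
  exists (\sum_(i < (size p).-1) p`_i.+1 *: 'X^i).
  rewrite -{1}[p]coefK poly_def -(prednK sp) big_ord_recl /= expr0 alg_polyC.
  by congr (_ + _); rewrite mulr_suml; apply: eq_bigr => i _;
    rewrite -scalerAl -exprSr.
exists q; rewrite {1}Eq polyVD polyVC polyVM polyVX.
by rewrite [_ + _ - _]addrC addrA addNr add0r mulrC.
Qed.

Section Descent.
Variable C' : W -> H.
Hypothesis hC' : forall x, is_kl bar x (C' x).
Variables (C : H -> H) (sig : W -> W).
Hypothesis op : kl_op C sig.

(** With w = [sig x] < x, the element g = C(C'_w) - sum of mu(y) C'_y - C'_x vanishes by
    [bar_negl_eq0]. Solving for C'_x, the claim follows from [kl_opK] for the first term and from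
    the induction hypothesis for the C'_y, which have y < [sig x] in length and [sig y] < y. *)
Lemma kl_op_descent x : (ell (sig x) < ell x)%N ->
  C (C' x) = (v + vinv) *: C' x.
Proof.
have [k] := ubnP (ell x); elim: k => // k IH in x * => lek ltx.
pose w := sig x; have sK := kl_op_invol op.
have swx : sig w = x by exact: sK.
have ewx : ell x = (ell w).+1 by rewrite /w; have := kl_op_ell op x; lia.
have [bw w1 wn wlt] := is_kl_form (hC' w).
have [bx x1 xn xlt] := is_kl_form (hC' x).
(* At y = w the coefficient is 1 and the value 0 is a dummy. *)
have muP y : exists m : int, y <> w -> negl (v * tc (C' w) y - m%:~R).
  have [yw|yw] := pselect (y = w); first by exists 0.
  by have [m nm] := negl_v (wn y yw); exists m.
pose mu y := projT1 (cid (muP y)).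
have muP' y : y <> w ->
  negl (v * tc (C' w) y - (mu y)%:~R) by exact: (projT2 (cid (muP y))).
have [s [us ms _]] := tcP (C' w).
(* Besides x itself, these are the only positions where C multiplies a coefficient by v or otherwise
   may leave v^-1 Z[v^-1]; subtracting mu(y) C'_y repairs them. *)
pose D := [seq y <- s | (y != w) && (ell (sig y) < ell y)%N].
have uD : uniq D by exact: filter_uniq.
have DP y : y \in D -> [/\ y <> w, (ell (sig y) < ell y)%N & (ell y < ell w)%N].
  rewrite mem_filter => /andP[/andP[/eqP yw lty] ys]; split=> //.
  by apply: wlt => //; rewrite -ms.
pose g := C (C' w) - \sum_(y <- D) C' y *~ mu y - C' x.
have bg : bar g = g.
  rewrite /g !rmorphB /= (kl_op_bar op) bw bx rmorph_sum; congr (_ - _ - _).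
  by apply: eq_bigr => y _; rewrite rmorphMz;
    have [-> _ _ _] := is_kl_form (hC' y).
have tcMz h m z : tc (h *~ m) z = m%:~R * tc h z by rewrite -scaler_int tcZ.
have tg z : tc g z = tc (C' w) (sig z) + kap sig z * tc (C' w) z
    - \sum_(y <- D) (mu y)%:~R * tc (C' y) z - tc (C' x) z.
  rewrite /g !tcD !tcN (tc_op op) tc_sum; congr (_ - _ - _).
  by apply: eq_bigr => y _; rewrite tcMz.
have tC'0 y z : (ell y <= ell z)%N -> y <> z -> tc (C' y) z = 0.
  move=> le yz; apply/eqP; apply: contraT => nz.
  have [_ _ _ ylt] := is_kl_form (hC' y).
  by have := ylt z (nesym yz) nz; lia.
have ng z : negl (tc g z).
  rewrite tg; have [->|/eqP zx] := eqVneq z x.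
    rewrite -/w w1 x1 (tC'0 w x) ?ewx ?mulr0 ?addr0 //; last first.
      by move=> wx; move: ewx; rewrite wx; lia.
    rewrite big1_seq => [|y /andP[_ /DP[_ _ yw]]].
      by rewrite subr0 subrr; exact: negl0.
    rewrite tC'0 ?mulr0 //; first by rewrite ewx; lia.
    by move=> yx; move: yw; rewrite yx ewx; lia.
  have szw : sig z <> w by move=> E; apply: zx; rewrite -swx -E sK.
  apply: neglD; last exact: neglN (xn z zx).
  rewrite -addrA; apply: neglD; first exact: wn.
  have nsum (l : seq W) : z \notin l ->
    negl (\sum_(y <- l) (mu y)%:~R * tc (C' y) z).
    move=> zl; apply: negl_sum => y yl; apply: negl_int.
    have [_ _ yn _] := is_kl_form (hC' y); apply: yn => zy.
    by rewrite zy yl in zl.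
  have [zD|zD] := boolP (z \in D).
    have [zw ltz _] := DP z zD.
    rewrite (bigD1_seq z) //= opprD addrA;
      have [_ -> _ _] := is_kl_form (hC' z).
    rewrite mulr1 /kap ltnNge (ltnW ltz) /=; apply: neglD; first exact: muP'.
    apply: neglN; rewrite -big_filter; apply: nsum.
    by rewrite mem_filter eqxx.
  apply: neglD; last by apply: neglN; exact: nsum.
  have [->|/eqP zw] := eqVneq z w.
    by rewrite /kap swx ewx ltnSn w1 mulr1; exact: negl_vinv1.
  rewrite /kap; case: ifP => ltz; first by apply: negl_vinv; exact: wn.
  have -> : tc (C' w) z = 0; last by rewrite mulr0; exact: negl0.
  apply/eqP; rewrite -[_ == 0]negbK -ms; apply: contra zD => zs.
  rewrite mem_filter zs andbT (introN eqP zw) /=.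
  by case: (kl_op_ell op z) => E; rewrite E ?ltnSn // in ltz *.
have g0 := bar_negl_eq0 bg ng.
have -> : C' x = C (C' w) - \sum_(y <- D) C' y *~ mu y.
  by apply/eqP; rewrite eq_sym -subr_eq0; apply/eqP; exact: g0.
rewrite (kl_opD op) (kl_opN op) (kl_opK op) (kl_op_sum op) scalerBr;
  congr (_ - _).
rewrite scaler_sumr; apply: eq_big_seq => y /DP[yw lty ltw].
rewrite (kl_opMz op) IH //; last by clear -lek ltw ewx; lia.
by rewrite -!scaler_int !scalerA mulrC.
Qed.

End Descent.

End KazhdanLusztig.

(** * The elements C_{w_I} and the projection *)
Section Symmetrizer.
Variables (n : nat) (R : rootDatum n) (H : affineHecke R).
Variables (bar : {rmorphism H -> H}).
Hypothesis hbar : bar_involution bar.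
Notation AR := (affine_roots R).
Notation W := (extWeyl R).
Notation S := (simples AR).
Notation Tt := (Tt H).
Implicit Types (h : H) (x y z s : W) (c d : laurent).

Section OneParabolic.
Variable I : set (weyl R).
Hypothesis hI : I `<=` simple_refl R.
Notation WI := (generated (fins I)).
Notation lI := (ell (fin (longest I))).

Lemma fins_S s : fins I s -> S s.
Proof. exact: fin_simples. Qed.

Lemma gen_enum : exists r : seq (weyl R), uniq r /\ generated I = [set` r].
Proof.
have /finite_seqP[r rE] := finite_gen I; exists (undup r); split.
  exact: undup_uniq.
by rewrite rE; apply/predeqP => a /=; rewrite mem_undup.
Qed.

Lemma CwE (r : seq (weyl R)) : uniq r -> generated I = [set` r] ->
  Cw I H = \sum_(y <- r) ((- v) ^+ lI * (- vinv) ^+ ell (fin y)) *: Tt (fin y).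
Proof.
move=> ur rE; rewrite /Cw rE -fsbig_seq // scaler_sumr; apply: eq_bigr => y _.
rewrite Tt_T !scalerA; congr (_ *: _); rewrite -!mulrA; congr (_ * _).
by rewrite mul2n -addnn exprD -!mulrA [vinv ^+ _ * v ^+ _]mulrC vvinvX mulr1
  -exprNn.
Qed.

Lemma tc_Cw x : tc (Cw I H) x =
  if `[< WI x >] then (- v) ^+ lI * (- vinv) ^+ ell x else 0.
Proof.
have [r [ur rE]] := gen_enum; rewrite (CwE ur rE) tc_sum.
have memr a : a \in r <-> generated I a by rewrite rE.
case: asboolP => [/fin_gen[a /memr ar ->]|nx].
  rewrite (bigD1_seq a) //= tcZ tc_Tt eqxx mulr1 big1 ?addr0 // => b ba.
  rewrite tcZ tc_Tt; case: eqP => [/fin_inj ab|]; last by rewrite mulr0.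
  by rewrite ab eqxx in ba.
rewrite big1_seq // => a /andP[_ /memr Ia]; rewrite tcZ tc_Tt;
  case: eqP => [xa|].
  by case: nx; rewrite xa; exact: gen_fin.
by rewrite mulr0.
Qed.

(** In the normalized basis the coefficients of C_{w_I} on W_I are proportional to (-v^-1)^l(x), so
    the contributions of y and [sig y] cancel. *)
Lemma kl_op_Cw C sig : kl_op bar C sig -> (forall x, WI x -> WI (sig x)) ->
  C (Cw I H) = 0.
Proof.
move=> op WIs; apply: tc_ext => y; rewrite (tc_op op) !tc_Cw tc0.
have E : `[< WI (sig y) >] = `[< WI y >].
  apply/asboolP/asboolP; last exact: WIs.
  by move/WIs; rewrite (kl_op_invol op).
rewrite E; case: asboolP => _; last by rewrite mulr0 addr0.
rewrite mulrCA -mulrDr /kap; case: (kl_op_ell op y) => ->.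
  by rewrite ltnSn exprS mulNr addNr mulr0.
by rewrite ltnNge leqnSn /= exprS mulrA mulrN v_vinv mulN1r subrr mulr0.
Qed.

Lemma gen_mull s x : fins I s -> WI x -> WI (s * x)%g.
Proof. by move=> Is Ix; apply: generatedM => //; exact: generated_in. Qed.

Lemma gen_mulr s x : fins I s -> WI x -> WI (x * s)%g.
Proof. by move=> Is Ix; apply: generatedM => //; exact: generated_in. Qed.

Lemma Cs_Cw s : fins I s -> Cs H s * Cw I H = 0.
Proof.
move=> Is; apply: (kl_op_Cw (kl_opl hbar (fins_S Is))) => x; exact: gen_mull.
Qed.

Lemma Cw_Cs s : fins I s -> Cw I H * Cs H s = 0.
Proof.
move=> Is; apply: (kl_op_Cw (kl_opr hbar (fins_S Is))) => x; exact: gen_mulr.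
Qed.

Lemma gen_ind (Q : W -> Prop) : Q 1%g ->
  (forall s x, fins I s -> WI x -> (ell x < ell (s * x)%g)%N -> Q x ->
    Q (s * x)%g) ->
  forall x, WI x -> Q x.
Proof.
move=> Q1 QS x; have [k] := ubnP (ell x); elim: k => // k IH in x * => lek Ix.
have [->//|/eqP x1] := eqVneq x 1%g.
have [s Is E] := gen_descl (fin_simples hI) Ix x1.
have ssx : (s * (s * x) = x)%g by rewrite gmulA (S_invol (fins_S Is)) mul1g.
rewrite -ssx; apply: QS => //; [exact: gen_mull|by rewrite ssx !ellE E|].
by apply: IH; [rewrite !ellE E in lek *|exact: gen_mull].
Qed.

Lemma gen_ind_r (Q : W -> Prop) : Q 1%g ->
  (forall s x, fins I s -> WI x -> (ell x < ell (x * s)%g)%N -> Q x ->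
    Q (x * s)%g) ->
  forall x, WI x -> Q x.
Proof.
move=> Q1 QS x; have [k] := ubnP (ell x); elim: k => // k IH in x * => lek Ix.
have [->//|/eqP x1] := eqVneq x 1%g.
have [s Is E] := gen_descr (fin_simples hI) Ix x1.
have ssx : (x * s * s = x)%g by rewrite -gmulA (S_invol (fins_S Is)) mulg1.
rewrite -ssx; apply: QS => //; [exact: gen_mulr|by rewrite ssx !ellE E|].
by apply: IH; [rewrite !ellE E in lek *|exact: gen_mulr].
Qed.

Definition insupp (D : set W) h : Prop := forall x, tc h x != 0 -> D x.

Lemma insuppD D h h' : insupp D h -> insupp D h' -> insupp D (h + h').
Proof.
move=> Dh Dh' x; rewrite tcD; have [->|/Dh //] := eqVneq (tc h x) 0.
by rewrite add0r; exact: Dh'.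
Qed.

Lemma insuppZ D c h : insupp D h -> insupp D (c *: h).
Proof.
by move=> Dh x; rewrite tcZ => nz; apply: Dh; apply: contraNneq nz => ->;
  rewrite mulr0.
Qed.

Lemma insupp_sum (D : set W) (U : eqType) (r : seq U) (F : U -> H) :
  (forall i, i \in r -> insupp D (F i)) -> insupp D (\sum_(i <- r) F i).
Proof.
elim: r => [|a r IH] Dr; first by rewrite big_nil => x; rewrite tc0 eqxx.
rewrite big_cons; apply: insuppD; first by apply: Dr; exact: mem_head.
by apply: IH => i ir; apply: Dr; rewrite inE ir orbT.
Qed.

Lemma insupp_op D C sig h : kl_op bar C sig -> (forall x, D x -> D (sig x)) ->
  insupp D h -> insupp D (C h).
Proof.
move=> op Ds Dh x; rewrite (tc_op op).
have [->|/Dh /Ds] := eqVneq (tc h (sig x)) 0; last by rewrite (kl_op_invol op).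
by rewrite add0r => nz; apply: Dh; apply: contraNneq nz => ->; rewrite mulr0.
Qed.

Lemma insupp_Tt D x : D x -> insupp D (Tt x).
Proof. by move=> Dx y; rewrite tc_Tt; case: (y =P x) => [->//|_];
  rewrite eqxx. Qed.

Lemma insupp_bar x : WI x -> insupp WI (bar (Tt x)).
Proof.
move: x; apply: gen_ind => [|s x Is Ix lt IH].
  by rewrite bar_T0 ?ell1 //; apply: insupp_Tt; exact: generated1.
rewrite (bar_Tt_Cs hbar (fins_S Is) lt).
apply: insuppD; last by rewrite -scaleNr; exact: insuppZ.
by apply: (insupp_op (kl_opl hbar (fins_S Is))) IH => y; exact: gen_mull.
Qed.

Lemma longestP : generated I (longest I) /\
  forall y : weyl R, generated I y -> (ell (fin y) <= lI)%N.
Proof.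
apply: (@xgetPex _ 1%g [set w | generated I w /\
  forall y : weyl R, generated I y -> (ell (fin y) <= ell (fin w))%N]).
have [r [ur rE]] := gen_enum.
have memr a : a \in r <-> generated I a by rewrite rE.
have [|w [/memr Iw _ maxw]] := @seq_argmax _ r (fun=> True) (fun a =>
  (ell (fin a))%:Z).
  by exists 1%g => //; apply/memr; exact: generated1.
exists w; split=> // y /memr yr; have := maxw y yr Logic.I; lia.
Qed.

(** The image under bar is supported on W_I and killed by every C'_s, so its coefficients are again
    proportional to (-v^-1)^l(x). The factor is read off at the longest element. *)
Lemma bar_Cw : bar (Cw I H) = Cw I H.
Proof.
have [r [ur rE]] := gen_enum;
  have memr a : a \in r <-> generated I a by rewrite rE.
have [Iw maxw] := longestP; set w := fin (longest I) in maxw *.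
pose d (y : weyl R) : laurent := (- vinv) ^+ lI * (- v) ^+ ell (fin y).
have bE : bar (Cw I H) = \sum_(y <- r) d y *: bar (Tt (fin y)).
  rewrite (CwE ur rE) rmorph_sum; apply: eq_bigr => y _; apply: barZ.
  by apply: barredM; apply: barredX; apply: barredN;
    [exact: barred_v|exact: barred_vinv].
have supp : insupp WI (bar (Cw I H)).
  rewrite bE; apply: insupp_sum => y /memr Iy; apply: insuppZ.
  by apply: insupp_bar; exact: gen_fin.
have tcx x : WI x -> tc (bar (Cw I H)) x = (- vinv) ^+ ell x * tc (bar (Cw I
  H)) 1%g.
  move: x; apply: gen_ind => [|s x Is Ix lt IH].
    by rewrite ell1 expr0 mul1r.
  have Ss := fins_S Is.
  have : tc (Cs H s * bar (Cw I H)) x = 0.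
    by rewrite -(bar_Cs hbar Ss) -rmorphM Cs_Cw // rmorph0 tc0.
  rewrite (tc_op (kl_opl hbar Ss)) /kap lt => /eqP; rewrite addr_eq0 => /eqP ->.
  have -> : ell (s * x)%g = (ell x).+1 by have := ell_mull x Ss; lia.
  by rewrite IH exprS !mulNr mulrA.
(* By unitriangularity only the term of the longest element itself contributes here. *)
have tcw : tc (bar (Cw I H)) w = 1.
  rewrite bE tc_sum (bigD1_seq (longest I)) //=; last by apply/memr.
  rewrite tcZ (proj1 (bar_Tt hbar _)) mulr1 big1_seq ?addr0.
    by rewrite /d -exprMn mulrNN vinv_v expr1n.
  move=> y /andP[yw /memr Iy]; rewrite tcZ.
  have [->|nz] := eqVneq (tc (bar (Tt (fin y))) w) 0; first by rewrite mulr0.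
  have wy : w <> fin y by move=> /fin_inj wy; rewrite wy eqxx in yw.
  by have := proj2 (bar_Tt hbar (fin y)) w wy nz; have := maxw y Iy;
    rewrite /w; lia.
have t1 : tc (bar (Cw I H)) 1%g = (- v) ^+ lI.
  have := tcx w (gen_fin Iw);
    rewrite tcw => /(congr1 (fun e => (- v) ^+ lI * e)).
  by rewrite mulr1 mulrA -exprMn mulrNN v_vinv expr1n mul1r => <-.
apply: tc_ext => x; rewrite tc_Cw; case: asboolP => [Ix|nIx].
  by rewrite tcx // t1 mulrC.
by apply/eqP; apply: contraT => /supp.
Qed.

End OneParabolic.
End Symmetrizer.

(** * The map chi and its triangularity *)

Section Projection.
Variables (n : nat) (R : rootDatum n) (H : affineHecke R).
Variables (bar : {rmorphism H -> H}).
Hypothesis hbar : bar_involution bar.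
Variable C' : extWeyl R -> H.
Hypothesis hC' : forall x, is_kl bar x (C' x).
Variables I J : set (weyl R).
Hypotheses (hI : I `<=` simple_refl R) (hJ : J `<=` simple_refl R).
Notation AR := (affine_roots R).
Notation W := (extWeyl R).
Notation S := (simples AR).
Notation Tt := (Tt H).
Notation WI := (generated (fins I)).
Notation WJ := (generated (fins J)).
Notation chi := (chi I J).
Notation red := (reduced AR (fins I) (fins J)).
Implicit Types (h : H) (x y z s m : W) (c d : laurent).

Lemma chiD h h' : chi (h + h') = chi h + chi h'.
Proof. by rewrite /Defs.chi mulrDr mulrDl. Qed.

Lemma chiZ c h : chi (c *: h) = c *: chi h.
Proof. by rewrite /Defs.chi -(scalerAr c) -(scalerAl c). Qed.

Lemma chi_sum (U : Type) (r : seq U) (F : U -> H) :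
  chi (\sum_(i <- r) F i) = \sum_(i <- r) chi (F i).
Proof.
apply: (big_morph chi chiD).
by rewrite /Defs.chi mulr0 mul0r.
Qed.

Lemma bar_chi h : bar h = h -> bar (chi h) = chi h.
Proof. by move=> bh; rewrite /Defs.chi !rmorphM /= (bar_Cw hbar hI) (bar_Cw
  hbar hJ) bh. Qed.

Lemma chi_not_reduced x : ~ red x -> chi (C' x) = 0.
Proof.
move=> nr.
have [[s Is lt]|nI] := pselect (exists2 s,
  fins I s & (ell (s * x)%g < ell x)%N).
  have Ss := fins_S hI Is.
  have E := kl_op_descent hbar hC' (kl_opl hbar Ss) lt.
  rewrite /Defs.chi; suff -> : Cw I H * C' x = 0 by rewrite mul0r.
  (* Here (v + v^-1) C_{w_I} C'_x = C_{w_I} C'_s C'_x = 0. *)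
  apply: hecke_torsion_free v_plus_vinv_neq0 _.
  by rewrite scalerAr -E mulrA (Cw_Cs hbar hI Is) mul0r.
have [[s Js lt]|nJ] := pselect (exists2 s,
  fins J s & (ell (x * s)%g < ell x)%N).
  have Ss := fins_S hJ Js.
  have E := kl_op_descent hbar hC' (kl_opr hbar Ss) lt.
  rewrite /Defs.chi -mulrA; suff -> : C' x * Cw J H = 0 by rewrite mulr0.
  apply: hecke_torsion_free v_plus_vinv_neq0 _.
  by rewrite scalerAl -E -mulrA (Cs_Cw hbar hJ Js) mulr0.
case: nr; split=> s Ks; rewrite -!ellE ltnNge; apply/negP => le.
  apply: nI; exists s => //; case: (ell_mull x (fins_S hI Ks)) => [E|->] //.
  by move: le; rewrite E ltnn.
apply: nJ; exists s => //; case: (ell_mulr x (fins_S hJ Ks)) => [E|->] //.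
by move: le; rewrite E ltnn.
Qed.

Lemma Tt_Cs_r s x : S s -> (ell x < ell (x * s)%g)%N ->
  Tt (x * s)%g = Tt x * Cs H s - vinv *: Tt x.
Proof. by move=> Ss lt; rewrite (kl_op_up (kl_opr hbar Ss) lt) addrK. Qed.

Lemma insuppB D h h' : insupp D h -> insupp D h' -> insupp (H := H) D (h - h').
Proof.
move=> Dh Dh'; apply: (insuppD Dh); rewrite -scaleN1r.
exact: insuppZ Dh'.
Qed.

Lemma insupp_gen_mull D h x : (forall s y, fins I s -> D y -> D (s * y)%g) ->
  WI x -> insupp D h -> insupp D (Tt x * h).
Proof.
move=> Ds Ix Dh; move: x Ix; apply: (gen_ind hI) => [|s x Is Ix lt IH].
  by rewrite Tt_one mul1r.
have Ss := fins_S hI Is.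
rewrite (Tt_Cs hbar Ss lt) mulrBl -mulrA -scalerAl; apply: insuppB;
  last exact: insuppZ.
by apply: (insupp_op (kl_opl hbar Ss)) IH => y; exact: Ds.
Qed.

Lemma insupp_gen_mulr D h x : (forall s y, fins J s -> D y -> D (y * s)%g) ->
  WJ x -> insupp D h -> insupp D (h * Tt x).
Proof.
move=> Ds Jx Dh; move: x Jx; apply: (gen_ind_r hJ) => [|s x Js Jx lt IH].
  by rewrite Tt_one mulr1.
have Ss := fins_S hJ Js.
rewrite (Tt_Cs_r Ss lt) mulrBr mulrA -scalerAr; apply: insuppB;
  last exact: insuppZ.
by apply: (insupp_op (kl_opr hbar Ss)) IH => y; exact: Ds.
Qed.

Definition dcoset x : set W :=
  [set y | exists a b, [/\ generated I a,
    generated J b & y = (fin a * x * fin b)%g]].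

Lemma insupp_chi x : insupp (dcoset x) (chi (Tt x)).
Proof.
have [r [ur rE]] := gen_enum I; have [r' [ur' rE']] := gen_enum J.
rewrite /Defs.chi (CwE H ur rE) (CwE H ur' rE') mulr_suml.
rewrite mulr_suml; apply: insupp_sum => a ar; rewrite mulr_sumr.
apply: insupp_sum => b br.
rewrite -!scalerAl -!scalerAr; do 2 apply: insuppZ.
have Ia : generated I a by rewrite rE.
have Jb : generated J b by rewrite rE'.
apply: insupp_gen_mulr (gen_fin Jb) _.
  move=> _ y [s Js <-] [a' [b' [Ia' Jb' ->]]]; exists a', (b' * s)%g;
    split=> //.
    by apply: generatedM => //; exact: generated_in.
  by rewrite finM !gmulA.
apply: insupp_gen_mull (gen_fin Ia) _.
  move=> _ y [s Is <-] [a' [b' [Ia' Jb' ->]]]; exists (s * a')%g, b';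
    split=> //.
    by apply: generatedM => //; exact: generated_in.
  by rewrite finM !gmulA.
apply: insupp_Tt; exists 1%g, 1%g.
by split; [exact: generated1|exact: generated1|rewrite !fin1 mul1g mulg1].
Qed.

Lemma eq1_kap sig y : eq1 (kap sig y) 1.
Proof. by rewrite /kap; case: ifP => _; [exact: eq1_vinv|exact: eq1_v]. Qed.

Lemma eq1_shift c d e : eq1 d 1 -> eq1 (c + (d - vinv) * e) c.
Proof.
move=> d1; rewrite -{2}[c]addr0 -(mul0r e); apply: eq1D; first exact: eq1_refl.
apply: eq1M; last exact: eq1_refl.
by rewrite -(subrr 1); apply: eq1D => //; apply: eq1N; exact: eq1_vinv.
Qed.

(* At v = 1 the element Tt x acts as the group element x. *)
Lemma eq1_mull x : WI x -> forall h y,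
  eq1 (tc (Tt x * h) y) (tc h (x^-1 * y)%g).
Proof.
move: x; apply: (gen_ind hI) => [h y|s x Is Ix lt IH h y].
  by rewrite Tt_one mul1r invg1 mul1g; exact: eq1_refl.
have Ss := fins_S hI Is.
rewrite (Tt_Cs hbar Ss lt) mulrBl -mulrA -scalerAl tcD tcN tcZ (tc_op (kl_opl
  hbar Ss)).
rewrite -addrA -mulrBl ginvM -gmulA (S_inv Ss).
by apply: eq1_trans (IH h _); apply: eq1_shift; exact: eq1_kap.
Qed.

Lemma eq1_mulr x : WJ x -> forall h y,
  eq1 (tc (h * Tt x) y) (tc h (y * x^-1)%g).
Proof.
move: x; apply: (gen_ind_r hJ) => [h y|s x Js Jx lt IH h y].
  by rewrite Tt_one mulr1 invg1 mulg1; exact: eq1_refl.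
have Ss := fins_S hJ Js.
rewrite (Tt_Cs_r Ss lt) mulrBr mulrA -scalerAr tcD tcN tcZ (tc_op (kl_opr hbar
  Ss)).
rewrite -addrA -mulrBl ginvM gmulA (S_inv Ss).
by apply: eq1_trans (IH h _); apply: eq1_shift; exact: eq1_kap.
Qed.

Lemma odd_ellM x y : odd (ell (x * y)%g) = odd (ell x) (+) odd (ell y).
Proof.
move: x; apply: left_ind => [x x0|s x Ss lt IH].
  rewrite x0 /= !ellE -len_inv ginvM len_mul_domp ?len_inv //.
  by apply: dompV; apply: len0_domp; rewrite -ellE.
have -> : ell (s * x)%g = (ell x).+1 by have := ell_mull x Ss; lia.
rewrite -gmulA /= addNb -IH.
by case: (ell_mull (x * y)%g Ss) => E; rewrite E //= negbK.
Qed.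

Lemma odd_ellV x : odd (ell x^-1%g) = odd (ell x).
Proof. by rewrite !ellE len_inv. Qed.

Lemma eq1_sign k : eq1 ((- v) ^+ k) ((-1) ^+ k) /\ eq1 ((- vinv) ^+ k) ((-1) ^+
  k).
Proof.
by split; apply: eq1X; apply: eq1N; [exact: eq1_v|exact: eq1_vinv].
Qed.

Lemma tc_chi_Tt_neq0 m : tc (chi (Tt m)) m != 0.
Proof.
have [r [ur rE]] := gen_enum I; have [r' [ur' rE']] := gen_enum J.
have memr a : a \in r <-> generated I a by rewrite rE.
have memr' a : a \in r' <-> generated J a by rewrite rE'.
pose lI := ell (fin (longest I)); pose lJ := ell (fin (longest J)).
pose N := (\sum_(a <- r) \sum_(b <- r') ((fin a)^-1 * (m * (fin b)^-1) ==
  m)%g)%N.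
(* The pair (1, 1) is counted. *)
have N0 : N != 0%N.
  have r1 : 1%g \in r by apply/memr; exact: generated1.
  have r1' : 1%g \in r' by apply/memr'; exact: generated1.
  rewrite /N (bigD1_seq 1%g) //= (bigD1_seq 1%g r1' ur') /=.
  by rewrite !fin1 invg1 mulg1 mul1g eqxx.
apply: contra N0 => /eqP E; apply/eqP; apply: (@eq1_nat N (odd (lI + lJ))).
rewrite -E /Defs.chi (CwE H ur rE) (CwE H ur' rE') mulr_suml mulr_suml tc_sum.
rewrite signr_odd /N natr_sum mulr_sumr; apply: eq1_sum => a /memr Ia.
rewrite mulr_sumr tc_sum natr_sum mulr_sumr; apply: eq1_sum => b /memr' Jb.
rewrite -!scalerAl -scalerAr !tcZ.
have E1 : eq1 (tc (Tt (fin a) * Tt m * Tt (fin b)) m)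
    (((fin a)^-1 * (m * (fin b)^-1) == m)%g)%:R.
  apply: eq1_trans (eq1_mulr (gen_fin Jb) _ _) _.
  apply: eq1_trans (eq1_mull (gen_fin Ia) _ _) _.
  by rewrite tc_Tt; case: eqP => _; exact: eq1_refl.
have [sv sw] := eq1_sign lI; have [sv' sw'] := eq1_sign lJ.
have [_ sa] := eq1_sign (ell (fin a)); have [_ sb] := eq1_sign (ell (fin b)).
apply: eq1_trans (eq1M (eq1M sv sa) (eq1M (eq1M sv' sb) E1)) _.
case: eqP => [E2|_]; last by rewrite !mulr0; exact: eq1_refl.
have par : odd (ell (fin a)) = odd (ell (fin b)).
  have := congr1 (fun x : W => odd (ell x)) E2.
  rewrite /= !odd_ellM !odd_ellV.
  by case: (odd (ell (fin a))); case: (odd (ell (fin b))); case: (odd (ell m)).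
rewrite !mulr1 exprD -[(-1) ^+ ell (fin a)]signr_odd -[(-1) ^+ ell (fin
  b)]signr_odd par.
rewrite mulrACA -expr2 sqrr_sign mulr1; exact: eq1_refl.
Qed.

Lemma dcoset_double lam (z : weyl R) x y : double_coset I J lam z x ->
  dcoset y x ->
  double_coset I J lam z y.
Proof.
move=> dx [a [b [Ia Jb E]]].
have -> : y = (fin a^-1 * x * fin b^-1)%g.
  by rewrite E !finV !gmulA mulVg mul1g mulgK.
by apply: double_cosetM dx; exact: generatedV.
Qed.

(** A basis element x of C'_m whose image reaches m0 lies in the double coset of m0, so l(m0) <=
    l(x) <= l(m) <= l(m0). This forces x = m, and a reduced m in that double coset is m0. *)
Lemma tc_chi_kl m lam (z : weyl R) : red m -> let m0 := min_elt I J lam z in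
  (ell m <= ell m0)%N ->
  tc (chi (C' m)) m0 = if m == m0 then tc (chi (Tt m0)) m0 else 0.
Proof.
move=> rm m0 le; have rm0 : red m0 by exact: min_elt_reduced.
have [dm0 minm0] := min_eltP I J lam z.
have [_ m1 _ mlt] := is_kl_form (hC' m).
have [s [us ms ->]] := tc_linear (C' m) m0 chiD chiZ.
have nz x : x \in s -> tc (chi (Tt x)) m0 != 0 -> x = m /\ m = m0.
  move=> xs /insupp_chi dx; have dx' := dcoset_double dm0 dx.
  have lex := minm0 x dx'.
  have xm : x = m.
    apply: contrapT => xm; have := mlt x xm; rewrite -ms xs => /(_ isT) lt.
    by have := leq_ltn_trans lex (leq_trans lt le); rewrite ltnn.
  by split=> //; rewrite -xm; apply: (double_coset_reduced hI hJ dx');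
    rewrite xm.
have [mm0|mm0] := eqVneq m m0; last first.
  rewrite big1_seq // => x /andP[_ xs];
    have [->|/(nz x xs)[_ /eqP]] := eqVneq (tc (chi (Tt x)) m0) 0.
    by rewrite mulr0.
  by rewrite (negPf mm0).
have m0s : m0 \in s by rewrite ms -mm0 m1 oner_neq0.
rewrite (bigD1_seq m0) //= -{1}mm0 m1 mul1r big1_seq ?addr0 // =>
  x /andP[xm0 xs].
have [->|/(nz x xs)[xm _]] := eqVneq (tc (chi (Tt x)) m0) 0;
  first by rewrite mulr0.
by rewrite xm mm0 eqxx in xm0.
Qed.

Definition kl_span h : Prop :=
  exists l : seq (laurent * W), h = \sum_(p <- l) p.1 *: C' p.2.

Lemma kl_spanD h h' : kl_span h -> kl_span h' -> kl_span (h + h').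
Proof. by move=> [l ->] [l' ->]; exists (l ++ l'); rewrite big_cat. Qed.

Lemma kl_spanZ c h : kl_span h -> kl_span (c *: h).
Proof.
move=> [l ->]; exists [seq (c * p.1, p.2) | p <- l].
by rewrite big_map scaler_sumr; apply: eq_bigr => p _; rewrite scalerA.
Qed.

Lemma kl_span_Tt x : kl_span (Tt x).
Proof.
have [k] := ubnP (ell x); elim: k => // k IH in x * => lek.
have [_ x1 _ xlt] := is_kl_form (hC' x).
have [s [us ms E]] := tcP (C' x).
have xs : x \in s by rewrite ms x1 oner_neq0.
have -> : Tt x = C' x - \sum_(y <- s | y != x) tc (C' x) y *: Tt y.
  by rewrite {1}E (bigD1_seq x) //= x1 scale1r addrK.
apply: kl_spanD.
  by exists [:: (1, x)]; rewrite big_seq1 scale1r.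
rewrite -scaleN1r; apply: kl_spanZ; rewrite big_seq_cond.
apply: big_ind => [|h h'|y /andP[ys /eqP yx]]; first by exists [::];
  rewrite big_nil.
  exact: kl_spanD.
apply: kl_spanZ; apply: IH; apply: leq_trans (xlt y yx _) _;
  last by rewrite -ltnS.
by rewrite -ms.
Qed.

Lemma kl_spanT h : kl_span h.
Proof.
apply: (@Tt_ind _ _ H) h => [|h h'|c x]; first by exists [::]; rewrite big_nil.
  exact: kl_spanD.
by apply: kl_spanZ; exact: kl_span_Tt.
Qed.

Lemma klIJ_basis : basis_on (indexIJ I J) (klIJ I J C') (heckeIJ H I J).
Proof.
split.
- by move=> p _; exists (C' (min_elt I J p.1 p.2)).
- move=> s c us sP E k ks; apply/eqP; apply: contraT => ck.
  (* For k0 with longest m among the nonzero coefficients, the coefficient of the relation at that m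
     involves k0 alone. *)
  have [|k0 [k0s ck0 maxk]] := @seq_argmax _ s (fun k => c k != 0)
      (fun k => (ell (min_elt I J k.1 k.2))%:Z).
    by exists k.
  have /(congr1 (fun h => tc h (min_elt I J k0.1 k0.2))) := E.
  rewrite tc0 tc_sum (bigD1_seq k0) //= tcZ.
  have rmin k' : red (min_elt I J k'.1 k'.2) by exact: min_elt_reduced.
  rewrite [tc (klIJ _ _ _ _) _](tc_chi_kl (lam := k0.1) (z :=
    k0.2) (rmin k0)) // eqxx.
  rewrite big1_seq ?addr0 => [|k' /andP[k'k0 k's]].
    move=> /laurent_mulf_eq0[ck00|]; first by rewrite ck00 eqxx in ck0.
    by move/eqP; rewrite (negPf (tc_chi_Tt_neq0 _)).
  have [ck'|ck'] := eqVneq (c k') 0; first by rewrite ck' scale0r tc0.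
  rewrite tcZ [tc (klIJ _ _ _ _) _](tc_chi_kl (lam := k0.1) (z :=
    k0.2) (rmin k')).
    case: eqP => [Em|_]; last by rewrite mulr0.
    by move: k'k0; rewrite (index_inj hI hJ (sP _ k's) (sP _ k0s) Em) eqxx.
  by have := maxk k' k's ck'; rewrite lez_nat.
- move=> _ [h _ <-]; have [l ->] := kl_spanT h.
  (* Applying chi to a combination of the C'_x drops the terms with x not reduced and turns each
     remaining one into a member of the family. *)
  have [l' [l'P E]] : exists l' : seq (laurent * ('cV[int]_n * weyl R)),
      (forall p, p \in l' -> indexIJ I J p.2) /\
      chi (\sum_(p <- l) p.1 *: C' p.2) = \sum_(p <- l') p.1 *: klIJ I J C' p.2.
    rewrite chi_sum; elim: l => [|[c x] l [l' [l'P IH]]].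
      by exists [::]; rewrite !big_nil.
    rewrite big_cons chiZ /= IH; have [rx|nrx] := pselect (red x).
      have [p [ip ->]] := reduced_index hI hJ rx.
      exists ((c, p) :: l'); rewrite big_cons; split=> // q.
      by rewrite inE => /predU1P[->//|/l'P].
    by exists l'; rewrite chi_not_reduced // scaler0 add0r.
  rewrite E; have [c [_ ->]] := sum_collect (klIJ I J C') l'.
  exists (undup [seq p.2 | p <- l']), c; split=> // k.
  by rewrite mem_undup => /mapP[p /l'P ip ->].
Qed.

End Projection.

Theorem proposition4p2 (n : nat) (R : rootDatum n)
    (hR : simply_connected_derived R) (H : affineHecke R)
    (bar : {rmorphism H -> H}) (hbar : bar_involution bar)
    (C' : extWeyl R -> H) (hC' : forall x, is_kl bar x (C' x))
    (I J : set (weyl R)) (hI : I `<=` simple_refl R)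
    (hJ : J `<=` simple_refl R) :
  [/\ basis_on (indexIJ I J) (klIJ I J C') (heckeIJ H I J),
      (forall p, indexIJ I J p -> bar (klIJ I J C' p) = klIJ I J C' p),
      (forall lam z, indexIJ I J (lam, z) ->
         chi I J (C' (min_elt I J lam z)) = klIJ I J C' (lam, z))
    & (forall x,
         (forall lam z, indexIJ I J (lam, z) -> x <> min_elt I J lam z) ->
         chi I J (C' x) = 0)].
Proof.
split.
- exact: (klIJ_basis hbar hC' hI hJ).
- by move=> p _; apply: (bar_chi hbar hI hJ);
  have [-> _] := hC' (min_elt I J p.1 p.2).
- by [].
- move=> x nx; apply: (chi_not_reduced hbar hC' hI hJ) => rx.
  by have [[lam z] [ip /nx]] := reduced_index hI hJ rx; apply.
Qed.
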